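(* Let $G = PSL(2,17)$. If $u$ is a torsion unit of $V(\mathbb{Z}G)$, then $u$ is rationally conjugate to some element $g \in G$, i.e. there exist $g \in G$ and a unit $x$ of the rational group ring $\mathbb{Q}G$ such that $x^{-1} u x = g$. Hence the Zassenhaus Conjecture is true for $G$.
   Context: For a finite group $G$, $\mathbb{Z}G$ denotes the integral group ring and $\mathbb{Q}G \supseteq \mathbb{Z}G$ the rational group ring. $V(\mathbb{Z}G)$ is the group of units $u = \sum_{g\in G} a_g g$ of $\mathbb{Z}G$ of augmentation one, i.e. with $\sum_{g\in G} a_g = 1$. A torsion unit of $V(\mathbb{Z}G)$ means an element of finite order in $V(\mathbb{Z}G)\setminus\{1\}$. A torsion unit $u\in V(\mathbb{Z}G)$ is rationally conjugate to a group element $g\in G$ if it is conjugate to $g$ by a unit of $\mathbb{Q}G$. The Zassenhaus Conjecture for $G$ is the assertion that every torsion unit in $V(\mathbb{Z}G)$ is rationally conjugate to an element of $G$. $PSL(2,17)$ is the projective special linear group of degree $2$ over the field with $17$ elements. *)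

(* Defs.v *)
From HB Require Import structures.
From mathcomp Require Import all_boot all_order all_fingroup all_algebra all_solvable.
From mathcomp Require Import boolp.

Set Implicit Arguments.
Unset Strict Implicit.
Unset Printing Implicit Defensive.

Import GRing.Theory.
Local Open Scope ring_scope.

(* The group ring R[gT].  A one-field record rather than a transparent alias of
   {ffun gT -> R}, whose canonical multiplication is pointwise. *)
Record group_ring (R : nzRingType) (gT : finGroupType) :=
  GroupRing { gr_coef : {ffun gT -> R} }.

HB.instance Definition _ R gT := [isNew for @gr_coef R gT].
HB.instance Definition _ R gT := [Choice of group_ring R gT by <:].

Section GroupRing.
Variables (R : nzRingType) (gT : finGroupType).
Implicit Types a b c : group_ring R gT.

Definition gr_zero : group_ring R gT := GroupRing 0.
Definition gr_opp a := GroupRing (- gr_coef a).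
Definition gr_add a b := GroupRing (gr_coef a + gr_coef b).

Fact gr_addA : associative gr_add.
Proof. by move=> a b c; rewrite /gr_add /= addrA. Qed.
Fact gr_addC : commutative gr_add.
Proof. by move=> a b; rewrite /gr_add addrC. Qed.
Fact gr_add0 : left_id gr_zero gr_add.
Proof. by case=> a; rewrite /gr_add add0r. Qed.
Fact gr_addN : left_inverse gr_zero gr_opp gr_add.
Proof. by move=> a; rewrite /gr_add addNr. Qed.

HB.instance Definition _ :=
  GRing.isZmodule.Build (group_ring R gT) gr_addA gr_addC gr_add0 gr_addN.

Definition gr_elt (g : gT) : group_ring R gT :=
  GroupRing [ffun x => (x == g)%:R].

Definition gr_mul a b : group_ring R gT :=
  GroupRing [ffun x => \sum_(y : gT) gr_coef a y * gr_coef b (y^-1 * x)%g].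

Lemma group_ringP a b : (forall x, gr_coef a x = gr_coef b x) -> a = b.
Proof. by move=> eq_ab; apply/val_inj/ffunP. Qed.

Lemma gr_coef_add a b x : gr_coef (a + b) x = gr_coef a x + gr_coef b x.
Proof. by rewrite ffunE. Qed.

Fact gr_mulA : associative gr_mul.
Proof.
move=> a b c; apply: group_ringP => x; rewrite !ffunE.
under [RHS]eq_bigr => z _ do rewrite ffunE mulr_suml.
rewrite exchange_big; apply: eq_bigr => y _ /=.
rewrite ffunE mulr_sumr (reindex_inj (mulgI y^-1%g)) /=.
by apply: eq_bigr => z _; rewrite invMg invgK mulrA !mulgA mulgK.
Qed.

Fact gr_mul1 : left_id (gr_elt 1) gr_mul.
Proof.
move=> a; apply: group_ringP => x; rewrite ffunE (bigD1 1%g) //= big1.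
  by rewrite ffunE eqxx mul1r invg1 mul1g addr0.
by move=> y /negPf y1; rewrite ffunE y1 mul0r.
Qed.

Fact gr_1mul : right_id (gr_elt 1) gr_mul.
Proof.
move=> a; apply: group_ringP => x; rewrite ffunE (bigD1 x) //= big1.
  by rewrite ffunE mulVg eqxx mulr1 addr0.
move=> y /negPf yx; rewrite ffunE -eq_mulVg1.
by rewrite yx mulr0.
Qed.

Fact gr_mulDl : left_distributive gr_mul +%R.
Proof.
move=> a b c; apply: group_ringP => x; rewrite gr_coef_add !ffunE -big_split.
by apply: eq_bigr => y _; rewrite gr_coef_add mulrDl.
Qed.

Fact gr_mulDr : right_distributive gr_mul +%R.
Proof.
move=> a b c; apply: group_ringP => x; rewrite gr_coef_add !ffunE -big_split.
by apply: eq_bigr => y _; rewrite gr_coef_add mulrDr.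
Qed.

Fact gr_oner_neq0 : gr_elt 1 != 0.
Proof.
apply/eqP=> /(congr1 (fun a => gr_coef a 1%g)); rewrite !ffunE eqxx.
exact/eqP/oner_neq0.
Qed.

HB.instance Definition _ := GRing.Zmodule_isNzRing.Build (group_ring R gT)
  gr_mulA gr_mul1 gr_1mul gr_mulDl gr_mulDr gr_oner_neq0.

(* Over an arbitrary coefficient ring invertibility is not decidable, hence the
   classical choice of the two-sided inverse; non-units are their own inverse. *)
Definition gr_is_inv a b := b * a = 1 /\ a * b = 1.
Definition gr_unit : pred (group_ring R gT) := fun a => `[< exists b, gr_is_inv a b >].
Definition gr_inv a :=
  if pselect (exists b, gr_is_inv a b) is left ex_b then projT1 (cid ex_b) else a.

Fact gr_invP a : a \in gr_unit -> gr_is_inv a (gr_inv a).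
Proof.
by move/asboolP=> ex_b; rewrite /gr_inv; case: pselect => // ?; case: cid.
Qed.
Fact gr_mulVr : {in gr_unit, left_inverse 1 gr_inv *%R}.
Proof. by move=> a /gr_invP[]. Qed.
Fact gr_mulrV : {in gr_unit, right_inverse 1 gr_inv *%R}.
Proof. by move=> a /gr_invP[]. Qed.
Fact gr_unitP a b : gr_is_inv a b -> gr_unit a.
Proof. by move=> inv_ab; apply/asboolP; exists b. Qed.
Fact gr_inv_out : {in [predC gr_unit], gr_inv =1 id}.
Proof.
by move=> a /asboolP/= nex; rewrite /gr_inv; case: pselect => // /nex.
Qed.

HB.instance Definition _ := GRing.NzRing_hasMulInverse.Build (group_ring R gT)
  gr_mulVr gr_mulrV gr_unitP gr_inv_out.

Definition augmentation a : R := \sum_(g : gT) gr_coef a g.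

End GroupRing.

Arguments gr_elt {R gT} g.

Definition ZG_to_QG (gT : finGroupType) (u : group_ring int gT) :
    group_ring rat gT :=
  GroupRing [ffun g => (gr_coef u g)%:~R].

Definition V_ZG (gT : finGroupType) : pred (group_ring int gT) :=
  fun u => (u \is a GRing.unit) && (augmentation u == 1).

Definition torsion_unit (gT : finGroupType) (u : group_ring int gT) : Prop :=
  [/\ u \in @V_ZG gT, u != 1 & exists2 n : nat, (0 < n)%N & u ^+ n = 1].

Definition rationally_conjugate (gT : finGroupType)
    (u : group_ring int gT) (g : gT) : Prop :=
  exists2 x : group_ring rat gT,
    x \is a GRing.unit & x^-1 * ZG_to_QG u * x = gr_elt g.

Definition Zassenhaus_conjecture (gT : finGroupType) : Prop :=
  forall u : group_ring int gT,
    torsion_unit u -> exists g : gT, rationally_conjugate u g.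

Section ProjectiveSpecialLinear.
Variables (n : nat) (F : finFieldType).

(* As for {'GL_n[F]}, the dimension is n only for 0 < n (it is n.-1.+1). *)
Definition SL : {set {'GL_n[F]}} := [set A | \det (GLval A) == 1].

Fact SL_group_set : group_set SL.
Proof.
apply/group_setP; split=> [|A B]; first by rewrite inE GL_1E det1.
by rewrite !inE GL_MxE det_mulmx => /eqP-> /eqP->; rewrite mulr1.
Qed.
Canonical SL_group := Group SL_group_set.

Definition PSL : {group coset_of 'Z(SL)} := (SL / 'Z(SL))%G.

End ProjectiveSpecialLinear.

(* Main.v *)
(** The proof is the Luthar-Passi-Hertweck method with complex characters
    replaced by elementary substitutes.  By Hertweck's and Berman-Higman's
    theorems, the partial augmentations [paug u x] of a torsion unit [u] of
    order [n] vanish unless the order of [x] divides [n] and [x <> 1].  The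
    remaining ones satisfy [\sum_x #|'C[x]| * paug u x ^ 2 <= #|G|], the
    congruences coming from [u -> u ^+ p] in characteristic [p], and the
    condition that eigenvalue multiplicities of [u] are nonnegative integers
    bounded by the dimension.  For [n] prime to 17 the representations used are
    the second and fourth symmetric powers of the natural module over 'F_17,
    of dimensions 3 and 5: a multiplicity at most 5 is determined by its
    residue modulo 17.  For [n = 17] it is a complex representation of degree 9.
    These constraints exclude the orders 6, 16, 34 and 51 and force [u] to have
    the partial augmentations of a group element [g], and then so do all powers.
    Therefore [u] and [g] give isomorphic representations of [G * Z/n] on the
    complex group algebra; an intertwiner commuting with left multiplication is
    a right multiplication, and it can be chosen rational. *)

Require Import Defs.
From HB Require Import structures.
From mathcomp Require Import all_boot all_order all_fingroup all_algebra all_solvable.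
From mathcomp Require Import all_field all_character.
From mathcomp Require Import boolp zify ring lra.
Import Order.TTheory GRing.Theory Num.Theory.
Import Defs.
Local Open Scope ring_scope.

Set Implicit Arguments.
Unset Strict Implicit.
Unset Printing Implicit Defensive.

(** * Eigenvalue multiplicities of matrices of finite order *)

(** The substitute for ordinary characters is one trace. The operator v -> x^-1 v u on the integral
    group algebra is an integer matrix of finite order, and its trace is the partial augmentation of
    [u] at [x] times the order of the centralizer of [x]. Vanishing, behaviour under coprime powers
    and the quadratic bound thus become facts about traces of integral torsion matrices. The
    defining characteristic suits the orders prime to 17 because the eigenvalues [z] needed satisfy
    z^16 = 1 or z^18 = 1: then z + z^-1 lies in the prime field, where all multiplicities are
    computed. It says nothing in order 17, where [u] acts unipotently. The two classes of that order
    are separated by the values (1 + sqrt 17)/2 and (1 - sqrt 17)/2 of a character of degree (17 +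
    1)/2 = 9, one half of the functions on the plane that transform by the quadratic character.
    Multiplicities fix partial augmentations only modulo 17, and the quadratic bound alone leaves
    spurious values such as -16. Those are removed by the congruence for the coefficient of u^(p^a)
    at the identity, or by the bound once several partial augmentations are known. *)

Lemma mxtrace_idem (F : fieldType) d (A : 'M[F]_d) :
  A *m A = A -> \tr A = (\rank A)%:R.
Proof.
rewrite -{1 2 3}(mulmx_base A) => AA.
(* In the factorization of [A] into a column base and a row base, both can be cancelled from
   [A *m A = A]; the product in the other order is then the identity, of size the rank, and has the
   same trace. *)
have {}AA : row_base A *m col_base A = 1%:M.
  have /(row_free_inj (row_base_free A)) AA1 :
      col_base A *m (row_base A *m col_base A) *m row_base A = col_base A *m row_base A.
    by rewrite -[RHS]AA !mulmxA.
  have cf : row_free (col_base A)^T by rewrite /row_free mxrank_tr; apply: col_base_full.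
  apply: trmx_inj; apply: (row_free_inj cf).
  by rewrite -trmx_mul AA1 trmx1 mul1mx.
by rewrite -{1}(mulmx_base A) mxtrace_mulC AA mxtrace1.
Qed.

(* [B] is only assumed multiplicative on exponents: [B 0] is an idempotent,
   not necessarily the identity. *)
Section RootProjector.
Variables (F : fieldType) (d n : nat) (B : nat -> 'M[F]_d).
Hypothesis BM : forall i j, B i *m B j = B (i + j)%N.
Hypothesis Bn : B n = B 0%N.
Hypothesis n_neq0 : n%:R != 0 :> F.

Definition root_proj (xi : F) := n%:R^-1 *: \sum_(k < n) xi ^- k *: B k.

Lemma root_proj_tr xi : n%:R * \tr (root_proj xi) = \sum_(k < n) xi ^- k * \tr (B k).
Proof.
rewrite /root_proj mxtraceZ mulrA divff // mul1r raddf_sum.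
by apply: eq_bigr => k _; rewrite /= mxtraceZ.
Qed.

Lemma mul_root_proj xi i : xi ^+ n = 1 -> B i *m root_proj xi = xi ^+ i *: root_proj xi.
Proof.
move=> xi1; have n_gt0: (0 < n)%N by case: (n) n_neq0 => //; rewrite eqxx.
have xi0 : xi != 0 by apply: contra_eq_neq xi1 => ->; rewrite expr0n gtn_eqF // eq_sym oner_eq0.
elim: i => [|i IHi].
  rewrite scale1r /root_proj -scalemxAr mulmx_sumr; congr (_ *: _).
  by apply: eq_bigr => k _; rewrite /= -scalemxAr BM.
rewrite -addn1 -BM -mulmxA (_ : B 1%N *m root_proj xi = xi *: root_proj xi); last first.
  rewrite /root_proj -scalemxAr !scalerA mulrC -scalerA; congr (_ *: _).
  rewrite mulmx_sumr scaler_sumr -(big_mkord xpredT (fun k => B 1%N *m (xi ^- k *: B k))).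
  rewrite -(big_mkord xpredT (fun k => xi *: (xi ^- k *: B k))).
  rewrite [LHS](eq_bigr (fun k => xi *: (xi ^- k.+1 *: B k.+1))); last first.
    move=> k _; rewrite /= -scalemxAr BM add1n scalerA; congr (_ *: _).
    by rewrite exprS invfM mulrA divff // mul1r.
  case: (n) n_gt0 xi1 Bn => // n' _ xi1 Bn'.
  rewrite big_nat_recr // [RHS]big_nat_recl //= addrC; congr (_ + _).
  by rewrite Bn' xi1 expr0.
by rewrite -scalemxAr IHi scalerA -exprS addn1.
Qed.

Lemma root_proj_idem xi : xi ^+ n = 1 -> root_proj xi *m root_proj xi = root_proj xi.
Proof.
move=> xi1; have n_gt0: (0 < n)%N by case: (n) n_neq0 => //; rewrite eqxx.
have xi0 : xi != 0 by apply: contra_eq_neq xi1 => ->; rewrite expr0n gtn_eqF // eq_sym oner_eq0.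
rewrite {1}/root_proj -scalemxAl mulmx_suml.
rewrite (eq_bigr (fun=> root_proj xi)); last first.
  move=> k _; rewrite -scalemxAl mul_root_proj // scalerA mulVf ?scale1r //.
  by rewrite expf_neq0.
by rewrite sumr_const card_ord -scaler_nat scalerA mulVf // scale1r.
Qed.

Lemma root_mult xi : xi ^+ n = 1 ->
  n%:R * (\rank (root_proj xi))%:R = \sum_(k < n) xi ^- k * \tr (B k).
Proof. by move=> xi1; rewrite -mxtrace_idem ?root_proj_idem // root_proj_tr. Qed.

Lemma sum_root_proj z : n.-primitive_root z -> \sum_(j < n) root_proj (z ^+ j) = B 0.
Proof.
move=> prz; have n_gt0 := prim_order_gt0 prz.
have z0 : z != 0.
  by apply: contra_eq_neq (prim_expr_order prz) => ->; rewrite expr0n gtn_eqF // eq_sym oner_eq0.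
rewrite -scaler_sumr exchange_big /= (bigD1 (Ordinal n_gt0)) //= [X in _ + X]big1 => [|k k0].
  rewrite addr0 (eq_bigr (fun=> B 0)) => [|j _]; last by rewrite expr0 invr1 scale1r.
  by rewrite sumr_const card_ord -scaler_nat scalerA mulVf // scale1r.
rewrite -scaler_suml (_ : \sum_j _ = 0) ?scale0r //.
have zk : z ^- k != 1.
  rewrite invr_eq1 -(prim_order_dvd prz) gtnNdvd //.
  by rewrite lt0n -val_eqE in k0 *.
apply: (mulIf (_ : 1 - z ^- k != 0)); first by rewrite subr_eq0 eq_sym.
rewrite mul0r mulrC (eq_bigr (fun j : 'I_n => (z ^- k) ^+ j)) => [|j _]; last first.
  by rewrite exprAC exprVn.
have := subrX1 (z ^- k) n.
rewrite (_ : (z ^- k) ^+ n = 1) ?subrr; last by rewrite exprVn exprAC (prim_expr_order prz) expr1n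
  invr1.
by move=> e; apply/eqP; rewrite -oppr_eq0 -mulNr opprB -e.
Qed.

End RootProjector.

Section TorsionMatrix.
Variables (F : fieldType) (d n : nat) (A : 'M[F]_d) (z : F).
Hypotheses (An : A ^+ n = 1) (prz : n.-primitive_root z) (n_neq0 : n%:R != 0 :> F).

Definition eigen_mult j := \rank (root_proj n (fun k => A ^+ k) (z ^+ j)).

Let AD i j : A ^+ i *m A ^+ j = A ^+ (i + j). Proof. by rewrite exprD. Qed.
Let A0 : A ^+ n = A ^+ 0. Proof. by rewrite An expr0. Qed.
Let zn j : (z ^+ j) ^+ n = 1. Proof. by rewrite exprAC (prim_expr_order prz) expr1n. Qed.

Lemma mxtrace_eigen_mult k :
  \tr (A ^+ k) = \sum_(j < n) (eigen_mult j)%:R * z ^+ (j * k).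
Proof.
rewrite -[A ^+ k]mulr1 -(expr0 A) -(sum_root_proj (fun k => A ^+ k) n_neq0 prz).
rewrite mulr_sumr raddf_sum; apply: eq_bigr => j _ /=.
rewrite (_ : _ * _ = (z ^+ j) ^+ k *: root_proj n (fun k => A ^+ k) (z ^+ j)); last first.
  exact: (mul_root_proj AD A0 n_neq0 k (zn j)).
by rewrite mxtraceZ mxtrace_idem ?(root_proj_idem AD A0) // mulrC exprM.
Qed.

(** The image of the projector lies in the eigenspace. The bound is expressed by the rank of
    [A - (z ^+ j)%:M] because ranks are what [rank_specialization] compares between
    characteristics. *)
Lemma eigen_mult_le j : (eigen_mult j + \rank (A - (z ^+ j)%:M)%R <= d)%N.
Proof.
rewrite addnC; apply: mulmx0_rank_max.
rewrite mulmxBl mul_scalar_mx; apply/eqP; rewrite subr_eq0; apply/eqP.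
by have := mul_root_proj AD A0 n_neq0 1 (zn j); rewrite !expr1.
Qed.

End TorsionMatrix.

(** ['Phi_n] is monic and is the minimal polynomial of [z], so it divides [f] over the integers, and
    the quotient makes sense in any [R]. In other words [z] goes to [y] under a ring morphism from
    Z[z] to [R], here stated without constructing that ring. *)
Lemma cyclotomic_specialization n (z : algC) (R : comNzRingType) (y : R) (f : {poly int}) :
  n.-primitive_root z -> root (map_poly intr 'Phi_n) y ->
  root (map_poly intr f) z -> root (map_poly intr f) y.
Proof.
move=> prz yr fz.
have f_eq := Pdiv.RingMonic.rdivp_eq (Cyclotomic_monic n) f.
move: fz; rewrite {1}f_eq rmorphD rmorphM /= rootE hornerD hornerM.
have -> : (map_poly intr 'Phi_n : {poly algC}).[z] = 0.
  by apply/rootP; rewrite (Cintr_Cyclotomic prz) (root_cyclotomic prz).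
rewrite mulr0 add0r => rz.
have r0 : Pdiv.Ring.rmodp f 'Phi_n = 0.
  apply: contraTeq rz => r_neq0.
  have [p [minE _ minP]] := minCpolyP z.
  have rE : map_poly intr (Pdiv.Ring.rmodp f 'Phi_n)
      = map_poly ratr (map_poly intr (Pdiv.Ring.rmodp f 'Phi_n) : {poly rat}) :> {poly algC}.
    by apply/polyP => i; rewrite !coef_map /= rmorph_int.
  rewrite -[_ == 0]/(root _ z) rE minP; apply/negP => /dvdp_leq.
  rewrite map_poly_eq0_id0 ?intr_eq0 ?lead_coef_eq0 // => /(_ r_neq0).
  rewrite leqNgt => /negP; apply.
  rewrite (size_map_inj_poly (intr_inj : injective (intr : int -> rat))) //.
  rewrite -(size_map_poly (@ratr algC) p) -minE (minCpoly_cyclotomic prz) -(Cintr_Cyclotomic prz).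
  rewrite (size_map_inj_poly (intr_inj : injective (intr : int -> algC))) //.
  by rewrite Pdiv.Ring.ltn_rmodp monic_neq0 // Cyclotomic_monic.
rewrite f_eq r0 addr0 rmorphM rootE hornerM_comm; last exact: mulrC.
by rewrite (rootP yr) mulr0.
Qed.

(** A minor that is nonzero at [y] is nonzero at [z], by [cyclotomic_specialization] applied to its
    determinant: specialization can only lower the rank. *)
Lemma rank_specialization n (z : algC) (F : fieldType) (y : F) d (M : 'M[{poly int}]_d) :
  n.-primitive_root z -> root (map_poly intr 'Phi_n) y ->
  (\rank (map_mx (fun f : {poly int} => (map_poly intr f).[y]) M)
   <= \rank (map_mx (fun f : {poly int} => (map_poly intr f).[z]) M))%N.
Proof.
move=> prz yr.
pose ev (K : fieldType) (x : K) : {poly int} -> K := horner_eval x \o map_poly intr.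
set A := map_mx _ M; set B := map_mx _ M.
have AE : A = map_mx (ev F y) M by [].
have BE : B = map_mx (ev algC z) M by [].
pose A1 := rowsub (maxrankfun A) A.
have A1r : row_full A1^T by rewrite /row_full mxrank_tr; exact: maxrowsub_free.
pose g := fullrankfun A1r; pose f := maxrankfun A.
have uA : mxsub f g A \in unitmx.
  by rewrite -unitmx_tr (_ : _^T = rowsub g A1^T) ?fullrowsub_unit //; apply/matrixP => i j;
    rewrite !mxE.
have sub_unit r (f1 g1 : 'I_r -> 'I_d) : mxsub f1 g1 A \in unitmx -> mxsub f1 g1 B \in unitmx.
  rewrite !unitmxE !unitfE AE BE -!map_mxsub !det_map_mx.
  by apply: contra => /(cyclotomic_specialization prz yr).
have uB := sub_unit _ _ _ uA.
rewrite -[X in (X <= _)%N](mxrank_unit uB) mxsubrc (leq_trans (mxrankS (rowsub_sub _ _))) //.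
by rewrite -mxrank_tr trmx_mxsub -[leqRHS]mxrank_tr mxrankS // rowsub_sub.
Qed.

(* The ranks [r i] of the powers of [D] form a convex sequence; both bounds say
   that the nilpotent matrix [D] has only Jordan blocks of size [p * q]. *)
Lemma kernel_power_bound (F : fieldType) d (D : 'M[F]_d) p q :
  (1 < p)%N -> (0 < q)%N -> D ^+ (p * q) = 0 ->
  (p * \rank (kermx (D ^+ q)) <= d)%N -> (p * q * \rank (kermx D) <= d)%N.
Proof.
move=> p_gt1 q_gt0 Dpq0; rewrite !mxrank_ker.
pose r i := \rank (D ^+ i).
have conv i : (r i.+1 + r i.+1 <= r i + r i.+2)%N.
  have := mxrank_Frobenius D (D ^+ i) D.
  by rewrite !mulmxE -exprS -!exprSr.
have r0 : r 0%N = d by rewrite /r expr0 mxrank1.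
rewrite -[X in \rank X]expr1 -/(r q) -/(r 1%N) => qd.
have rle i : (r i <= d)%N by apply: rank_leq_row.
have conv2 i k : (r i.+1 + r (i + k) <= r i + r (i + k).+1)%N.
  by elim: k => [|k IHk]; [rewrite addn0 addnC; apply: leqnn | have := conv (i + k)%N;
    rewrite addnS; lia].
case: q q_gt0 Dpq0 qd => [//|q] _ Dpq0 qd.
(* [q.+1] is now the exponent [q] of the statement. Let [e] be the drop [r q - r q.+1]: by convexity
   each later drop is at most [e], and (in [lo]) each earlier one at least [e]. *)
have hi k : (r q.+1 + k * r q.+1 <= k * r q + r (q.+1 + k))%N.
  elim: k => [|k IHk]; first by rewrite !mul0n !addn0.
  have c : (r q.+1 + r (q.+1 + k) <= r q + r (q.+1 + k.+1))%N.
    by have := conv2 q k.+1; rewrite addnS -addSn -addnS.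
  by rewrite !mulSn; lia.
have rpq : r (p * q.+1)%N = 0%N by rewrite /r Dpq0 mxrank0.
have := hi (p.-1 * q.+1)%N.
rewrite (_ : (q.+1 + p.-1 * q.+1)%N = (p * q.+1)%N); last by rewrite -mulSn prednK // ltnW.
rewrite rpq addn0 => hi1.
have lo k : (k <= q -> r k.+1 + k * r q <= r 1%N + k * r q.+1)%N.
  elim: k => [|k IHk] kq; first by rewrite !mul0n !addn0.
  have := conv2 k.+1 (q - k.+1)%N; rewrite subnKC // => c.
  have := IHk (ltnW kq); rewrite !mulSn; lia.
have lo1 := lo q (leqnn q).
have := rle 1%N; have := rle q.+1.
move: (r 1%N) (r q) (r q.+1) lo1 hi1 qd => a y x lo1 hi1 qd xd ad.
case: p p_gt1 hi1 qd {Dpq0 rpq} => [//|[//|P]] _ /= hi1 qd.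
have xy : (x <= y)%N by rewrite -(leq_pmul2l (_ : 0 < P.+1 * q.+1)%N) //; lia.
have [e yE] : exists e, y = (x + e)%N by exists (y - x)%N; rewrite subnKC.
have [K dE] : exists K, d = (x + K)%N by exists (d - x)%N; rewrite subnKC.
have [k aE] : exists k, d = (a + k)%N by exists (d - a)%N; rewrite subnKC.
rewrite [in X in (_ * X)%N]aE addKn; rewrite [in X in (_ * X <= _)%N]dE addKn in qd.
have xe : (x <= P.+1 * q.+1 * e)%N by move: hi1; rewrite yE mulnDr; lia.
have ke : (k + q * e <= K)%N by move: lo1; rewrite yE mulnDr; lia.
have Ke : (K <= q.+1 * e)%N.
  by rewrite -(leq_pmul2l (_ : 0 < P.+1)%N) // mulnA; move: qd; rewrite dE mulSn; lia.
have de : (d <= P.+2 * (q.+1 * e))%N by rewrite mulSn mulnA dE; lia.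
have h1 := leq_mul (leqnn (P.+2 * q.+1)) ke.
have h2 := leq_mul (leqnn q.+1) qd.
have h3 := leq_mul (leqnn q) de.
lia.
Qed.

(** Evaluation of (X^n - 1)/(X - 1) at 1. Being an integral identity in [z], it survives
    specialization, where it keeps the powers of the root distinct as long as [n] is nonzero in the
    field. *)
Lemma prod_1_sub_prim_root (F : fieldType) n (z : F) :
  n.-primitive_root z -> \prod_(1 <= i < n) (1 - z ^+ i) = n%:R.
Proof.
move=> prz; have n_gt0 := prim_order_gt0 prz.
have := factor_Xn_sub_1 prz; rewrite big_ltn // expr0 subrX1.
move/(mulfI (monic_neq0 (monicXsubC 1))) => e.
have := congr1 (horner^~ 1) e; rewrite horner_prod horner_sum.
rewrite (eq_bigr (fun i => 1 - z ^+ i)) => [->|i _]; last by rewrite !hornerE.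
rewrite (eq_bigr (fun=> 1)) => [|i _]; last by rewrite hornerXn expr1n.
by rewrite sumr_const card_ord.
Qed.

Lemma pchar_expr_pow_eq1 (F : fieldType) p k (x : F) :
  p \in [pchar F] -> x ^+ (p ^ k) = 1 -> x = 1.
Proof.
move=> chF; have := @exprDn_pchar F (x - 1) 1 (p ^ k) _.
rewrite subrK expr1n => ->; last by rewrite pnatX (pnatE _ (pcharf_prime chF)) chF.
move/eqP; rewrite -subr_eq0 addrK expf_eq0 subr_eq0 => /andP[_ /eqP //].
Qed.

Lemma pchar_closed_field p : prime p ->
  exists F : closedFieldType, p \in [pchar F].
Proof.
move=> p_pr; have [K [f _]] := countable_algebraic_closure 'F_p.
by exists K; rewrite (fmorph_pchar f) pchar_Fp.
Qed.

Lemma sum_nat_periodic (R : nmodType) (f : nat -> R) n k :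
  (forall j, f (j + n)%N = f j) -> \sum_(j < n) f (j + k)%N = \sum_(j < n) f j.
Proof.
move=> fn; elim: k => [|k <-]; first by apply: eq_bigr => j _; rewrite addn0.
case: n fn => [|n] fn; first by rewrite !big_ord0.
rewrite big_ord_recr [RHS]big_ord_recl /= addrC; congr (_ + _).
  by rewrite add0n addnS -addSn addnC fn.
by apply: eq_bigr => j _; rewrite /bump /= add1n addSnnS.
Qed.

Lemma sum_nat_periodic_mul (f : nat -> nat) q n :
  (forall j, f (j + n)%N = f j) -> (\sum_(j < q * n) f j = q * \sum_(j < n) f j)%N.
Proof.
move=> fn; elim: q => [|q IHq]; first by rewrite big_ord0.
rewrite mulSn mulSn big_split_ord /= -IHq; congr addn.
by apply: eq_bigr => j _; rewrite addnC fn.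
Qed.

(* The eigenspaces modulo [p] bound the multiplicities over [algC], and by the
   freeness hypothesis they are too small for any of these bounds to be strict.
   Hence the multiplicities are invariant under multiplication by roots of
   unity of order [p ^ b], so the trace is zero. *)
Lemma mxtrace_eq0_of_free d (T : 'M[int]_d) p b m :
  prime p -> (0 < b)%N -> (0 < m)%N -> ~~ (p %| m)%N -> T ^+ (p ^ b * m) = 1 ->
  (forall F : fieldType, p \in [pchar F] ->
     (p * \rank (kermx (map_mx intr T ^+ (p ^ b.-1 * m) - 1 : 'M[F]_d)) <= d)%N) ->
  \tr T = 0.
Proof.
move=> p_pr b_gt0 m_gt0 pNm TL1 freeT.
have L_gt0 : (0 < p ^ b * m)%N by rewrite muln_gt0 expn_gt0 prime_gt0.
set L := (p ^ b * m)%N in TL1 L_gt0.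
have [z prz] := C_prim_root_exists L_gt0.
have [F chF] := pchar_closed_field p_pr.
have m_neq0 : m%:R != 0 :> F by rewrite -(dvdn_pcharf chF).
have [y yP] : exists y : F, root (map_poly intr 'Phi_L) y.
  apply/closed_rootP; rewrite size_map_poly_id0;
    last by rewrite (monicP (Cyclotomic_monic _)) oner_neq0.
  by rewrite size_Cyclotomic eqSS -lt0n totient_gt0.
have spec := cyclotomic_specialization prz yP.
have yL : y ^+ L = 1.
  have := spec ('X^L - 1); rewrite !rmorphB !rmorph1 /= !map_polyXn !rootE !hornerE.
  by rewrite (prim_expr_order prz) subrr eqxx => /(_ isT); rewrite subr_eq0 => /eqP.
have ym : y ^+ m = 1 by apply: (pchar_expr_pow_eq1 (k := b) chF); rewrite -exprM mulnC.
have y_inj i j : (i < j < m)%N -> y ^+ i != y ^+ j.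
  case/andP=> ij jm; apply/eqP => eij.
  have y0 : y != 0 by apply: contra_eq_neq ym => ->; rewrite expr0n gtn_eqF // eq_sym oner_eq0.
  have yij : y ^+ (j - i) = 1.
    by apply: (mulfI (expf_neq0 i y0)); rewrite -exprD subnKC ?mulr1 // ltnW.
  (* This vanishes at [z], whose power [p ^ b] is a primitive root of order [m], hence also at [y].
     A coincidence between powers of [y] would make a factor of the product zero, whereas [m] is
     nonzero in [F]. *)
  pose f : {poly int} := \prod_(1 <= k < m) (1 - 'X^(p ^ b * k)) - m%:R.
  have ev (K : fieldType) (x : K) : (map_poly intr f).[x] = \prod_(1 <= k < m) (1 - (x ^+ (p ^ b))
    ^+ k) - m%:R.
    rewrite /f rmorphB rmorph_prod rmorph_nat hornerD hornerN -polyC_natr hornerC horner_prod.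
    congr (_ - _); apply: eq_bigr => k _.
    by rewrite rmorphB rmorph1 /= map_polyXn !hornerE exprM.
  have := spec f; rewrite !rootE !ev prod_1_sub_prim_root; last first.
    by have := dvdn_prim_root prz (dvdn_mull (p ^ b) (dvdnn m)); rewrite -/L /L mulnK.
  rewrite subrr eqxx => /(_ isT); rewrite (bigD1_seq (j - i)%N) ?iota_uniq //=; last first.
    by rewrite mem_index_iota subn_gt0 ij /= (leq_ltn_trans (leq_subr _ _)).
  by rewrite exprAC yij expr1n subrr mul0r sub0r oppr_eq0 (negPf m_neq0).
pose TC : 'M[algC]_d := map_mx intr T; pose TF : 'M[F]_d := map_mx intr T.
have TCL : TC ^+ L = 1 by rewrite /TC -rmorphXn TL1 rmorph1.
have TFL : TF ^+ L = 1 by rewrite /TF -rmorphXn TL1 rmorph1.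
have LC : L%:R != 0 :> algC by rewrite pnatr_eq0 -lt0n.
pose mu j := eigen_mult L TC z j.
pose kap j := \rank (eigenspace TF (y ^+ j)).
have mu_le j : (mu j <= kap j)%N.
  have := eigen_mult_le TCL prz LC j; rewrite -/(mu j) => mu_j.
  rewrite /kap /eigenspace mxrank_ker leq_subRL ?rank_leq_row // addnC.
  apply: leq_trans mu_j; rewrite leq_add2l.
  pose M : 'M[{poly int}]_d := map_mx polyC T - ('X^j)%:M.
  have evM (K : fieldType) (x : K) :
      map_mx (fun f : {poly int} => (map_poly intr f).[x]) M = map_mx intr T - (x ^+ j)%:M.
    apply/matrixP => k l; rewrite !mxE rmorphB rmorphMn /= map_polyC map_polyXn /= hornerD hornerN
      hornerC.
    by rewrite hornerMn hornerXn.
  by have := rank_specialization M prz yP; rewrite !evM.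
have kap_per j : kap (j + m)%N = kap j by rewrite /kap exprD ym mulr1.
have kap_mod j : kap j = kap (j %% m)%N.
  by rewrite {1}(divn_eq j m) /kap exprD mulnC exprM ym expr1n mul1r.
have sum_kap : (\sum_(j < m) kap j <= \rank (eigenspace (TF ^+ m) 1))%N.
  have /mxdirectP /= <- : mxdirect (\sum_(j < m) eigenspace TF (y ^+ j)).
    apply: mxdirect_sum_eigenspace => i j _ _ /eqP e; apply/val_inj/eqP => /=.
    by case: ltngtP e => // ij; [|rewrite eq_sym]; rewrite (negPf (y_inj _ _ _)) // ij ltn_ord.
  apply/mxrankS/sumsmx_subP => j _; apply/eigenspaceP.
  have : eigenspace TF (y ^+ j) *m TF = y ^+ j *: eigenspace TF (y ^+ j).
    exact/eigenspaceP.
  move: (eigenspace _ _) => E EP.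
  suff -> k : E *m TF ^+ k = y ^+ j ^+ k *: E by rewrite exprAC ym expr1n.
  elim: k => [|k IHk]; first by rewrite !expr0 mulmx1 scale1r.
  by rewrite exprS -mulmxE mulmxA EP -scalemxAl IHk scalerA -exprS.
have pow_sub1 k (P : 'M[F]_d) : (P - 1) ^+ (p ^ k) = P ^+ (p ^ k) - 1.
  case: (d) P => [|d'] P; first by rewrite [LHS]flatmx0 [RHS]flatmx0.
  have chM : p \in [pchar 'M[F]_d'.+1] by rewrite pchar_lalg.
  elim: k => [|k IHk]; first by rewrite expn0 !expr1.
  rewrite expnSr exprM IHk -!(pFrobenius_autE chM) pFrobenius_autB_comm ?pFrobenius_aut1.
    by rewrite pFrobenius_autE -exprM.
  exact: commr1.
(* [kernel_power_bound] is applied to [TF ^+ m - 1], nilpotent because raising to powers of [p] is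
   additive here; its power [p ^ b.-1] is the matrix of the freeness hypothesis. *)
have rank_ker : (p ^ b * \rank (eigenspace (TF ^+ m) 1) <= d)%N.
  rewrite -(prednK b_gt0) expnS; apply: kernel_power_bound;
    rewrite ?prime_gt1 ?expn_gt0 ?prime_gt0 //.
    by rewrite -expnS prednK // pow_sub1 -exprM [(m * _)%N]mulnC TFL subrr.
  by rewrite pow_sub1 -exprM [(m * _)%N]mulnC; apply: freeT.
have sum_mu : (\sum_(j < L) mu j = d)%N.
  have := mxtrace_eigen_mult TCL prz LC 0; rewrite expr0 mxtrace1.
  under eq_bigr do rewrite muln0 expr0 mulr1.
  by rewrite -natr_sum => /eqP; rewrite eqr_nat => /eqP.
have sum_kapL : (\sum_(j < L) kap j <= d)%N.
  by apply: leq_trans rank_ker; rewrite sum_nat_periodic_mul // leq_mul2l sum_kap orbT.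
have kapE j : (j < L)%N -> mu j = kap j.
  move=> jL; have [_] := leqif_sum (fun (i : 'I_L) (_ : true) => leqif_eq (mu_le i)).
  rewrite eqn_leq leq_sum //= sum_mu sum_kapL => /esym/forallP/(_ (Ordinal jL)).
  by move/eqP.
have tr_eq : (\tr T)%:~R = \sum_(j < L) (kap j)%:R * z ^+ j.
  rewrite -[T]expr1 -(trace_map_mx intr) rmorphXn /= -/TC (mxtrace_eigen_mult TCL prz LC).
  by apply: eq_bigr => j _; rewrite muln1 -kapE.
have tr_shift : z ^+ m * (\tr T)%:~R = (\tr T)%:~R :> algC.
  rewrite tr_eq mulr_sumr -(sum_nat_periodic (f := fun j => (kap j)%:R * z ^+ j) m) => [|j].
    by apply: eq_bigr => j _; rewrite kap_per exprD mulrC mulrA.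
  rewrite exprD (prim_expr_order prz) mulr1; congr (_%:R * _).
  by rewrite kap_mod addnC modnMDl -kap_mod.
apply/eqP; rewrite -(intr_eq0 algC); move/eqP: tr_shift.
rewrite -subr_eq0 -{2}[_%:~R]mul1r -mulrBl mulf_eq0 subr_eq0 -(prim_order_dvd prz).
by rewrite gtnNdvd // -[X in (X < _)%N]mul1n ltn_pmul2r // -(expn0 p) ltn_exp2l // prime_gt1.
Qed.

Section IntegralTorsion.
Variables (d n : nat) (A : 'M[int]_d).
Hypotheses (n_gt0 : (0 < n)%N) (An : A ^+ n = 1).

Let AC : 'M[algC]_d := map_mx intr A.
Let ACn : AC ^+ n = 1. Proof. by rewrite /AC -rmorphXn An rmorph1. Qed.
Let nC : n%:R != 0 :> algC. Proof. by rewrite pnatr_eq0 -lt0n. Qed.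
Let trE k : \tr (AC ^+ k) = (\tr (A ^+ k))%:~R.
Proof. by rewrite /AC -rmorphXn trace_map_mx. Qed.

Let z := sval (C_prim_root_exists n_gt0).
Let prz : n.-primitive_root z. Proof. exact: svalP (C_prim_root_exists n_gt0). Qed.
Let norm_z j : `|z ^+ j| = 1.
Proof.
rewrite normrX; suff -> : `|z| = 1 by rewrite expr1n.
by apply/eqP; rewrite -(pexpr_eq1 n_gt0) // -normrX (prim_expr_order prz) normr1.
Qed.

Let sum_mult : \sum_(j < n) (eigen_mult n AC z j)%:R = d%:R :> algC.
Proof.
have := mxtrace_eigen_mult ACn prz nC 0; rewrite expr0 mxtrace1 => ->.
by apply: eq_bigr => j _; rewrite muln0 expr0 mulr1.
Qed.

Lemma torsion_mxtrace_le : \tr A <= d%:Z.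
Proof.
rewrite -(ler_int algC) -[A]expr1 -trE (mxtrace_eigen_mult ACn prz nC) -[leRHS]sum_mult.
apply: le_trans (_ : `|\sum_(j < n) (eigen_mult n AC z j)%:R * z ^+ (j * 1)| <= _).
  by apply: real_ler_norm; rewrite -(mxtrace_eigen_mult ACn prz nC) trE Rreal_int.
apply: le_trans (ler_norm_sum _ _ _) _; apply: ler_sum => j _.
by rewrite normrM norm_z mulr1 normr_nat.
Qed.

(** This is the equality case of the triangle inequality: every eigenvalue of positive multiplicity
    has to be 1. *)
Lemma torsion_mxtrace_eq : \tr A = d%:Z -> A = 1.
Proof.
move=> trA; suff : AC = 1.
  move=> /matrixP A1; apply/matrixP => i j; apply: (intr_inj (R := algC)).
  by have := A1 i j; rewrite !mxE => ->; rewrite rmorph_nat.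
have e1 : \sum_(j < n) (eigen_mult n AC z j)%:R * z ^+ (j * 1) = \sum_(j < n) (eigen_mult n AC z
  j)%:R.
  by rewrite -(mxtrace_eigen_mult ACn prz nC) sum_mult trE expr1 trA.
have pt : forall j : 'I_n, true -> (eigen_mult n AC z j)%:R * z ^+ (j * 1) = (eigen_mult n AC z
  j)%:R.
  by apply: normC_sum_upper e1 => j _; rewrite normrM norm_z mulr1 normr_nat.
rewrite -[AC]mulr1 -(expr0 AC) -(sum_root_proj (fun k => AC ^+ k) nC prz) mulr_sumr.
apply: eq_bigr => j _.
have AD i k : AC ^+ i *m AC ^+ k = AC ^+ (i + k) by rewrite exprD.
have zn : (z ^+ j) ^+ n = 1 by rewrite exprAC (prim_expr_order prz) expr1n.
have := mul_root_proj AD (etrans ACn (esym (expr0 _))) nC 1 zn; rewrite !expr1 => E.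
rewrite (_ : _ * _ = z ^+ j *: root_proj n (fun k => AC ^+ k) (z ^+ j)); last exact: E.
have [|mj] := eqVneq (eigen_mult n AC z j) 0%N.
  by move/eqP; rewrite /eigen_mult mxrank_eq0 => /eqP ->; rewrite scaler0.
have := pt j isT; rewrite muln1 -[RHS]mulr1 => /(mulfI _) -> //; last by rewrite pnatr_eq0.
by rewrite scale1r.
Qed.

(** Galois conjugation z -> z^k turns the eigenvalues of [A] into those of [A ^+ k] and fixes the
    trace, which is an integer. *)
Lemma torsion_mxtrace_coprime k : coprime k n -> \tr (A ^+ k) = \tr A.
Proof.
move=> kn; pose f : {poly int} := \sum_(j < n) (eigen_mult n AC z j)%:R *: 'X^j - (\tr A)%:P.
have ev (x : algC) : (map_poly intr f).[x] = \sum_(j < n) (eigen_mult n AC z j)%:R * x ^+ j - (\tr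
  A)%:~R.
  rewrite /f rmorphB rmorph_sum /= map_polyC hornerD hornerN hornerC horner_sum.
  by congr (_ - _); apply: eq_bigr => j _; rewrite map_polyZ map_polyXn !hornerE rmorph_nat.
have przk : n.-primitive_root (z ^+ k) by rewrite prim_root_exp_coprime.
have := @cyclotomic_specialization n z algC (z ^+ k) f prz.
rewrite (Cintr_Cyclotomic przk) (root_cyclotomic przk) => /(_ przk).
rewrite !rootE !ev -[X in _ - X]/((\tr A)%:~R) => spec.
have trk i : (\tr (A ^+ i))%:~R = \sum_(j < n) (eigen_mult n AC z j)%:R * (z ^+ i) ^+ j.
  rewrite -trE (mxtrace_eigen_mult ACn prz nC); apply: eq_bigr => j _.
  by rewrite -exprM mulnC.
move: spec; rewrite -trk -[in X in X -> _](expr1 z) -trk !expr1 subrr eqxx => /(_ isT).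
by rewrite subr_eq0 eqr_int => /eqP.
Qed.

(** [r] is the multiplicity of the eigenvalue 1. *)
Lemma torsion_mxtrace_sum : exists r : nat, \sum_(k < n) \tr (A ^+ k) = (n * r)%:Z.
Proof.
have AD i k : AC ^+ i *m AC ^+ k = AC ^+ (i + k) by rewrite exprD.
have := root_mult AD (etrans ACn (esym (expr0 _))) nC (expr1n _ n).
set r := \rank _ => e; exists r; apply: (intr_inj (R := algC)).
rewrite rmorph_sum /= -pmulrn natrM e.
by apply: eq_bigr => k _; rewrite expr1n invr1 mul1r trE.
Qed.

End IntegralTorsion.

(** * Group rings and partial augmentations *)

Section FunMatrix.
Variables (T : finType) (R : comNzRingType).

(** Acts on row vectors, taking the basis vector of [x] to that of [f x]; hence the reversed order
    of composition in [fun_mxM]. *)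
Definition fun_mx (f : T -> T) : 'M[R]_#|T| :=
  \matrix_(i, j) (enum_val j == f (enum_val i))%:R.

Lemma fun_mxM f g : fun_mx f *m fun_mx g = fun_mx (g \o f).
Proof.
apply/matrixP => i j; rewrite !mxE (bigD1 (enum_rank (f (enum_val i)))) //= !mxE enum_rankK eqxx
  mul1r.
rewrite big1 ?addr0 // => k ki; rewrite !mxE (_ : _ == _ = false) ?mul0r //.
by apply: contraNF ki => /eqP <-; rewrite enum_valK.
Qed.

Lemma fun_mx1 : fun_mx id = 1.
Proof. by apply/matrixP => i j; rewrite !mxE (inj_eq enum_val_inj) eq_sym. Qed.

Lemma eq_fun_mx f g : f =1 g -> fun_mx f = fun_mx g.
Proof. by move=> fg; apply/matrixP => i j; rewrite !mxE fg. Qed.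

Lemma mxtrace_fun_mx f : \tr (fun_mx f) = #|[set x | f x == x]|%:R.
Proof.
rewrite /mxtrace -sum1_card natr_sum [RHS]big_mkcond /=.
rewrite [RHS](reindex (@enum_val T (mem T))) /=; last first.
  by exists enum_rank => x _; rewrite ?enum_valK ?enum_rankK.
by apply: eq_bigr => i _; rewrite !mxE inE eq_sym; case: eqP.
Qed.

End FunMatrix.

Lemma map_fun_mx (T : finType) (R S : comNzRingType) (h : {rmorphism R -> S}) (f : T -> T) :
  map_mx h (fun_mx R f) = fun_mx S f.
Proof. by apply/matrixP => i j; rewrite !mxE rmorph_nat. Qed.

(** An invariant vector is constant on the cosets of the cyclic group of [x], so it is determined by
    its entries at coset representatives, which [W] extracts. This is where freeness of translations
    enters. *)
Lemma kermx_fun_mx_sub1 (F : fieldType) (gT : finGroupType) (x : gT) :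
  (#[x]%g * \rank (kermx (fun_mx F (mulg x^-1%g) - 1)) <= #|gT|)%N.
Proof.
pose X := rcosets <[x]>%g [set: gT].
have cX : (#[x]%g * #|X| = #|gT|)%N by rewrite -cardsT -(Lagrange (subsetT <[x]>%G)).
pose W : 'M[F]_(#|gT|, #|X|) := \matrix_(i, j) (enum_val i == repr (enum_val j))%:R.
suff injW (w : 'rV_#|gT|) : w *m fun_mx F (mulg x^-1%g) = w -> w *m W = 0 -> w = 0.
  rewrite -[leqRHS]cX leq_mul2l; apply/orP; right;
    apply: leq_trans (rank_leq_col (kermx (fun_mx F (mulg x^-1%g) - 1) *m W)).
  apply: eq_leq; apply: esym; apply/mxrank_injP/rowV0P => w.
  rewrite sub_capmx !sub_kermx mulmxBr mulmx1 subr_eq0 => /andP[/eqP wP /eqP].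
  exact: injW.
move=> wP wW0.
have wx y : w 0 (enum_rank (x^-1 * y)%g) = w 0 (enum_rank y).
  have /matrixP/(_ 0 (enum_rank (x^-1 * y)%g)) := wP; rewrite mxE => <-.
  rewrite (bigD1 (enum_rank y)) //= !mxE !enum_rankK eqxx mulr1 big1 ?addr0 // => j jy.
  rewrite !mxE enum_rankK (inj_eq (mulgI _)) (_ : _ == _ = false) ?mulr0 //.
  by apply: contraNF jy => /eqP ->; rewrite enum_valK.
have wcyc y h : h \in <[x]>%g -> w 0 (enum_rank (h * y)%g) = w 0 (enum_rank y).
  rewrite -cycleV => /cycleP[k ->]; elim: k => [|k IHk]; first by rewrite mul1g.
  by rewrite expgS -mulgA wx IHk.
apply/rowP => i; rewrite [RHS]mxE -(enum_valK i); set y := enum_val i.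
have yX : (<[x]> :* y)%g \in X by apply/rcosetsP; exists y.
have /matrixP/(_ 0 (enum_rank_in yX (<[x]> :* y)%g)) := wW0; rewrite !mxE.
rewrite (bigD1 (enum_rank (repr (<[x]> :* y)%g))) //= !mxE enum_rankK enum_rankK_in // eqxx mulr1
  big1; last first.
  move=> j jy; rewrite !mxE enum_rankK_in // (_ : _ == _ = false) ?mulr0 //.
  by apply: contraNF jy => /eqP <-; rewrite enum_valK.
by rewrite addr0; have /rcosetP[h hx ->] := mem_repr_rcoset <[x]>%G y; rewrite wcyc.
Qed.

Section GroupRingMatrix.
Variables (gT : finGroupType) (R : comNzRingType) (d : nat).
Implicit Types (rho : gT -> 'M[R]_d) (u v : group_ring int gT).

Definition gr_mx rho u : 'M[R]_d := \sum_g (gr_coef u g)%:~R *: rho g.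

Lemma gr_mxM rho : {morph rho : g h / (g * h)%g >-> g *m h} ->
  {morph gr_mx rho : u v / u * v >-> u *m v}.
Proof.
move=> rhoM u v; rewrite /gr_mx.
transitivity (\sum_g \sum_y ((gr_coef u y)%:~R * (gr_coef v (y^-1 * g)%g)%:~R) *: rho g).
  apply: eq_bigr => g _; rewrite ffunE rmorph_sum scaler_suml.
  by apply: eq_bigr => y _; rewrite rmorphM.
rewrite exchange_big mulmx_suml; apply: eq_bigr => y _.
rewrite (reindex_inj (mulgI y)) mulmx_sumr; apply: eq_bigr => g _.
by rewrite mulKg -scalemxAl -scalemxAr scalerA rhoM.
Qed.

Lemma gr_mx1 rho : gr_mx rho 1 = rho 1%g.
Proof.
rewrite /gr_mx (bigD1 1%g) //= ffunE eqxx scale1r big1 ?addr0 // => g /negPf g1.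
by rewrite ffunE g1 scale0r.
Qed.

Lemma gr_mxX rho k u : {morph rho : g h / (g * h)%g >-> g *m h} -> rho 1%g = 1 ->
  gr_mx rho (u ^+ k) = gr_mx rho u ^+ k.
Proof.
move=> rhoM rho1; elim: k => [|k IHk]; first by rewrite !expr0 gr_mx1.
by rewrite !exprS gr_mxM // IHk.
Qed.

Lemma mxtrace_gr_mx rho u : \tr (gr_mx rho u) = \sum_g (gr_coef u g)%:~R * \tr (rho g).
Proof. by rewrite raddf_sum; apply: eq_bigr => g _; rewrite /= mxtraceZ. Qed.

End GroupRingMatrix.

Lemma map_gr_mx (gT : finGroupType) (R S : comNzRingType) (h : {rmorphism R -> S}) d
    (rho : gT -> 'M[R]_d) u :
  map_mx h (gr_mx rho u) = gr_mx (fun g => map_mx h (rho g)) u.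
Proof.
by rewrite raddf_sum; apply: eq_bigr => g _; rewrite /= map_mxZ rmorph_int.
Qed.

Section Bimodule.
Variables (gT : finGroupType) (R : comNzRingType).
Implicit Types (x y g h v : gT) (u : group_ring int gT).

(** The inverse compensates for the row convention and makes [lmul_mx] multiplicative. *)
Definition lmul_mx x := fun_mx R (mulg x^-1%g).
Definition rmul_mx h := fun_mx R (mulg^~ h).

Lemma lmul_mxM : {morph lmul_mx : x y / (x * y)%g >-> x *m y}.
Proof. by move=> x y; rewrite fun_mxM; apply: eq_fun_mx => v /=; rewrite invMg mulgA. Qed.

Lemma rmul_mxM : {morph rmul_mx : x y / (x * y)%g >-> x *m y}.
Proof. by move=> x y; rewrite fun_mxM; apply: eq_fun_mx => v /=; rewrite mulgA. Qed.

Lemma lmul_mx1 : lmul_mx 1 = 1.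
Proof. by rewrite -fun_mx1; apply: eq_fun_mx => v; rewrite invg1 mul1g. Qed.

Lemma rmul_mx1 : rmul_mx 1 = 1.
Proof. by rewrite -fun_mx1; apply: eq_fun_mx => v; rewrite mulg1. Qed.

Lemma lmul_mxX x k : lmul_mx (x ^+ k)%g = lmul_mx x ^+ k.
Proof. by elim: k => [|k IHk]; rewrite ?lmul_mx1 ?expgS ?lmul_mxM ?exprS ?IHk. Qed.

Lemma lrmul_mxC x h : lmul_mx x *m rmul_mx h = rmul_mx h *m lmul_mx x.
Proof. by rewrite !fun_mxM; apply: eq_fun_mx => v /=; rewrite mulgA. Qed.

(** The operator v -> x^-1 v u of the group algebra. *)
Definition bimul_mx x u := lmul_mx x *m gr_mx rmul_mx u.

Lemma lmul_gr_mxC x u : lmul_mx x *m gr_mx rmul_mx u = gr_mx rmul_mx u *m lmul_mx x.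
Proof.
rewrite mulmx_sumr mulmx_suml; apply: eq_bigr => g _.
by rewrite -scalemxAr -scalemxAl lrmul_mxC.
Qed.

Lemma bimul_mxX x u k : bimul_mx x u ^+ k = bimul_mx (x ^+ k)%g (u ^+ k).
Proof.
by rewrite /bimul_mx [LHS]exprMn_comm ?lmul_mxX ?gr_mxX //;
  [apply: rmul_mxM | apply: rmul_mx1 | apply: lmul_gr_mxC].
Qed.

(* The partial augmentation of [u] at the conjugacy class of [x]. *)
Definition paug u x : int := \sum_(h in (x ^: [set: gT])%g) gr_coef u h.

Lemma sum_conj (V : nmodType) (F : gT -> V) x :
  \sum_v F (x ^ v)%g = (\sum_(h in (x ^: [set: gT])%g) F h) *+ #|'C[x]%g|.
Proof.
rewrite (partition_big (fun v => x ^ v)%g [in x ^: [set: gT]]%g) => [|v _] /=;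
  last exact: memJ_class.
rewrite -sumrMnl; apply: eq_bigr => h /imsetP[y _ ->].
rewrite (eq_bigr (fun=> F (x ^ y)%g)) => [|v /eqP -> //].
rewrite sumr_const; congr (_ *+ _).
rewrite -(card_rcoset _ y); apply: eq_card => v; rewrite mem_rcoset.
rewrite -[LHS]/((x ^ v)%g == (x ^ y)%g); apply/eqP/cent1P => [e|/commute_sym/commgP/conjg_fixP e].
  by apply/commute_sym/commgP/conjg_fixP; rewrite conjgM e -conjgM mulgV conjg1.
by rewrite -[v](mulgKV y) conjgM e.
Qed.

(** The coefficient of [u] at [g] is counted once for each [v] with x^-1 v g = v, that is, with
    [g = x ^ v]. *)
Lemma mxtrace_bimul x u : \tr (bimul_mx x u) = (paug u x *+ #|'C[x]%g|)%:~R.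
Proof.
rewrite /bimul_mx mulmx_sumr raddf_sum.
rewrite -sum_conj rmorph_sum.
transitivity (\sum_g (gr_coef u g)%:~R * (\sum_v (g == (x ^ v)%g)%:R) : R).
  apply: eq_bigr => g _; rewrite /= -scalemxAr mxtraceZ fun_mxM mxtrace_fun_mx; congr (_ * _).
  rewrite -sum1_card natr_sum big_mkcond; apply: eq_bigr => v _; rewrite inE /=.
  rewrite (_ : (_ == v) = (g == (x ^ v)%g)); first by case: eqP.
  apply/eqP/eqP => [e|->]; last by rewrite conjgE !mulgA mulgK mulVg mul1g.
  by rewrite conjgE -{2}e !mulgA mulgK mulVg mul1g.
under eq_bigr do rewrite mulr_sumr.
rewrite exchange_big; apply: eq_bigr => v _ /=.
rewrite (bigD1 (x ^ v)%g) //= eqxx mulr1 big1 ?addr0 // => g /negPf ->.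
by rewrite mulr0.
Qed.

End Bimodule.

Lemma augmentationM (gT : finGroupType) (u v : group_ring int gT) :
  augmentation (u * v) = augmentation u * augmentation v.
Proof.
have augE w : augmentation w = gr_mx (fun=> 1%:M : 'M[int]_1) w 0 0.
  rewrite summxE; apply: eq_bigr => g _.
  by rewrite !mxE mulr1 intz.
rewrite !augE gr_mxM ?mxE ?big_ord1 // => g h.
by rewrite mul1mx.
Qed.

Lemma augmentation1 (gT : finGroupType) : augmentation (1 : group_ring int gT) = 1.
Proof.
rewrite /augmentation (bigD1 1%g) //= ffunE eqxx big1 ?addr0 // => g /negPf g1.
by rewrite ffunE g1.
Qed.

Lemma augmentationX (gT : finGroupType) (u : group_ring int gT) k :
  augmentation u = 1 -> augmentation (u ^+ k) = 1.
Proof.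
by move=> u1; elim: k => [|k IHk]; rewrite ?augmentation1 // exprS augmentationM u1 IHk.
Qed.

Section TorsionUnit.
Variables (gT : finGroupType) (u : group_ring int gT) (n : nat).
Hypotheses (n_gt0 : (0 < n)%N) (un : u ^+ n = 1).
Implicit Types (x y g : gT).

Lemma bimul_mx_order1 (R : comNzRingType) x m :
  (#[x]%g %| m)%N -> (n %| m)%N -> bimul_mx R x u ^+ m = 1.
Proof.
move=> /dvdnP[a ->]; rewrite [(a * _)%N]mulnC bimul_mxX expgM expg_order expg1n.
case/dvdnP=> b ->; rewrite [(b * _)%N]mulnC exprM un expr1n.
by rewrite /bimul_mx gr_mx1 lmul_mx1 rmul_mx1 mulmx1.
Qed.

(* Hertweck: for a prime [p] such that [#[x]] has a larger [p]-part than [n],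
   [v |-> x^-1 v u] has a power which is left translation by an element of order
   [p], hence acts freely. *)
Lemma paug_eq0 x : ~~ (#[x]%g %| n)%N -> paug u x = 0.
Proof.
move=> xNn; set o := #[x]%g in xNn *; set L := lcmn o n.
have L_gt0 : (0 < L)%N by rewrite lcmn_gt0 order_gt0.
have nL : (n %| L)%N by rewrite dvdn_lcmr.
have q_gt1 : (1 < L %/ n)%N.
  rewrite ltn_neqAle eq_sym divn_gt0 // dvdn_leq // andbT.
  by apply: contra xNn; rewrite -(eqn_pmul2r n_gt0) divnK // mul1n => /eqP <-; rewrite dvdn_lcml.
set p := pdiv (L %/ n); have p_pr : prime p by rewrite pdiv_prime.
have pL : (p %| L)%N by rewrite (dvdn_trans (pdiv_dvd _)) // dvdn_div.
have nLp : (n %| L %/ p)%N.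
  rewrite (_ : (L %/ p)%N = (n * (L %/ n %/ p))%N) ?dvdn_mulr //.
  by rewrite muln_divA ?pdiv_dvd // mulnC divnK.
have oNLp : ~~ (o %| L %/ p)%N.
  apply/negP => oLp; have : (L %| L %/ p)%N by rewrite dvdn_lcm oLp nLp.
  by move/dvdn_leq; rewrite divn_gt0 ?prime_gt0 // dvdn_leq // leqNgt ltn_Pdiv ?prime_gt1 // =>
    /(_ isT).
have b_gt0 : (0 < logn p L)%N by rewrite logn_gt0 mem_primes p_pr L_gt0 pL.
have LE : (p ^ logn p L * L`_p^')%N = L by rewrite -p_part partnC.
have LpE : (p ^ (logn p L).-1 * L`_p^' = L %/ p)%N.
  by rewrite -[in RHS]LE -[in RHS](prednK b_gt0) expnS -mulnA mulKn ?prime_gt0.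
have tr0 : \tr (bimul_mx int x u) = 0.
  apply: (mxtrace_eq0_of_free p_pr b_gt0 (part_gt0 p^' L)).
  - by rewrite -p'natE // part_pnat.
  - by rewrite LE bimul_mx_order1 ?dvdn_lcml ?dvdn_lcmr.
  move=> F chF; rewrite LpE.
  have -> : map_mx intr (bimul_mx int x u) = bimul_mx F x u.
    rewrite /bimul_mx map_mxM map_gr_mx map_fun_mx; congr (_ *m _).
    by apply: eq_bigr => g _; rewrite map_fun_mx.
  have zp : #[(x ^+ (L %/ p))%g]%g = p.
    apply: nt_prime_order => //; last by rewrite -order_dvdn.
    by rewrite -expgM divnK //; apply/eqP; rewrite -order_dvdn dvdn_lcml.
  rewrite bimul_mxX (_ : u ^+ _ = 1); last by case/dvdnP: nLp => k ->;
    rewrite mulnC exprM un expr1n.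
  rewrite /bimul_mx gr_mx1 rmul_mx1 mulmx1 -[X in (X * _)%N]zp.
  exact: kermx_fun_mx_sub1.
by move: tr0; rewrite mxtrace_bimul => /eqP;
  rewrite intr_eq0 mulrn_eq0 (gtn_eqF (cardG_gt0 _)) => /eqP.
Qed.

(** The trace of the [k]-th power of [bimul_mx x u] is unchanged by [torsion_mxtrace_coprime], and
    [x ^+ k] generates the same cyclic group as [x], so both traces carry the same centralizer
    order. *)
Lemma paug_coprime x k : coprime k (lcmn #[x]%g n) -> paug (u ^+ k) (x ^+ k)%g = paug u x.
Proof.
move=> kL; have L_gt0 : (0 < lcmn #[x]%g n)%N by rewrite lcmn_gt0 order_gt0.
have TL : bimul_mx int x u ^+ lcmn #[x]%g n = 1 by rewrite bimul_mx_order1 ?dvdn_lcml ?dvdn_lcmr.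
have := torsion_mxtrace_coprime L_gt0 TL kL; rewrite bimul_mxX !mxtrace_bimul.
have -> : 'C[(x ^+ k)%g]%g = 'C[x]%g.
  have : generator <[x]>%g (x ^+ k)%g by rewrite generator_coprime coprime_sym (coprime_dvdr _ kL)
    ?dvdn_lcml.
  by move/eqP=> e; rewrite -!cent_cycle e.
by move/eqP; rewrite eqr_int -subr_eq0 -mulrnBl mulrn_eq0 (gtn_eqF (cardG_gt0 _)) subr_eq0 => /eqP.
Qed.

End TorsionUnit.

Section TorsionCoefficients.
Variables (gT : finGroupType) (u : group_ring int gT) (n : nat).
Hypotheses (n_gt0 : (0 < n)%N) (un : u ^+ n = 1).
Implicit Types (x y g : gT).

Let A := gr_mx (rmul_mx int (gT := gT)) u.

Let An : A ^+ n = 1.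
Proof. by rewrite -gr_mxX ?un ?gr_mx1 ?rmul_mx1 //; apply: rmul_mxM. Qed.

Lemma gr_mx_rmulE (v : group_ring int gT) i j :
  gr_mx (rmul_mx int (gT := gT)) v i j = gr_coef v ((enum_val i)^-1 * enum_val j)%g.
Proof.
rewrite summxE (bigD1 ((enum_val i)^-1 * enum_val j)%g) //= !mxE mulKVg eqxx mulr1 intz.
rewrite big1 ?addr0 // => g gij; rewrite !mxE (_ : _ == _ = false) ?mulr0 //.
by apply: contraNF gij => /eqP ->; rewrite mulKg.
Qed.

Lemma mxtrace_gr_rmul (v : group_ring int gT) :
  \tr (gr_mx (rmul_mx int (gT := gT)) v) = gr_coef v 1%g *+ #|gT|.
Proof.
rewrite /mxtrace (eq_bigr (fun=> gr_coef v 1%g)) => [|i _]; last by rewrite gr_mx_rmulE mulVg.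
by rewrite sumr_const card_ord.
Qed.

(* Berman-Higman. *)
Lemma gr_coef1_torsion : augmentation u = 1 -> u != 1 -> gr_coef u 1%g = 0.
Proof.
move=> u1 uN1; apply: contra_neq_eq uN1 => a_neq0.
have N_gt0 : (0 < #|gT|)%N by apply/card_gt0P; exists 1%g.
have [a_gt0|a_le0] := ltrP 0 (gr_coef u 1%g).
  have trA : \tr A = #|gT|%:Z.
    apply/eqP; rewrite eq_le (torsion_mxtrace_le n_gt0 An) mxtrace_gr_rmul.
    by rewrite -mulr_natl natz ler_peMr // -gtz0_ge1.
  have /matrixP A1 := torsion_mxtrace_eq n_gt0 An trA.
  apply: group_ringP => x; have := A1 (enum_rank 1%g) (enum_rank x).
  by rewrite gr_mx_rmulE !enum_rankK invg1 mul1g ffunE !mxE (inj_eq enum_rank_inj) eq_sym.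
(* For a negative coefficient the same argument applies to [- A], torsion of order dividing [2 * n];
   it gives [u = -1], whose augmentation is -1. *)
have a_lt0 : gr_coef u 1%g < 0 by rewrite lt_neqAle a_neq0.
have A2n : (- A) ^+ (2 * n) = 1 by rewrite exprM sqrrN -exprM mulnC exprM An expr1n.
have n2_gt0 : (0 < 2 * n)%N by rewrite muln_gt0.
have trA : \tr (- A) = #|gT|%:Z.
  apply/eqP; rewrite eq_le (torsion_mxtrace_le n2_gt0 A2n) raddfN /= mxtrace_gr_rmul.
  by rewrite -mulNrn -mulr_natl natz ler_peMr // -gtz0_ge1 oppr_gt0.
have /matrixP A1 := torsion_mxtrace_eq n2_gt0 A2n trA.
have uE x : gr_coef u x = - (x == 1%g)%:R.
  have := A1 (enum_rank 1%g) (enum_rank x).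
  rewrite !mxE gr_mx_rmulE !enum_rankK invg1 mul1g (inj_eq enum_rank_inj) eq_sym => /eqP.
  by rewrite eqr_oppLR => /eqP ->.
move: u1; rewrite /augmentation (eq_bigr _ (fun x _ => uE x)) (bigD1 1%g) //= eqxx big1 => [|x
  /negPf ->].
  by [].
by rewrite oppr0.
Qed.

(** The left side is the trace of a product of two commuting torsion operators, [L] built from left
    translations with the coefficients of [u] and [A] the right multiplication by [u]. A torsion
    operator has trace at most the dimension. *)
Lemma torsion_coef_bound :
  \sum_g gr_coef u g * (paug u g *+ #|'C[g]%g|) <= #|gT|%:Z.
Proof.
pose L := gr_mx (lmul_mx int (gT := gT)) u.
have Ln : L ^+ n = 1.
  by rewrite -gr_mxX ?un ?gr_mx1 ?lmul_mx1 //; apply: lmul_mxM.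
have LA : L *m A = A *m L.
  rewrite mulmx_suml mulmx_sumr; apply: eq_bigr => g _.
  by rewrite -scalemxAl -scalemxAr lmul_gr_mxC.
have LAn : (L *m A) ^+ n = 1 by rewrite [LHS]exprMn_comm // Ln An mulr1.
apply: le_trans (torsion_mxtrace_le n_gt0 LAn).
rewrite mulmx_suml raddf_sum le_eqVlt; apply/orP; left; apply/eqP; apply: eq_bigr => g _.
by rewrite -scalemxAl /= mxtraceZ mxtrace_bimul !intz.
Qed.

End TorsionCoefficients.

(** In the regular representation the powers [u ^+ k] with [0 < k < n] have trace zero by
    Berman-Higman, so the traces of all powers add up to the group order; this sum is [n] times the
    multiplicity of the eigenvalue 1. *)
Lemma torsion_order_dvd (gT : finGroupType) (u : group_ring int gT) n :
  (0 < n)%N -> u ^+ n = 1 -> augmentation u = 1 ->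
  (forall k, (0 < k < n)%N -> u ^+ k != 1) -> (n %| #|gT|)%N.
Proof.
move=> n_gt0 un u1 uk.
have An : gr_mx (rmul_mx int (gT := gT)) u ^+ n = 1.
  by rewrite -gr_mxX ?un ?gr_mx1 ?rmul_mx1 //; apply: rmul_mxM.
have [r] := torsion_mxtrace_sum n_gt0 An.
rewrite (bigD1 (Ordinal n_gt0)) //= expr0 mxtrace1 big1 => [|k k0].
  by rewrite addr0 natz => -[->]; rewrite dvdn_mulr.
rewrite -gr_mxX ?rmul_mx1 //; last exact: rmul_mxM.
rewrite mxtrace_gr_rmul (gr_coef1_torsion n_gt0) ?mul0rn ?augmentationX //.
  by rewrite exprAC un expr1n.
by apply: uk; rewrite ltn_ord lt0n -val_eqE in k0 *; rewrite k0.
Qed.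

Lemma sum_class_reps (gT : finGroupType) (V : nmodType) (s : seq gT) (F : gT -> V) :
  (forall g, count (fun r => g \in (r ^: [set: gT])%g) s = 1)%N ->
  \sum_g F g = \sum_(r <- s) \sum_(g in (r ^: [set: gT])%g) F g.
Proof.
move=> s1; under [RHS]eq_bigr do rewrite big_mkcond.
rewrite exchange_big; apply: eq_bigr => g _ /=.
by rewrite -big_mkcond big_const_seq s1 iter_addr addr0.
Qed.

Lemma sum_gr_coef_class (gT : finGroupType) (R : pzRingType) (s : seq gT) (u : group_ring int gT)
  (f : gT -> R) :
  (forall g, count (fun r => g \in (r ^: [set: gT])%g) s = 1)%N ->
  (forall g h, f (g ^ h)%g = f g) ->
  \sum_g (gr_coef u g)%:~R * f g = \sum_(r <- s) (paug u r)%:~R * f r.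
Proof.
move=> s1 fJ; rewrite (sum_class_reps _ s1); apply: eq_bigr => r _.
rewrite rmorph_sum mulr_suml; apply: eq_bigr => g /imsetP[h _ ->].
by rewrite fJ.
Qed.

Lemma torsion_paug_bound (gT : finGroupType) (s : seq gT) (u : group_ring int gT) n :
  (forall g, count (fun r => g \in (r ^: [set: gT])%g) s = 1)%N ->
  (0 < n)%N -> u ^+ n = 1 ->
  \sum_(r <- s) paug u r ^+ 2 *+ #|'C[r]%g| <= #|gT|%:Z.
Proof.
move=> s1 n_gt0 un; apply: le_trans (torsion_coef_bound n_gt0 un).
rewrite le_eqVlt; apply/orP; left; apply/eqP.
have := @sum_gr_coef_class gT int s u (fun g => paug u g *+ #|'C[g]%g|) s1.
under eq_bigr do rewrite intz.
move=> -> => [|g h].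
  by apply: eq_bigr => r _; rewrite intz expr2 mulrnAr.
rewrite /paug classGidl ?inE // -[in RHS](cardJg _ h).
by rewrite -!cent_set1 -centJ conjg_set1.
Qed.

(** An orbit of [s] that is not a fixed point has [p] elements, on which [F] is constant, and
    contributes a multiple of [p]. *)
Lemma sum_perm_fixed (X : finType) (R : pzRingType) p (s : {perm X}) (F : X -> R) :
  prime p -> p%:R = 0 :> R -> (s ^+ p = 1)%g -> (forall x, F (s x) = F x) ->
  \sum_x F x = \sum_(x | s x == x) F x.
Proof.
move=> p_pr pR sp Fs; rewrite (bigID (fun x => s x == x)) /= -[RHS]addr0; congr (_ + _).
rewrite (partition_big (porbit s) xpredT) //= big1 // => O _.
have [x0 /andP[sx0 /eqP <-]|noO] := pickP (fun x => (s x != x) && (porbit s x == O)); last first.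
  by rewrite big_pred0.
have Fpow k x : F ((s ^+ k)%g x) = F x.
  by elim: k => [|k IHk]; rewrite ?perm1 // expgSr permM Fs.
rewrite (eq_bigl [in porbit s x0]) => [|y].
  rewrite (eq_bigr (fun=> F x0)) => [|y /porbitP[k ->]]; last exact: Fpow.
  rewrite sumr_const.
  have : (#|porbit s x0| %| p)%N.
    apply: dvdn_trans (_ : #[s]%g %| p)%N; last by rewrite order_dvdn sp.
    by rewrite porbitE -[#[s]%g]/(#|<[s]>%g|); apply: dvdn_orbit.
  case/primeP: p_pr => _ pdv /pdv /orP[/eqP O1|/eqP ->]; last by rewrite -mulr_natl pR mul0r.
  case/negP: sx0; have : s x0 \in porbit s x0 by rewrite -{1}(expg1 s) mem_porbit.
  have /cards1P[y yE] : #|porbit s x0| == 1%N by rewrite O1.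
  by have := porbit_id s x0; rewrite yE !inE => /eqP -> ->.
apply/andP/idP => [[_ /eqP <-]|yO]; first exact: porbit_id.
split; last by rewrite eq_porbit_mem.
case/porbitP: yO => k ->; apply: contra sx0 => /eqP e; apply/eqP.
by apply: (perm_inj (s := (s ^+ k)%g)); rewrite -permM -expgS expgSr permM.
Qed.

Lemma sum_gr_coefX (gT : finGroupType) (R : pzRingType) (u : group_ring int gT) k (f : gT -> R) :
  \sum_g (gr_coef (u ^+ k) g)%:~R * f g =
  \sum_(t : k.-tuple gT) (\prod_(x <- t) gr_coef u x)%:~R * f (\prod_(x <- t) x)%g.
Proof.
elim: k f => [|k IHk] f.
  rewrite expr0 (bigD1 1%g) //= ffunE eqxx mul1r big1 ?addr0 => [|g /negPf g1];
    last by rewrite ffunE g1 mul0r.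
  rewrite (big_pred1 [tuple]) => [|t]; last by apply/esym/eqP/val_inj; case: t => -[].
  by rewrite !big_nil mul1r.
transitivity (\sum_y (gr_coef u y)%:~R * \sum_g (gr_coef (u ^+ k) g)%:~R * f (y * g)%g).
  rewrite exprS; transitivity (\sum_g \sum_y (gr_coef u y)%:~R * (gr_coef (u ^+ k) (y^-1 *
    g)%g)%:~R * f g).
    apply: eq_bigr => g _; rewrite ffunE rmorph_sum mulr_suml.
    by apply: eq_bigr => y _; rewrite rmorphM.
  rewrite exchange_big; apply: eq_bigr => y _; rewrite mulr_sumr (reindex_inj (mulgI y)).
  by apply: eq_bigr => g _; rewrite mulKg mulrA.
under eq_bigr do rewrite (IHk (fun g => f (_ * g)%g)) mulr_sumr.
rewrite pair_big /= (reindex (fun t : k.+1.-tuple gT => (thead t, [tuple of behead t]))) /=.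
  apply: eq_bigr => t _; rewrite [in RHS](tuple_eta t) !big_cons rmorphM mulrA.
  by [].
exists (fun q : gT * k.-tuple gT => [tuple of q.1 :: q.2]) => [t _|[x t] _] /=;
  first by rewrite -tuple_eta.
by congr (_, _); apply: val_inj.
Qed.

(* In characteristic [p], the cyclic shifts of [p]-tuples of support elements
   leave only the constant tuples in the expansion of [u ^+ p]. *)
Lemma frobenius_congruence (gT : finGroupType) (R : comNzRingType) p (u : group_ring int gT) (f :
  gT -> R) :
  p \in [pchar R] -> (forall g h, f (g ^ h)%g = f g) ->
  \sum_g (gr_coef (u ^+ p) g)%:~R * f g = \sum_g (gr_coef u g)%:~R * f (g ^+ p)%g.
Proof.
move=> chR fJ; have p_pr := pcharf_prime chR.
pose F (t : p.-tuple gT) := (\prod_(x <- t) gr_coef u x)%:~R * f (\prod_(x <- t) x)%g : R.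
have rot_inj1 : injective (fun t : p.-tuple gT => [tuple of seq.rot 1%N t]).
  by move=> t t' /(congr1 val) /rot_inj e; apply: val_inj.
pose s := perm rot_inj1.
have p_gt0 := prime_gt0 p_pr.
have sX k t : (k <= p)%N -> val ((s ^+ k)%g t) = seq.rot k t.
  elim: k => [|k IHk] kp; first by rewrite perm1 rot0.
  by rewrite expgSr permM permE /= IHk 1?ltnW // -rotS ?size_tuple.
have sp : (s ^+ p = 1)%g.
  by apply/permP => t; apply: val_inj; rewrite sX // perm1 -{1}(size_tuple t) rot_size.
have Fs t : F (s t) = F t.
  rewrite /F permE /= (perm_big _ (permEl (perm_rot 1 t))) /=; congr (_ * _).
  case: t => -[|x t] /= _; first by rewrite rot_oversize.
  rewrite rot1_cons -cats1 big_cat big_seq1 /= big_cons.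
  by rewrite -[RHS](fJ _ x) conjgE -mulgA mulKg.
rewrite sum_gr_coefX (sum_perm_fixed p_pr _ sp Fs); last by apply/eqP; case/andP: chR.
have fixP g : s [tuple of nseq p g] = [tuple of nseq p g].
  rewrite permE; apply: val_inj => /=; rewrite -[p in RHS](size_nseq p g) -(size_rot 1).
  by apply/all_pred1P; rewrite (eq_all_r (mem_rot 1 _)) all_pred1_nseq.
rewrite (reindex_onto (fun g => [tuple of nseq p g]) (fun t : p.-tuple gT => nth 1%g t 0)) /=;
  last first.
  move=> t /eqP st; have stk k : (s ^+ k)%g t = t by elim: k => [|k IHk];
    rewrite ?perm1 // expgSr permM IHk st.
  apply: val_inj; apply: (@eq_from_nth _ 1%g) => [|k]; rewrite /= size_nseq ?size_tuple // => kp.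
  have := congr1 (fun t' : p.-tuple gT => nth 1%g t' 0) (stk k).
  rewrite sX ?(ltnW kp) // /seq.rot nth_cat size_drop size_tuple subn_gt0 kp nth_drop addn0 => ->.
  by rewrite nth_nseq kp.
apply: eq_big => [g|g _].
  by rewrite fixP eqxx nth_nseq p_gt0 eqxx.
rewrite /F /= !big_nseq iter_mulr_1 iter_mulg_1; congr (_ * _).
by rewrite rmorphXn /= -(pFrobenius_autE chR) pFrobenius_aut_int.
Qed.

(* A nonzero polynomial with complex coordinates does not vanish on all
   rational points; coordinates are made rational one at a time. *)
Lemma rational_det_neq0 m N (K : 'I_m -> 'M[rat]_N) (w : 'I_m -> algC) :
  \det (\sum_i w i *: map_mx ratr (K i)) != 0 ->
  exists q : 'I_m -> rat, \det (\sum_i q i *: K i) != 0.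
Proof.
move=> dw.
suff /(_ m (leqnn m)) [w' [w'Q dw']] : forall k, (k <= m)%N -> exists w' : 'I_m -> algC,
    (forall i : 'I_m, (i < k)%N -> exists q : rat, w' i = ratr q) /\
    \det (\sum_i w' i *: map_mx ratr (K i)) != 0.
  have /fin_all_exists [q qP] : forall i : 'I_m, exists q, w' i = ratr q by move=> i; apply: w'Q.
  exists q; apply: contraNneq dw' => dq; apply/eqP.
  rewrite (eq_bigr (fun i => map_mx ratr (q i *: K i))) => [|i _]; last by rewrite map_mxZ qP.
  by rewrite -raddf_sum /= det_map_mx dq rmorph0.
elim=> [|k IHk] km; first by exists w.
have [w' [w'Q dw']] := IHk (ltnW km).
pose ik := Ordinal km.
pose p : {poly algC} := \det (\sum_(i | i != ik) map_mx polyC (w' i *: map_mx ratr (K i)) + 'X *: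
  map_mx polyC (map_mx ratr (K ik))).
have pE x : p.[x] = \det (\sum_i (if i == ik then x else w' i) *: map_mx ratr (K i)).
  rewrite -[LHS]/(horner_eval x p) /p -det_map_mx rmorphD rmorph_sum [in RHS](bigD1 ik) //= eqxx
    addrC.
  congr (\det (_ + _)).
    by apply: eq_bigr => i /negPf ->; apply/matrixP => a b; rewrite !mxE /= /horner_eval hornerC.
  by apply/matrixP => a b; rewrite !mxE /= /horner_eval !hornerE.
have p_neq0 : p != 0.
  apply: contraNneq dw' => p0; have := pE (w' ik); rewrite p0 horner0 => /esym /eqP.
  by rewrite (eq_bigr (fun i => w' i *: map_mx ratr (K i))) // => i _; case: eqP => [->|].
have [a pa] : exists a : nat, p.[a%:R] != 0.
  have /allPn[x] : ~~ all (root p) [seq a%:R | a <- iota 0 (size p)].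
    have nat_uniq : uniq [seq (a%:R : algC) | a <- iota 0 (size p)].
      by rewrite map_inj_uniq ?iota_uniq // => a b /eqP; rewrite eqr_nat => /eqP.
    by apply/negP => all_roots; have := max_poly_roots p_neq0 all_roots nat_uniq;
      rewrite size_map size_iota ltnn.
  by case/mapP => a _ -> ra; exists a.
exists (fun i => if i == ik then a%:R else w' i); split; last by rewrite -pE.
move=> i; rewrite ltnS leq_eqVlt; have [-> _|iik] := eqVneq i ik; first by exists a%:R;
  rewrite rmorph_nat.
case/orP => [/eqP e|]; last exact: w'Q.
by case/eqP: iik; apply: val_inj.
Qed.

(** * Rational conjugacy from equality of partial augmentations *)

Section Criterion.
Variables (gT : finGroupType) (u v : group_ring int gT) (n : nat).
Hypotheses (n_gt1 : (1 < n)%N) (un : u ^+ n = 1) (vn : v ^+ n = 1).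
Hypothesis paugE : forall k x, paug (u ^+ k) x = paug (v ^+ k) x.

(** The character of this representation at [(x, i)] is, up to a centralizer order, the partial
    augmentation of [w ^+ i] at [x]. This is why [paugE] is required for all powers. *)
Let rep (w : group_ring int gT) (g : (gT * 'Z_n)%type) := bimul_mx algC g.1 (w ^+ g.2).

Let rep_repr w : w ^+ n = 1 -> mx_repr [set: (gT * 'Z_n)%type] (rep w).
Proof.
move=> wn; split; first by rewrite /rep /bimul_mx expr0 gr_mx1 lmul_mx1 rmul_mx1 mulmx1.
move=> [x i] [y j] _ _; rewrite /rep /=.
have -> : w ^+ (i + j)%R = w ^+ i * w ^+ j.
  have nE : ((Zp_trunc n).+2 = n)%N by rewrite Zp_cast.
  rewrite -exprD -[RHS](expr_mod _ wn) /=; congr (_ ^+ (_ %% _)); exact: nE.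
rewrite /bimul_mx lmul_mxM gr_mxM; last exact: rmul_mxM.
by rewrite !mulmxA -[in RHS](mulmxA _ _ (lmul_mx _ _)) -lmul_gr_mxC !mulmxA.
Qed.

Lemma bimodule_intertwiner : exists B : 'M[algC]_#|gT|,
  [/\ B \in unitmx, forall x, lmul_mx algC x *m B = B *m lmul_mx algC x
    & gr_mx (rmul_mx algC (gT:=gT)) u *m B = B *m gr_mx (rmul_mx algC (gT:=gT)) v].
Proof.
pose rU := MxRepresentation (rep_repr un : mx_repr [set: (gT * 'Z_n)%type]%G (rep u)).
pose rV := MxRepresentation (rep_repr vn : mx_repr [set: (gT * 'Z_n)%type]%G (rep v)).
have /cfRepr_rsimP [B _ Bfree BP] : cfRepr rU == cfRepr rV.
  apply/eqP/cfunP => -[x k]; rewrite !cfunE; congr (_ *+ _).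
  by rewrite /= /rep /= !mxtrace_bimul paugE.
exists B; split=> [|x|]; first by rewrite -row_free_unit.
  have := BP (x, 0) (in_setT _); rewrite /= /rep /bimul_mx /= !expr0 !gr_mx1 !rmul_mx1 !mulmx1.
  by [].
have := BP (1%g, Zp1) (in_setT _); rewrite /= /rep /bimul_mx /= lmul_mx1 !mul1mx.
by rewrite modn_small ?expr1.
Qed.

(** Right multiplication by the element of the group algebra with coordinates [w]. *)
Let vec_mx_of (F : fieldType) (w : 'rV[F]_#|gT|) : 'M[F]_#|gT| :=
  \matrix_(i, j) w 0 (enum_rank ((enum_val i)^-1 * enum_val j)%g).

(** The linear map w -> u w - w v. It has rational entries, so its kernel over [algC] is spanned by
    its rational kernel. *)
Let vec_eq (F : fieldType) : 'M[F]_#|gT| :=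
  gr_mx (fun h => lmul_mx F h^-1%g) u - gr_mx (rmul_mx F (gT := gT)) v.

Let mul_lmul (F : fieldType) m (W : 'M[F]_(m, #|gT|)) x i y :
  (W *m lmul_mx F x) i (enum_rank y) = W i (enum_rank (x * y)%g).
Proof.
rewrite mxE (bigD1 (enum_rank (x * y)%g)) //= !mxE !enum_rankK mulKg eqxx mulr1 big1 ?addr0 // =>
  j jxy.
rewrite !mxE enum_rankK (_ : _ == _ = false) ?mulr0 //.
by apply: contraNF jxy => /eqP ->; rewrite mulKVg enum_valK.
Qed.

Let mul_rmul (F : fieldType) m (W : 'M[F]_(m, #|gT|)) h i y :
  (W *m rmul_mx F h) i (enum_rank y) = W i (enum_rank (y * h^-1)%g).
Proof.
rewrite mxE (bigD1 (enum_rank (y * h^-1)%g)) //= !mxE !enum_rankK mulgKV eqxx mulr1 big1 ?addr0 //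
  => j jxy.
rewrite !mxE enum_rankK (_ : _ == _ = false) ?mulr0 //.
by apply: contraNF jxy => /eqP ->; rewrite mulgK enum_valK.
Qed.

Let mul_vec_eq (F : fieldType) (w : 'rV[F]_#|gT|) y :
  (w *m vec_eq F) 0 (enum_rank y) =
  \sum_h (gr_coef u h)%:~R * w 0 (enum_rank (h^-1 * y)%g)
  - \sum_h (gr_coef v h)%:~R * w 0 (enum_rank (y * h^-1)%g).
Proof.
rewrite mulmxBr !mulmx_sumr !mxE !summxE; congr (_ - _); apply: eq_bigr => h _.
  by rewrite -scalemxAr mxE mul_lmul.
by rewrite -scalemxAr mxE mul_rmul.
Qed.

Let map_vec_eq : map_mx ratr (vec_eq rat) = vec_eq algC.
Proof.
rewrite map_mxB !map_gr_mx; congr (_ - _); apply: eq_bigr => h _; congr (_ *: _); exact: map_fun_mx.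
Qed.

(** [B] is right multiplication by its row at the identity, a complex combination of rational
    solutions of u w = w v. Its determinant is nonzero, so by [rational_det_neq0] some rational
    combination is invertible too. *)
Lemma rational_intertwiner : exists b : group_ring rat gT,
  b \is a GRing.unit /\ ZG_to_QG u * b = b * ZG_to_QG v.
Proof.
have [B [Bunit Bl Br]] := bimodule_intertwiner.
pose w := row (enum_rank 1%g) B.
have BE : B = vec_mx_of w.
  apply/matrixP => i j; rewrite !mxE -{1}(enum_valK i) -{1}(enum_valK j).
  move: (enum_val i) (enum_val j) => x y.
  have /matrixP/(_ (enum_rank x) (enum_rank (x^-1 * y)%g)) := Bl x.
  rewrite mul_lmul mulKVg => <-.
  rewrite mxE (bigD1 (enum_rank 1%g)) //= !mxE !enum_rankK mulVg eqxx mul1r big1 ?addr0 // => k k1.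
  rewrite !mxE enum_rankK mulVg (_ : _ == _ = false) ?mul0r //.
  by apply: contraNF k1 => /eqP <-; rewrite enum_valK.
have wM : w *m vec_eq algC = 0.
  apply/rowP => j; rewrite -(enum_valK j); move: (enum_val j) => y; rewrite mul_vec_eq [RHS]mxE.
  apply/eqP; rewrite subr_eq0; apply/eqP.
  have /matrixP/(_ (enum_rank 1%g) (enum_rank y)) := Br.
  rewrite mulmx_sumr mulmx_suml !summxE => e.
  rewrite (eq_bigr (fun h => ((gr_coef u h)%:~R *: rmul_mx algC h *m B) (enum_rank 1%g) (enum_rank
    y))).
    rewrite e; apply: eq_bigr => h _.
    by rewrite -scalemxAr mxE mul_rmul !mxE.
  move=> h _; rewrite -scalemxAl [RHS]mxE; congr (_ * _).
  have -> : w 0 (enum_rank (h^-1 * y)%g) = B (enum_rank h) (enum_rank y).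
    by have /matrixP/(_ (enum_rank h) (enum_rank y)) -> := BE; rewrite [RHS]mxE !enum_rankK.
  rewrite [RHS]mxE (bigD1 (enum_rank h)) //= !mxE !enum_rankK mul1g eqxx mul1r [X in _ + X]big1
    ?addr0 // => k kh.
  rewrite !mxE !enum_rankK mul1g (_ : _ == _ = false) ?mul0r //.
  by apply: contraNF kh => /eqP <-; rewrite enum_valK.
pose K i := vec_mx_of (row i (kermx (vec_eq rat))).
have [a wE] : exists a, w = a *m map_mx ratr (kermx (vec_eq rat)).
  by apply/submxP; rewrite map_kermx map_vec_eq sub_kermx wM.
have [q dq] : exists q : 'I_#|gT| -> rat, \det (\sum_i q i *: K i) != 0.
  apply: (@rational_det_neq0 _ _ _ (a 0)).
  move: Bunit; rewrite unitmxE unitfE BE; congr (is_true (\det _ != 0)).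
  apply/matrixP => i j; rewrite mxE wE mxE summxE; apply: eq_bigr => k _.
  by rewrite !mxE.
pose w' : 'rV[rat]_#|gT| := \sum_i q i *: row i (kermx (vec_eq rat)).
have w'M : w' *m vec_eq rat = 0.
  rewrite mulmx_suml big1 // => i _.
  by rewrite -scalemxAl -row_mul mulmx_ker row0 scaler0.
have w'E : \sum_i q i *: K i = vec_mx_of w'.
  apply/matrixP => i j; rewrite summxE [RHS]mxE [RHS]summxE; apply: eq_bigr => k _.
  by rewrite !mxE.
pose b : group_ring rat gT := GroupRing [ffun y => w' 0 (enum_rank y)].
have mul_b (c : group_ring rat gT) y :
    gr_coef (c * b) y = ((\row_i gr_coef c (enum_val i)) *m vec_mx_of w') 0 (enum_rank y).
  rewrite ffunE mxE (reindex (@enum_val gT (mem gT))) /=; last first.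
    by exists enum_rank => x _; rewrite ?enum_valK ?enum_rankK.
  by apply: eq_bigr => i _; rewrite !mxE ffunE enum_rankK.
have vunit : vec_mx_of w' \in unitmx by rewrite unitmxE unitfE -w'E.
have injb (c : group_ring rat gT) : c * b = 0 -> c = 0.
  move=> cb0; have : (\row_i gr_coef c (enum_val i)) *m vec_mx_of w' = 0.
    by apply/rowP => j; rewrite -(enum_valK j) -mul_b cb0 !mxE ffunE.
  move/(congr1 (mulmx^~ (invmx (vec_mx_of w')))); rewrite mulmxK // mul0mx => /rowP c0.
  by apply: group_ringP => x; have := c0 (enum_rank x); rewrite !mxE enum_rankK ffunE.
pose c : group_ring rat gT :=
  GroupRing [ffun y => ((delta_mx 0 (enum_rank 1%g) : 'rV[rat]_#|gT|) *m invmx (vec_mx_of w')) 0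
    (enum_rank y)].
have cb : c * b = 1.
  apply: group_ringP => x; rewrite mul_b.
  have -> : \row_i gr_coef c (enum_val i) = (delta_mx 0 (enum_rank 1%g) : 'rV[rat]_#|gT|) *m invmx
    (vec_mx_of w').
    by apply/rowP => i; rewrite mxE ffunE enum_valK.
  by rewrite mulmxKV // !mxE eqxx (inj_eq enum_rank_inj) ffunE.
exists b; split.
  apply/asboolP; exists c; split=> //.
  by apply/eqP; rewrite -subr_eq0; apply/eqP/injb; rewrite mulrBl -mulrA cb mulr1 mul1r subrr.
apply: group_ringP => y; have /rowP/(_ (enum_rank y)) := w'M.
rewrite mul_vec_eq mxE => /eqP; rewrite subr_eq0 => /eqP e.
rewrite !ffunE (eq_bigr (fun h => (gr_coef u h)%:~R * w' 0 (enum_rank (h^-1 * y)%g))) => [|h _];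
  last by rewrite !ffunE.
rewrite e (reindex_inj (inj_comp (mulIg y) invg_inj)) /=; apply: eq_bigr => h _.
by rewrite !ffunE invMg invgK mulKVg mulrC.
Qed.

End Criterion.

(** * Lifting PSL(2, p) to SL(2, p) *)

Section Lift.
Variable p : nat.
Hypothesis p_pr : prime p.
Local Notation F := 'F_p.
Local Notation Z := 'Z(SL 2 F)%g.

Definition Fp_mx2 (a b c d : F) : 'M[F]_2 :=
  \matrix_(i, j) (if i == 0 then if j == 0 then a else b else if j == 0 then c else d).

Lemma det_mx2E (A : 'M[F]_2) : \det A = A 0 0 * A 1 1 - A 0 1 * A 1 0.
Proof.
rewrite (expand_det_row _ 0) !big_ord_recl big_ord0 addr0 /cofactor !det_mx11 !mxE /=.
rewrite expr0 expr1 mul1r mulN1r mulrN; congr (_ * _ - _ * _); congr (A _ _); exact/val_inj.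
Qed.

Lemma mx2_eta (A : 'M[F]_2) : A = Fp_mx2 (A 0 0) (A 0 1) (A 1 0) (A 1 1).
Proof.
apply/matrixP => i j; rewrite mxE.
by case: i => -[|[|//]] ? ; case: j => -[|[|//]] ? /=; congr (A _ _); apply: val_inj.
Qed.

Lemma det_mx2 a b c d : \det (Fp_mx2 a b c d) = a * d - b * c.
Proof. by rewrite det_mx2E !mxE. Qed.

Lemma mul_mx2 a b c d a' b' c' d' : Fp_mx2 a b c d *m Fp_mx2 a' b' c' d' =
  Fp_mx2 (a * a' + b * c') (a * b' + b * d') (c * a' + d * c') (c * b' + d * d').
Proof.
apply/matrixP => i j; rewrite !mxE !big_ord_recl big_ord0 addr0 !mxE /=.
by case: (i == 0); case: (j == 0).
Qed.

Lemma mx2_inj a b c d a' b' c' d' :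
  Fp_mx2 a b c d = Fp_mx2 a' b' c' d' -> [/\ a = a', b = b', c = c' & d = d'].
Proof.
move/matrixP => e.
by have := e 0 0; have := e 0 1; have := e 1 0; have := e 1 1; rewrite !mxE /= => -> -> -> ->.
Qed.

Lemma mx2_1 : 1 = Fp_mx2 1 0 0 1.
Proof. by rewrite [LHS]mx2_eta !mxE. Qed.

Lemma opp_mx2 a b c d : - Fp_mx2 a b c d = Fp_mx2 (- a) (- b) (- c) (- d).
Proof. by rewrite [LHS]mx2_eta !mxE. Qed.

Let GLval_inj : injective (@GLval 2 F). Proof. exact: val_inj. Qed.

Definition GL_of (A : 'M[F]_2) : {'GL_2[F]} := insubd (1%g : {'GL_2[F]}) A.

Lemma GL_ofE A : A \in unitmx -> GLval (GL_of A) = A.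
Proof. by move=> uA; exact: (insubdK (1%g : {'GL_2[F]}) uA). Qed.

Lemma GL_of_SL A : \det A = 1 -> GL_of A \in SL 2 F /\ GLval (GL_of A) = A.
Proof.
move=> dA; have uA : A \in unitmx by rewrite unitmxE dA unitr1.
by rewrite inE GL_ofE // dA eqxx.
Qed.

Lemma center_SL_sign z : z \in Z -> GLval z = 1 \/ GLval z = - 1.
Proof.
case/centerP; rewrite inE => /eqP dz zC.
have com (A : 'M[F]_2) : \det A = 1 -> GLval z *m A = A *m GLval z.
  case/GL_of_SL => sA <-; have := congr1 (@GLval _ _) (zC _ sA).
  by rewrite !GL_MxE.
move: dz com; move: (GLval z) => /= A; rewrite (mx2_eta A).
move: (A 0 0) (A 0 1) (A 1 0) (A 1 1) => a b c d; rewrite det_mx2 => dA com.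
(* Commuting with the two elementary transvections already forces a scalar matrix. *)
have := com (Fp_mx2 1 1 0 1); rewrite det_mx2 !mul_mx2 mulr1 mulr0 subr0 => /(_ erefl) /mx2_inj[e1
  e2 _ e4].
have := com (Fp_mx2 1 0 1 1); rewrite det_mx2 !mul_mx2 mulr1 mul0r subr0 => /(_ erefl) /mx2_inj[e5
  e6 _ _].
have b0 : b = 0 by move: e5; rewrite !mulr1 !mul1r !mul0r !addr0 => /eqP;
  rewrite -subr_eq0 addrAC subrr add0r => /eqP.
have c0 : c = 0 by move: e1; rewrite !mulr1 !mulr0 !mul1r addr0 => /eqP;
  rewrite eq_sym -subr_eq0 addrAC subrr add0r => /eqP.
have ad : d = a.
  by move: e2; rewrite b0 !mulr1 !mul1r add0r addr0.
move: dA; rewrite ad b0 c0 mul0r subr0 -expr2 => /eqP; rewrite sqrf_eq1.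
by case/orP => /eqP ->; [left|right]; rewrite mx2_1 ?opp_mx2 ?oppr0.
Qed.

Lemma SL_opp1 : exists2 z, z \in Z & GLval z = - 1.
Proof.
have dN1 : \det (- 1 : 'M[F]_2) = 1 by rewrite mx2_1 opp_mx2 det_mx2 !oppr0 mul0r subr0 mulrNN
  mulr1.
have [zS zE] := GL_of_SL dN1; exists (GL_of (- 1)) => //.
apply/centerP; split=> // y _; apply: GLval_inj.
by rewrite !GL_MxE zE mulNmx mulmxN mul1mx mulmx1.
Qed.

(** A set-theoretic section chosen by [repr], hence multiplicative only up to sign. *)
Definition PSL_lift (g : [subg PSL 2 F]) : 'M[F]_2 := GLval (repr (sgval g : coset_of Z)).

Lemma repr_PSL (g : [subg PSL 2 F]) :
  repr (sgval g : coset_of Z) \in SL 2 F /\ coset Z (repr (sgval g : coset_of Z)) = sgval g.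
Proof.
split; last exact: coset_reprK.
have /morphimP[x xN xS ->] := subgP g.
have : repr (coset Z x) \in (coset Z x : {set {'GL_2[F]}}) by exact: mem_repr_coset.
rewrite val_coset // => /rcosetP[z /centerP[zS _] ->].
by rewrite groupM.
Qed.

Lemma SL_normZ x : x \in SL 2 F -> x \in 'N(Z)%g.
Proof. exact: (subsetP (gFnorm center_igFun (SL_group 2 F))). Qed.

Lemma det_PSL_lift g : \det (PSL_lift g) = 1.
Proof. by have [] := repr_PSL g; rewrite inE => /eqP. Qed.

Lemma PSL_lift_coset x y : x \in SL 2 F -> y \in SL 2 F -> coset Z x = coset Z y ->
  GLval x = GLval y \/ GLval x = - GLval y.
Proof.
move=> xS yS e; have : x \in (Z :* y)%g.
  by rewrite -(val_coset (SL_normZ yS)) -e (val_coset (SL_normZ xS)) rcoset_refl.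
case/rcosetP => z zZ ->; rewrite GL_MxE.
by case: (center_SL_sign zZ) => ->; [left; rewrite mul1mx | right; rewrite mulNmx mul1mx].
Qed.

Lemma PSL_liftM g h : PSL_lift (g * h)%g = PSL_lift g *m PSL_lift h
  \/ PSL_lift (g * h)%g = - (PSL_lift g *m PSL_lift h).
Proof.
have [gS gE] := repr_PSL g; have [hS hE] := repr_PSL h; have [ghS ghE] := repr_PSL (g * h)%g.
rewrite -[PSL_lift g *m _]/(GLval (repr (sgval g : coset_of Z) * repr (sgval h : coset_of Z))%g).
apply: PSL_lift_coset; rewrite ?groupM //.
rewrite ghE [RHS]morphM ?SL_normZ //; congr (_ * _)%g; apply/esym; [exact: gE | exact: hE].
Qed.

Lemma PSL_lift_inj g h : PSL_lift g = PSL_lift h \/ PSL_lift g = - PSL_lift h -> g = h.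
Proof.
have [gS gE] := repr_PSL g; have [hS hE] := repr_PSL h.
move=> e; apply: subg_inj; rewrite -gE -hE; case: e => e.
  by congr (coset _ _); apply: GLval_inj.
have [z zZ zE] := SL_opp1.
have -> : repr (sgval g : coset_of Z) = (z * repr (sgval h : coset_of Z))%g.
  by apply: GLval_inj; rewrite GL_MxE zE mulNmx mul1mx.
have zS : z \in SL 2 F by case/centerP: zZ.
rewrite [LHS]morphM ?SL_normZ //; rewrite [X in (X * _)%g](coset_id zZ); exact: mul1g.
Qed.

Lemma PSL_lift_surj A : \det A = 1 -> exists g, PSL_lift g = A \/ PSL_lift g = - A.
Proof.
move=> dA; have [AS AE] := GL_of_SL dA.
have gP : coset Z (GL_of A) \in PSL 2 F by rewrite mem_quotient.
exists (subg _ (coset Z (GL_of A))).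
have [gS gE] := repr_PSL (subg _ (coset Z (GL_of A))).
have := PSL_lift_coset gS AS; rewrite AE; apply.
by rewrite gE subgK.
Qed.

(** Both sides count GL(2, p): the center of SL(2, p) has order 2, and each of the [p.-1] fibres of
    the determinant is a translate of SL(2, p). The product form avoids division. *)
Lemma card_PSL : (2 < p)%N -> (#|[subg PSL 2 F]| * 2 * p.-1 = p * p.-1 ^ 2 * p.+1)%N.
Proof.
move=> p_gt2.
have cZ : #|Z| = 2%N.
  have [z zZ zE] := SL_opp1.
  have z1 : z != 1%g.
    apply/eqP => z1; move: zE; rewrite z1 GL_1E mx2_1 opp_mx2 => /mx2_inj[/eqP].
    by rewrite -subr_eq0 opprK -(natrD _ 1 1) -(dvdn_pcharf (pchar_Fp p_pr)) gtnNdvd.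
  rewrite (_ : Z = [set 1%g; z]) ?cards2 1?eq_sym ?z1 //.
  apply/eqP; rewrite eq_sym eqEsubset; apply/andP; split.
    by apply/subsetP => x /set2P[] ->; rewrite ?group1.
  apply/subsetP => x /center_SL_sign xE; rewrite in_set2.
  by case: xE => xE; apply/orP; [left|right]; apply/eqP/GLval_inj; rewrite xE ?zE ?GL_1E.
have cG : (#|[subg PSL 2 F]| * 2 = #|SL 2 F|)%N.
  have -> : #|[subg PSL 2 F]| = #|(SL_group 2 F / Z)%g| by rewrite card_sub; apply: eq_card.
  by rewrite -[X in (_ * X = _)%N]cZ card_quotient ?gFnorm // mulnC Lagrange // center_sub.
have cGL : #|[set: {'GL_2[F]}]| = (p * p.-1 ^ 2 * p.+1)%N by rewrite -[LHS]/#|'GL_2[F]%g|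
  card_GL_2 card_Fp.
rewrite cG -cGL.
pose D0 := [set d : F | d != 0].
have cF : p.-1 = #|D0|.
  rewrite -[in LHS](card_Fp p_pr).
  by rewrite -(cardC1 (0 : F)); apply: eq_card => d; rewrite !inE.
rewrite [in LHS]cF mulnC -sum_nat_const.
rewrite -[RHS]sum1_card (partition_big (fun A : {'GL_2[F]} => \det (GLval A)) [in D0]) /=.
  apply: eq_bigr => d; rewrite inE => d0.
  pose D := GL_of (Fp_mx2 d 0 0 1).
  have DE : GLval D = Fp_mx2 d 0 0 1 by rewrite GL_ofE // unitmxE det_mx2 mulr1 mul0r subr0 unitfE.
  rewrite sum1dep_card -(card_imset (mem (SL 2 F)) (mulgI D)).
  apply: eq_card => x; rewrite [RHS]inE in_setT /=.
  apply/imsetP/eqP => [[y]|dx].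
    by rewrite inE => /eqP dy ->; rewrite GL_MxE det_mulmx dy DE det_mx2 !mulr1 mul0r subr0.
  exists (D^-1 * x)%g; last by rewrite mulKVg.
  have e : \det (GLval x) = d * \det (GLval (D^-1 * x)%g).
    by rewrite -[in LHS](mulKVg D x) GL_MxE det_mulmx DE det_mx2 mulr1 mul0r subr0.
  by rewrite inE; apply/eqP/(mulfI d0); rewrite mulr1 -e.
move=> A _; rewrite inE; have := GL_unitmx A.
by rewrite unitmxE unitfE.
Qed.

End Lift.

(** * Normal forms and symmetric powers for SL(2, 17) *)

Local Notation F := 'F_17.
Local Notation mx2 := (@Fp_mx2 17).

Lemma tr_mx2E (A : 'M[F]_2) : \tr A = A 0 0 + A 1 1.
Proof. by rewrite /mxtrace !big_ord_recl big_ord0 addr0; congr (A _ _ + A _ _); apply: val_inj. Qed.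

Lemma tr_mx2 a b c d : \tr (mx2 a b c d) = a + d.
Proof. by rewrite tr_mx2E !mxE. Qed.

Lemma F17_forall (P : pred F) : all P [seq inZp i | i <- iota 0 17] -> forall x, P x.
Proof.
move/allP=> h x; apply: h; apply/mapP; exists (val x); last by rewrite valZpK.
by rewrite mem_iota /= ltn_ord.
Qed.

Lemma complete_square (K : fieldType) (b e c X y : K) : (2 : K) != 0 -> b != 0 ->
  X ^+ 2 - (e ^+ 2 + 4 * b * c) * y ^+ 2 = 4 * b ->
  b * ((X - e * y) / (2 * b)) ^+ 2 + e * ((X - e * y) / (2 * b)) * y - c * y ^+ 2 = 1.
Proof.
move=> n2 b0 XE; have n4 : (4 : K) != 0 by rewrite (_ : 4 = 2 * 2) ?mulf_neq0 //; ring.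
apply: (mulfI (mulf_neq0 n4 b0)); rewrite mulr1 -[RHS]XE; field.
by rewrite n2 b0.
Qed.

(** A nondegenerate binary quadratic form over a finite field takes every value. After completing
    the square this is checked by enumeration; for [b = 0] the form is affine in [x] at [y = 1]. *)
Lemma binary_form_repr (b e c : F) : e ^+ 2 + 4 * b * c != 0 ->
  exists x y, b * x ^+ 2 + e * x * y - c * y ^+ 2 = 1.
Proof.
have sol : forall al de : F, de != 0 -> exists X y : F, X ^+ 2 - de * y ^+ 2 = al.
  pose l := [seq (inZp i : F) | i <- iota 0 17].
  pose T (al de : F) := (de != 0) ==> has (fun X => has (fun y => X ^+ 2 - de * y ^+ 2 == al) l) l.
  have h : all (fun al => all (T al) l) l by vm_compute.
  move=> al de d0; have := F17_forall (F17_forall h al) de; rewrite /T d0 implyTb.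
  by case/hasP => X _ /hasP[y _ /eqP e0]; exists X, y.
move=> D0; have [b0|b0] := eqVneq b 0.
  have e0 : e != 0 by apply: contraNneq D0 => ->; rewrite b0 mulr0 mul0r expr0n addr0.
  by exists ((1 + c) / e), 1; rewrite b0 mul0r add0r mulr1 mulrC divfK // expr1n mulr1 addrK.
have [X [y XE]] := sol (4 * b) _ D0.
exists ((X - e * y) / (2 * b)), y.
exact: complete_square.
Qed.

(** 3 is not a square modulo 17, so 1 and 3 represent the two classes of nonzero elements modulo
    squares. *)
Lemma square_or_triple (b : F) : b != 0 -> exists x, b * x ^+ 2 = 1 \/ b * x ^+ 2 = 3.
Proof.
pose l := [seq (inZp i : F) | i <- iota 0 17].
pose T (b : F) := (b != 0) ==> has (fun x => (b * x ^+ 2 == 1) || (b * x ^+ 2 == 3)) l.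
have h : all T l by vm_compute.
move=> b0; have := F17_forall h b; rewrite /T b0 implyTb => /hasP[x _ /orP[]/eqP e]; exists x;
  [by left|by right].
Qed.

Lemma three_nonsquare (x : F) : 3 * x ^+ 2 != 1.
Proof. by move: x; apply: F17_forall; vm_compute. Qed.

(** [P] has rows v and v A for a vector v = (x, y). Its determinant is a quadratic form in v of
    discriminant tr(A)^2 - 4, so v can be chosen with determinant exactly 1: the conjugation takes
    place in SL and not merely in GL. *)
Lemma mx2_companion (A : 'M[F]_2) : \det A = 1 -> (\tr A) ^+ 2 != 4 ->
  exists2 P, \det P = 1 & P *m A = mx2 0 1 (-1) (\tr A) *m P.
Proof.
rewrite (mx2_eta A); move: (A 0 0) (A 0 1) (A 1 0) (A 1 1) => a b c d;
  rewrite det_mx2 tr_mx2 => dA tA.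
have [|x [y xyE]] := @binary_form_repr b (d - a) c.
  apply: contra tA => /eqP e0; rewrite -subr_eq0; apply/eqP.
  transitivity ((d - a) ^+ 2 + 4 * b * c + 4 * (a * d - b * c - 1)); first by ring.
  by rewrite e0 dA; ring.
exists (mx2 x y (x * a + y * c) (x * b + y * d)).
  by rewrite det_mx2 -xyE; ring.
rewrite !mul_mx2; congr mx2; try ring.
  transitivity ((a + d) * (x * a + y * c) - x * (a * d - b * c)); first by ring.
  by rewrite dA; ring.
transitivity ((a + d) * (x * b + y * d) - y * (a * d - b * c)); first by ring.
by rewrite dA; ring.
Qed.

(** [P] has rows v and v (A - 1)/be, where [be] is the determinant of the rows v and v (A - 1). This
    quadratic form in v has discriminant 0, hence takes nonzero values in a single square class, and
    [be] can be made 1 or 3. *)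
Lemma mx2_unipotent (A : 'M[F]_2) : \det A = 1 -> \tr A = 2 -> A != 1 ->
  exists P be, [/\ \det P = 1, be = 1 \/ be = 3 & P *m A = mx2 1 be 0 1 *m P].
Proof.
rewrite (mx2_eta A); move: (A 0 0) (A 0 1) (A 1 0) (A 1 1) => a b c d;
  rewrite det_mx2 tr_mx2 => dA tA.
have dE : d = 2 - a by rewrite -tA; ring.
move: dA; rewrite {}dE {d tA} => dA A1.
have bc : b * c = - (a - 1) ^+ 2 by rewrite -[b * c]addr0 -(subrr 1) -{1}dA; ring.
have [x [y [be [beP beE]]]] : exists x y be, (be = 1 \/ be = 3) /\ b * x ^+ 2 - 2 * (a - 1) * x *
  y - c * y ^+ 2 = be.
  have [b0|b0] := eqVneq b 0; last first.
    have [x xP] := square_or_triple b0; exists x, 0, (b * x ^+ 2); split=> //; ring.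
  have a1 : a = 1.
    by move: bc; rewrite b0 mul0r => /esym/eqP; rewrite oppr_eq0 sqrf_eq0 subr_eq0 => /eqP.
  have c0 : - c != 0.
    apply: contraNneq A1 => /eqP; rewrite oppr_eq0 => /eqP ->.
    by rewrite b0 a1 mx2_1; apply/eqP; congr mx2; ring.
  have [y yP] := square_or_triple c0; exists 0, y, (- c * y ^+ 2); split=> //; rewrite b0; ring.
have be0 : be != 0 by case: beP => ->.
exists (mx2 x y ((x * (a - 1) + y * c) / be) ((x * b + y * (1 - a)) / be)), be; split=> //.
  by rewrite det_mx2; apply: (mulfI be0); rewrite mulr1 -[RHS]beE; field.
rewrite !mul_mx2; congr mx2; try by field.
  apply: (mulfI be0); apply/eqP; rewrite -subr_eq0; apply/eqP.
  transitivity (x * (b * c + (a - 1) ^+ 2)); first by field.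
  by rewrite bc; ring.
apply: (mulfI be0); apply/eqP; rewrite -subr_eq0; apply/eqP.
transitivity (y * (b * c + (a - 1) ^+ 2)); first by field.
by rewrite bc; ring.
Qed.

Lemma order_pfactor (gT : finGroupType) (x : gT) p k :
  prime p -> (x ^+ (p ^ k) != 1)%g -> (x ^+ (p ^ k.+1) = 1)%g -> #[x]%g = (p ^ k.+1)%N.
Proof.
move=> p_pr xk xk1; have : (#[x]%g %| p ^ k.+1)%N by rewrite order_dvdn xk1.
case/(dvdn_pfactor _ _ p_pr) => m; rewrite leq_eqVlt => /orP[/eqP -> //|].
rewrite ltnS => mk ox; case/eqP: xk; apply/eqP.
by rewrite -order_dvdn ox dvdn_exp2l.
Qed.

(* The action on binary forms of degree 2 and 4; both are even in [A], hence
   induce representations of PSL(2, 17). *)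
Definition sym2_mx (A : 'M[F]_2) : 'M[F]_3 :=
  let a := A 0 0 in let b := A 0 1 in let c := A 1 0 in let d := A 1 1 in
  \matrix_(i, j) nth 0 (nth [::]
   [:: [:: a ^+ 2; 2 * a * b; b ^+ 2];
       [:: a * c; a * d + b * c; b * d];
       [:: c ^+ 2; 2 * c * d; d ^+ 2]] i) j.

Definition sym4_mx (A : 'M[F]_2) : 'M[F]_5 :=
  let a := A 0 0 in let b := A 0 1 in let c := A 1 0 in let d := A 1 1 in
  \matrix_(i, j) nth 0 (nth [::]
   [:: [:: a ^+ 4; 4 * a ^+ 3 * b; 6 * a ^+ 2 * b ^+ 2; 4 * a * b ^+ 3; b ^+ 4];
       [:: a ^+ 3 * c; a ^+ 3 * d + 3 * a ^+ 2 * b * c; 3 * a ^+ 2 * b * d + 3 * a * b ^+ 2 * c;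
           3 * a * b ^+ 2 * d + b ^+ 3 * c; b ^+ 3 * d];
       [:: a ^+ 2 * c ^+ 2; 2 * a ^+ 2 * c * d + 2 * a * b * c ^+ 2;
           a ^+ 2 * d ^+ 2 + 4 * a * b * c * d + b ^+ 2 * c ^+ 2;
           2 * a * b * d ^+ 2 + 2 * b ^+ 2 * c * d; b ^+ 2 * d ^+ 2];
       [:: c ^+ 3 * a; c ^+ 3 * b + 3 * c ^+ 2 * d * a; 3 * c ^+ 2 * d * b + 3 * c * d ^+ 2 * a;
           3 * c * d ^+ 2 * b + d ^+ 3 * a; d ^+ 3 * b];
       [:: c ^+ 4; 4 * c ^+ 3 * d; 6 * c ^+ 2 * d ^+ 2; 4 * c * d ^+ 3; d ^+ 4]] i) j.

Lemma sym2_mxM A B : sym2_mx (A *m B) = sym2_mx A *m sym2_mx B.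
Proof.
rewrite (mx2_eta A) (mx2_eta B).
move: (A 0 0) (A 0 1) (A 1 0) (A 1 1) => a b c d.
move: (B 0 0) (B 0 1) (B 1 0) (B 1 1) => a' b' c' d'.
rewrite mul_mx2; apply/matrixP => i j; rewrite mxE [RHS]mxE !big_ord_recl big_ord0 !mxE /=.
by case: i => -[|[|[|//]]] ?; case: j => -[|[|[|//]]] ? /=; ring.
Qed.

Lemma sym4_mxM A B : sym4_mx (A *m B) = sym4_mx A *m sym4_mx B.
Proof.
rewrite (mx2_eta A) (mx2_eta B).
move: (A 0 0) (A 0 1) (A 1 0) (A 1 1) => a b c d.
move: (B 0 0) (B 0 1) (B 1 0) (B 1 1) => a' b' c' d'.
rewrite mul_mx2; apply/matrixP => i j; rewrite mxE [RHS]mxE !big_ord_recl big_ord0 !mxE /=.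
by case: i => -[|[|[|[|[|//]]]]] ?; case: j => -[|[|[|[|[|//]]]]] ? /=; ring.
Qed.

Lemma sym2_mxN A : sym2_mx (- A) = sym2_mx A.
Proof.
apply/matrixP => i j; rewrite !mxE.
by case: i => -[|[|[|//]]] ?; case: j => -[|[|[|//]]] ? /=; ring.
Qed.

Lemma sym4_mxN A : sym4_mx (- A) = sym4_mx A.
Proof.
apply/matrixP => i j; rewrite !mxE.
by case: i => -[|[|[|[|[|//]]]]] ?; case: j => -[|[|[|[|[|//]]]]] ? /=; ring.
Qed.

Lemma sym2_mx1 : sym2_mx 1 = 1.
Proof.
apply/matrixP => i j; rewrite !mxE /=.
by case: i => -[|[|[|//]]] ?; case: j => -[|[|[|//]]] ? /=; rewrite -?val_eqE /=; ring.
Qed.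

Lemma sym4_mx1 : sym4_mx 1 = 1.
Proof.
apply/matrixP => i j; rewrite !mxE /=.
by case: i => -[|[|[|[|[|//]]]]] ?; case: j => -[|[|[|[|[|//]]]]] ? /=; rewrite -?val_eqE /=; ring.
Qed.

Lemma tr_sym2 A : \det A = 1 -> \tr (sym2_mx A) = (\tr A ^+ 2 - 2) + 1.
Proof.
rewrite det_mx2E tr_mx2E /mxtrace !big_ord_recl big_ord0 !mxE /= => dA.
transitivity ((A 0 0 + A 1 1) ^+ 2 - (A 0 0 * A 1 1 - A 0 1 * A 1 0)); first by ring.
by rewrite dA; ring.
Qed.

Lemma tr_sym4 A : \det A = 1 ->
  \tr (sym4_mx A) = (\tr A ^+ 2 - 2) ^+ 2 + (\tr A ^+ 2 - 2) - 1.
Proof.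
rewrite det_mx2E tr_mx2E /mxtrace !big_ord_recl big_ord0 !mxE /=.
move: (A 0 0) (A 0 1) (A 1 0) (A 1 1) => a b c d dA.
transitivity (((a + d) ^+ 2 - 2 * (a * d - b * c)) ^+ 2 + ((a + d) ^+ 2 - 2 * (a * d - b * c)) *
  (a * d - b * c) - (a * d - b * c) ^+ 2); first by ring.
by rewrite dA; ring.
Qed.

(** * Partial augmentations and class functions on powers *)

Section PaugClass.
Variables (gT : finGroupType).
Implicit Types (u v : group_ring int gT) (x y g : gT).

Lemma paug_class u x y : y \in (x ^: [set: gT])%g -> paug u y = paug u x.
Proof. by move/class_eqP; rewrite /paug => ->. Qed.

Lemma paug_elt g x : paug (gr_elt g) x = (g \in (x ^: [set: gT])%g)%:R.
Proof.
rewrite /paug; have [gx|gx] := boolP (g \in _).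
  rewrite (bigD1 g) //= ffunE eqxx big1 ?addr0 // => h /andP[_ /negPf hg].
  by rewrite ffunE hg.
rewrite big1 // => h hx; rewrite ffunE (_ : h == g = false) //.
by apply: contraNF gx => /eqP <-.
Qed.

Lemma gr_eltM g h : gr_elt (g * h)%g = gr_elt g * gr_elt h :> group_ring int gT.
Proof.
apply: group_ringP => x; rewrite !ffunE (bigD1 g) //= !ffunE eqxx mul1r big1 ?addr0.
  by rewrite -(inj_eq (mulgI g^-1%g)) mulKg.
by move=> y /negPf yg; rewrite ffunE yg mul0r.
Qed.

Lemma gr_eltX g k : gr_elt (g ^+ k)%g = gr_elt g ^+ k :> group_ring int gT.
Proof. by elim: k => [|k IHk] //; rewrite expgS gr_eltM IHk exprS. Qed.

(** Both sides vanish unless the order of [x] divides [n]; in that case [x] is a [k]-th power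
    [y ^+ k], and [paug_coprime] leads back to the partial augmentations of [u] and [v] at [y]. *)
Lemma paugX_coprime u v n k : (0 < n)%N -> u ^+ n = 1 -> v ^+ n = 1 -> coprime k n ->
  (forall x, paug u x = paug v x) -> forall x, paug (u ^+ k) x = paug (v ^+ k) x.
Proof.
move=> n_gt0 un vn kn uv x.
have [xn|xn] := boolP (#[x]%g %| n)%N; last first.
  by rewrite !(paug_eq0 n_gt0) // exprAC ?un ?vn expr1n.
have ckx : coprime #[x]%g k by rewrite coprime_sym (coprime_dvdr xn).
have [y yx xE] : exists2 y, (#[y]%g %| n)%N & x = (y ^+ k)%g.
  exists (x ^+ expg_invn <[x]>%g k)%g; first exact: dvdn_trans (orderXdvd _ _) xn.
  by rewrite -[LHS](expgK ckx (cycle_id x)) -!expgM mulnC.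
have cn : coprime k (lcmn #[y]%g n) by rewrite (_ : lcmn _ _ = n) //; apply/lcmn_idPr.
by rewrite xE !(paug_coprime n_gt0) // uv.
Qed.

Lemma paugX_pfactor u v p a : prime p -> u ^+ (p ^ a.+1) = 1 -> v ^+ (p ^ a.+1) = 1 ->
  (forall x, paug u x = paug v x) -> (forall k x, paug ((u ^+ p) ^+ k) x = paug ((v ^+ p) ^+ k) x)
    ->
  forall k x, paug (u ^+ k) x = paug (v ^+ k) x.
Proof.
move=> p_pr un vn uv uvp k x.
have [/dvdnP[j ->]|pk] := boolP (p %| k)%N; first by rewrite mulnC !exprM.
apply: (@paugX_coprime _ _ (p ^ a.+1)) => //; first by rewrite expn_gt0 prime_gt0.
by rewrite coprime_sym coprimeXl // prime_coprime.
Qed.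

End PaugClass.

(** Replacing [k] by [K] does not change [u ^+ k] when [u ^+ n = 1], but with [N] the group order it
    makes g -> g^K a bijection of the group. *)
Lemma exists_coprime_lift k n N : (0 < n)%N -> (0 < N)%N -> coprime k n ->
  exists2 K, coprime K N & K = k %[mod n].
Proof.
move=> n_gt0 N_gt0 kn.
have cop : coprime n N`_\pi(n)^'.
  by rewrite (@pnat_coprime \pi(n)) ?pnat_pi ?part_pnat.
pose K := (n * N`_\pi(n)^' + chinese n N`_\pi(n)^' k 1)%N.
have K_gt0 : (0 < K)%N by rewrite addn_gt0 muln_gt0 n_gt0 part_gt0.
have Kn : K = k %[mod n] by rewrite /K mulnC modnMDl chinese_modl.
exists K => //; rewrite -(partnC \pi(n) N_gt0) coprimeMr; apply/andP; split.
  have nK : coprime n K by rewrite coprime_sym -coprime_modl Kn coprime_modl.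
  by rewrite coprime_sym (@pnat_coprime \pi(n)) ?part_pnat // -coprime_pi'.
by rewrite -coprime_modl /K modnMDl chinese_modr // coprime_modl coprime1n.
Qed.

(** For [K] prime to the group order, the powers [r ^+ K] are again class representatives, and
    [paug_coprime] moves their partial augmentations back to [u]. *)
Lemma sum_gr_coef_coprime (gT : finGroupType) (R : pzRingType) (s : seq gT)
    (u : group_ring int gT) n k (f : gT -> R) :
  (forall g, count (fun r => g \in (r ^: [set: gT])%g) s = 1)%N ->
  (0 < n)%N -> u ^+ n = 1 -> coprime k n -> (forall g h, f (g ^ h)%g = f g) ->
  \sum_g (gr_coef (u ^+ k) g)%:~R * f g = \sum_(r <- s) (paug u r)%:~R * f (r ^+ k)%g.
Proof.
move=> s1 n_gt0 un kn fJ; have N_gt0 : (0 < #|gT|)%N by apply/card_gt0P; exists 1%g.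
have [K KN Kk] := exists_coprime_lift n_gt0 N_gt0 kn.
have cK (x : gT) : coprime #[x]%g K.
  rewrite coprime_sym; apply: coprime_dvdr KN.
  by have := @order_dvdG _ [set: gT]%G x (in_setT x); rewrite cardsT.
have -> : u ^+ k = u ^+ K by rewrite -(expr_mod k un) -Kk expr_mod.
rewrite (@sum_gr_coef_class _ _ [seq (r ^+ K)%g | r <- s]) //.
  rewrite big_map; apply: eq_bigr => r _; rewrite (paug_coprime n_gt0 un) //.
    have [rn|rn] := boolP (#[r]%g %| n)%N; last by rewrite (paug_eq0 n_gt0) ?mul0r.
    have modr j : (r ^+ j = r ^+ (j %% n))%g.
      by rewrite {1}(divn_eq j n) expgD mulnC expgM (eqP (_ : r ^+ n == 1)%g) ?expg1n ?mul1g //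
        -order_dvdn.
    by rewrite modr Kk -modr.
  have Kn : coprime K n by rewrite -coprime_modl Kk coprime_modl.
  apply: (@coprime_dvdr _ (#[r]%g * n)); first by rewrite dvdn_lcm dvdn_mulr ?dvdn_mull.
  by rewrite coprimeMr Kn coprime_sym cK.
move=> g; rewrite count_map -[RHS](s1 (g ^+ expg_invn [set: gT] K)%g).
have cT : coprime #|[set: gT]%G| K by rewrite cardsT coprime_sym.
apply: eq_count => r /=; apply/imsetP/imsetP => -[h _ e]; exists h; rewrite ?inE //.
  by rewrite e -conjXg expgK ?inE.
by rewrite conjXg -e -expgM mulnC expgM (expgK cT) ?inE.
Qed.

(** Dickson polynomials: z^k + z^-k as a polynomial in z + z^-1. Through them eigenvalues outside
    ['F_17] are handled by computations inside it. *)
Fixpoint cheb (R : pzRingType) (t : R) k : R :=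
  if k is k1.+1 then if k1 is k2.+1 then t * cheb t k1 - cheb t k2 else t else 2.

Lemma pchar_F17 : 17 \in [pchar F]. Proof. exact: (pchar_Fp (isT : prime 17)). Qed.

Lemma Fp_int_eq0 p (z : int) : prime p -> z%:~R = 0 :> 'F_p -> exists q, z = p%:Z * q.
Proof.
move=> p_pr z0; suff /dvdzP[q ->] : (p %| z)%Z by exists q; rewrite mulrC.
have : (`|z|%N)%:R == 0 :> 'F_p.
  by case: z z0 => n; rewrite ?NegzE ?rmorphN => /eqP; rewrite ?oppr_eq0 -?pmulrn.
by rewrite -(dvdn_pcharf (pchar_Fp p_pr)).
Qed.

Lemma root_of_trace (s : F) : exists (K : fieldType) (i : {rmorphism F -> K}) (z : K),
  z != 0 /\ z + z^-1 = i s.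
Proof.
have [K [i _]] := countable_algebraic_closure F.
have [z] := solve_monicpoly (fun j => if j == 0%N then -1 else i s) (isT : (0 < 2)%N).
rewrite !big_ord_recl big_ord0 /= expr0 mulr1 expr1 addr0 => e.
have z0 : z != 0.
  by apply: contra_eq_neq e => ->; rewrite expr0n mulr0 addr0 eq_sym oppr_eq0 oner_eq0.
exists K, i, z; split=> //; apply: (mulfI z0).
by rewrite mulrDr divff // -expr2 e addrAC addNr add0r mulrC.
Qed.

Lemma chebE (K : fieldType) (z t : K) k : z != 0 -> z + z^-1 = t -> cheb t k = z ^+ k + z ^- k.
Proof.
move=> z0 <-; suff [] : cheb (z + z^-1) k = z ^+ k + z ^- k /\ cheb (z + z^-1) k.+1 = z ^+ k.+1 +
  z ^- k.+1 by [].
elim: k => [|k [IH1 IH2]]; first by rewrite /= !expr0 invr1 !expr1.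
split=> //; rewrite -[LHS]/((z + z^-1) * cheb (z + z^-1) k.+1 - cheb (z + z^-1) k) IH1 IH2 -!exprVn.
by rewrite !exprS; field.
Qed.

Lemma cheb_rmorph (R S : pzRingType) (i : {rmorphism R -> S}) t k : i (cheb t k) = cheb (i t) k.
Proof.
suff [] : i (cheb t k) = cheb (i t) k /\ i (cheb t k.+1) = cheb (i t) k.+1 by [].
elim: k => [|k [IH1 IH2]]; first by rewrite /= rmorph_nat.
split=> //; rewrite -[X in i X]/(t * cheb t k.+1 - cheb t k) rmorphB rmorphM IH1 IH2.
by [].
Qed.

Lemma add_inv_eq2 (K : fieldType) (w : K) : w != 0 -> w + w^-1 = 2 -> w = 1.
Proof.
move=> w0 e; have : (w - 1) ^+ 2 = 0.
  have -> : (w - 1) ^+ 2 = w * (w + w^-1 - 2) by field.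
  by rewrite e subrr mulr0.
by move/eqP; rewrite sqrf_eq0 subr_eq0 => /eqP.
Qed.

(** [s] encodes an eigenvalue [z] by z + z^-1 = s, and [cheb s n = 2] says z^n = 1. As the traces
    are symmetric under k -> n - k, the formulas with [z] and with its inverse give the same
    multiplicity; their sum has all its terms in the prime field. *)
Lemma eigenvalue_multiplicity d (rho : 'M[F]_d) n s (t : nat -> F) :
  n%:R != 0 :> F -> rho ^+ n = 1 -> cheb s n = 2 ->
  (forall k, (k < n)%N -> \tr (rho ^+ k) = t k) ->
  (forall k, (0 < k < n)%N -> t (n - k)%N = t k) ->
  exists2 m, (m <= d)%N & (2 * n * m)%:R = \sum_(k < n) cheb s k * t k.
Proof.
move=> nF rn sn trE tn.
have [K [i [z [z0 zs]]]] := root_of_trace s.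
have zn : z ^+ n = 1.
  apply: (add_inv_eq2 (expf_neq0 n z0)).
  by rewrite -(chebE _ z0 zs) -cheb_rmorph sn rmorph_nat.
have nK : n%:R != 0 :> K by rewrite -(rmorph_nat i) fmorph_eq0.
pose B k := map_mx i rho ^+ k.
have BM j k : B j *m B k = B (j + k)%N by rewrite /B exprD.
have Bn : B n = B 0%N by rewrite /B -!rmorphXn rn expr0.
have rm := root_mult BM Bn nK.
exists (\rank (root_proj n B z)); first exact: rank_leq_row.
have n_gt0 : (0 < n)%N by case: (n) nF => //; rewrite eqxx.
have trB k : (k < n)%N -> \tr (B k) = i (t k).
  by move=> kn; rewrite /B -rmorphXn trace_map_mx trE.
have e1 := rm z zn.
have e2 : n%:R * (\rank (root_proj n B z))%:R = \sum_(k < n) z ^+ k * i (t k).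
  rewrite e1; case: (n) n_gt0 zn trB tn => // n' _ zn' trB' tn'.
  rewrite big_ord_recl [RHS]big_ord_recl trB' // !expr0 invr1; congr (_ + _).
  rewrite (reindex_inj rev_ord_inj); apply: eq_bigr => k _ /=.
  have kE : bump 0 (n' - k.+1) = (n'.+1 - bump 0 k)%N by rewrite /bump /= !add1n subSS subnSK.
  rewrite trB' ?kE; last by rewrite ltn_subrL.
  rewrite tn'; last by rewrite /bump /= add1n ltnS ltn_ord.
  congr (_ * _).
  apply: (mulfI (expf_neq0 (n'.+1 - bump 0 k) z0));
    rewrite divff ?expf_neq0 // -exprD subnK ?zn' //.
  by rewrite /bump /= add1n; apply: leqW (ltn_ord k).
apply: (fmorph_inj i); rewrite rmorph_nat rmorph_sum /= 2!natrM -mulrA.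
transitivity (n%:R * (\rank (root_proj n B z))%:R + n%:R * (\rank (root_proj n B z))%:R : K);
  first by ring.
rewrite {1}e1 e2 -big_split /=; apply: eq_bigr => k _.
by rewrite trB // rmorphM cheb_rmorph (chebE _ z0 zs) mulrDl addrC.
Qed.

(** * Integer constraints on the partial augmentations *)

Fixpoint dotz (a b : seq int) : int :=
  if a is x :: a' then if b is y :: b' then x * y + dotz a' b' else 0 else 0.

Lemma dotzE n (a b : seq int) : size a = n -> size b = n ->
  dotz a b = \sum_(k < n) nth 0 a k * nth 0 b k.
Proof.
elim: n a b => [|n IHn] [|x a] [|y b] //= => [_ _|[sa] [sb]]; first by rewrite big_ord0.
by rewrite big_ord_recl /= (IHn a b).
Qed.

Lemma weighted_sum_bound (gT : finGroupType) (u : group_ring int gT) (N : int) (x0 x1 x2 x3 x4 x5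
  x6 x7 x8 x9 x10 : gT) :
  \sum_(r <- [:: x0; x1; x2; x3; x4; x5; x6; x7; x8; x9; x10]) paug u r ^+ 2 *+ #|'C[r]%g| <= N ->
  all (fun x => 8 <= #|'C[x]%g|)%N [:: x1; x2; x3; x4] ->
  all (fun x => 9 <= #|'C[x]%g|)%N [:: x5; x6; x7; x8] ->
  all (fun x => 17 <= #|'C[x]%g|)%N [:: x9; x10] ->
  8 * (paug u x1 ^+ 2 + paug u x2 ^+ 2 + paug u x3 ^+ 2 + paug u x4 ^+ 2)
  + 9 * (paug u x5 ^+ 2 + paug u x6 ^+ 2 + paug u x7 ^+ 2 + paug u x8 ^+ 2)
  + 17 * (paug u x9 ^+ 2 + paug u x10 ^+ 2) <= N.
Proof.
have le (x : gT) c : (c <= #|'C[x]%g|)%N -> c%:R * paug u x ^+ 2 <= paug u x ^+ 2 *+ #|'C[x]%g|.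
  by move=> cx; rewrite mulr_natl ler_wpMn2l ?sqr_ge0.
rewrite !big_cons big_nil => bound.
case/and5P => /le h1 /le h2 /le h3 /le h4 _; case/and5P => /le h5 /le h6 /le h7 /le h8 _.
case/and3P => /le h9 /le h10 _.
have h0 : 0 <= paug u x0 ^+ 2 *+ #|'C[x0]%g| by rewrite mulrn_wge0 ?sqr_ge0.
lra.
Qed.

Lemma dotz_map (T : Type) (f g : T -> int) s : dotz (map f s) (map g s) = \sum_(t <- s) f t * g t.
Proof. by elim: s => [|t s IHs]; rewrite ?big_nil // big_cons -IHs. Qed.

(* [comp_el t], for [t] in this list, represents the classes of elements of
   respective orders 2, 4, 8, 8, 3, 9, 9, 9. *)
Definition traces : seq F := [:: 0; 6; 5; 8; 1; 3; 7; 4].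

(** [cheb (t ^+ 2 - 2) k] is [tau] of the [k]-th power of [comp_el t]. Values are lifted to integers
    from 0 to 16 so that the constraints can be solved over the integers. *)
Definition char_coefs (h : F -> F) k : seq int := [seq (val (h (cheb (t ^+ 2 - 2) k)))%:Z | t <-
  traces].

Lemma sum_seq8 (T : Type) (f : T -> int) (a0 a1 a2 a3 a4 a5 a6 a7 : T) :
  \sum_(t <- [:: a0; a1; a2; a3; a4; a5; a6; a7]) f t =
  f a0 + f a1 + f a2 + f a3 + f a4 + f a5 + f a6 + f a7.
Proof. by rewrite !big_cons big_nil addr0 !addrA. Qed.

Lemma sum_dotz (T : Type) (R : pzRingType) (x : T -> int) (F : T -> R) s (c : seq int) :
  map F s = map intr c -> \sum_(t <- s) (x t)%:~R * F t = (dotz (map x s) c)%:~R.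
Proof.
elim: s c => [|t s IHs] [|y c] //=; first by rewrite big_nil.
by case=> Ft /IHs e; rewrite big_cons e Ft rmorphD rmorphM.
Qed.

Lemma frobenius_iter (gT : finGroupType) (R : comNzRingType) p a (u : group_ring int gT) (f : gT
  -> R) :
  p \in [pchar R] -> (forall g h, f (g ^ h)%g = f g) ->
  \sum_g (gr_coef (u ^+ (p ^ a)) g)%:~R * f g = \sum_g (gr_coef u g)%:~R * f (g ^+ (p ^ a))%g.
Proof.
move=> pR; elim: a f => [|a IHa] f fJ; first by rewrite expn0 expr1; apply: eq_bigr => g _;
  rewrite expg1.
rewrite expnSr exprM (frobenius_congruence _ pR fJ) (IHa (fun g => f (g ^+ p)%g)) => [|g h].
  by apply: eq_bigr => g _; rewrite expgM.
by rewrite -conjXg fJ.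
Qed.

(** If the matrix has eigenvalues a, a^-1 and x = a^2 + a^-2, the second and fourth symmetric powers
    have traces 1 + x and 1 + x + (a^4 + a^-4), where the last term is x^2 - 2. *)
Definition sym2_char (x : F) : F := x + 1.
Definition sym4_char (x : F) : F := x ^+ 2 + x - 1.

(* [tz] lists the traces of the powers of [u] and [cz] the values [z^k + z^-k],
   both modulo 17; [m] is then the multiplicity of the eigenvalue [z], the
   factor 2 coming from the symmetry between [z] and its inverse. *)
Definition multiplicity_cond d n (cz tz : seq int) : Prop :=
  exists m q, (m <= d)%N /\ (2 * n * m)%:Z = dotz cz tz + 17%:Z * q.

Local Notation zs := (map Posz).

Lemma sqr_lt_324 (x : int) : x ^+ 2 < 324 -> -17 <= x <= 17.
Proof. nia. Qed.

Lemma sqr_lt_289 (x : int) : x ^+ 2 < 289 -> -16 <= x <= 16.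
Proof. nia. Qed.

Lemma linear_bounds (a b c d e f g h i j : int) : 0 <= a -> 0 <= b -> 0 <= c -> 0 <= d -> 0 <= e
  -> 0 <= f -> 0 <= g ->
  0 <= h -> 0 <= i -> 0 <= j ->
  8 * (a + b + c + d) + 9 * (e + f + g + h) + 17 * (i + j) <= 2448 ->
  [/\ a < 324, b < 324, c < 324 & d < 324] /\ [/\ e < 289, f < 289, g < 289 & h < 289].
Proof. by move=> *; split; split; lia. Qed.

Lemma dot_pow2 (p0 p6 p5 p8 p1 p3 p7 p4 : int) (x0 x1 x2 x3 x4 x5 x6 x7 : nat) : p1 = 0 -> p3 = 0
  -> p7 = 0 -> p4 = 0 ->
  dotz [:: p0; p6; p5; p8; p1; p3; p7; p4] (zs [:: x0; x1; x2; x3; x4; x5; x6;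
    x7]) = p0 * x0%:Z + p6 * x1%:Z + p5 * x2%:Z + p8 * x3%:Z.
Proof. by move=> h1 h3 h7 h4; rewrite /= h1 h3 h7 h4; lia. Qed.

Lemma dot_pow3 (p0 p6 p5 p8 p1 p3 p7 p4 : int) (x0 x1 x2 x3 x4 x5 x6 x7 : nat) : p0 = 0 -> p6 = 0
  -> p5 = 0 -> p8 = 0 ->
  dotz [:: p0; p6; p5; p8; p1; p3; p7; p4] (zs [:: x0; x1; x2; x3; x4; x5; x6;
    x7]) = p1 * x4%:Z + p3 * x5%:Z + p7 * x6%:Z + p4 * x7%:Z.
Proof. by move=> h1 h3 h7 h4; rewrite /= h1 h3 h7 h4; lia. Qed.

Lemma dot_6 (p0 p6 p5 p8 p1 p3 p7 p4 : int) (x0 x1 x2 x3 x4 x5 x6 x7 : nat) : p6 = 0 -> p5 = 0 ->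
  p8 = 0 -> p3 = 0 -> p7 = 0 -> p4 = 0 ->
  dotz [:: p0; p6; p5; p8; p1; p3; p7; p4] (zs [:: x0; x1; x2; x3; x4; x5; x6;
    x7]) = p0 * x0%:Z + p1 * x4%:Z.
Proof. by move=> h6 h5 h8 h3 h7 h4; rewrite /= h6 h5 h8 h3 h7 h4; lia. Qed.

(* [p_t] stands for the partial augmentation at [comp_el t], [y1] and [y3] for
   those at the two classes of elements of order 17. *)
Section Arithmetic.
Variables p0 p6 p5 p8 p1 p3 p7 p4 y1 y3 : int.

(** Only classes of order dividing [p ^ a] contribute, modulo [p], to the coefficient of
    [u ^+ (p ^ a)] at the identity; the list contains the orders of the elements [comp_el t]. *)
Definition coef1_cond p a : Prop := exists q,
  dotz [:: p0; p6; p5; p8; p1; p3; p7; p4] [seq ((o %| p ^ a)%N : nat)%:Z | o <- [:: 2; 4; 8; 8;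
    3; 9; 9; 9]%N]
  + (y1 + y3) * ((17 %| p ^ a)%N : nat)%:Z = p%:Z * q.

Let cp := [:: p0; p6; p5; p8; p1; p3; p7; p4].
Hypothesis total : p0 + p6 + p5 + p8 + p1 + p3 + p7 + p4 + y1 + y3 = 1.
Hypothesis bound : 8 * (p0 ^+ 2 + p6 ^+ 2 + p5 ^+ 2 + p8 ^+ 2)
  + 9 * (p1 ^+ 2 + p3 ^+ 2 + p7 ^+ 2 + p4 ^+ 2) + 17 * (y1 ^+ 2 + y3 ^+ 2) <= 2448.

Lemma arith_order17 : p0 = 0 -> p6 = 0 -> p5 = 0 -> p8 = 0 -> p1 = 0 -> p3 = 0 -> p7 = 0 -> p4 = 0
  -> y1 + y3 = 1.
Proof. clear bound cp; move: total; lia. Qed.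

(** The squares are at most 2448 / 8 = 306 in the first group and 2448 / 9 = 272 in the second. The
    resulting 16 matters: there a multiple of 17 must be 0. *)
Lemma small_paugs : [/\ -17 <= p0 <= 17, -17 <= p6 <= 17, -17 <= p5 <= 17 & -17 <= p8 <= 17] /\
  [/\ -16 <= p1 <= 16, -16 <= p3 <= 16, -16 <= p7 <= 16 & -16 <= p4 <= 16].
Proof.
have := (sqr_ge0 p0, sqr_ge0 p6, sqr_ge0 p5, sqr_ge0 p8, sqr_ge0 p1, sqr_ge0 p3, sqr_ge0 p7,
  sqr_ge0 p4, sqr_ge0 y1, sqr_ge0 y3).
case=> -[] -[] -[] -[] -[] -[] -[] -[] h0 h6 h5 h8 h1 h3 h7 h4 h9 h10.
clear cp total; move: bound.
case/(linear_bounds h0 h6 h5 h8 h1 h3 h7 h4 h9 h10) => -[b1 b2 b3 b4] [b5 b6 b7 b8].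
by split; split; (apply: sqr_lt_324 || apply: sqr_lt_289).
Qed.

Lemma arith_order2 : p6 = 0 -> p5 = 0 -> p8 = 0 -> p1 = 0 -> p3 = 0 -> p7 = 0 -> p4 = 0 -> y1 = 0
  -> y3 = 0 -> p0 = 1.
Proof. clear bound cp; move: total; lia. Qed.

Lemma arith_order3 : p0 = 0 -> p6 = 0 -> p5 = 0 -> p8 = 0 -> p3 = 0 -> p7 = 0 -> p4 = 0 -> y1 = 0
  -> y3 = 0 -> p1 = 1.
Proof. clear bound cp; move: total; lia. Qed.

Lemma arith_order4 : p5 = 0 -> p8 = 0 -> p1 = 0 -> p3 = 0 -> p7 = 0 -> p4 = 0 -> y1 = 0 -> y3 = 0 ->
  coef1_cond 2 1 ->
  let X := p0 * 16%:Z + p6 * 1%:Z + p5 * 7%:Z + p8 * 12%:Z in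
  multiplicity_cond 3 4 (zs [:: 2; 2; 2; 2]%N) [:: 3%:Z; X; 16%:Z; X] ->
  multiplicity_cond 3 4 (zs [:: 2; 15; 2; 15]%N) [:: 3%:Z; X; 16%:Z; X] ->
  p0 = 0 /\ p6 = 1.
Proof.
move=> h5 h8 h1 h3 h7 h4 h9 h10 [q0]; rewrite /cp /= => e0 [m1 [q1 []]] /= l1 e1 [m2 [q2 []]] /=
  l2 e2.
have [[b _ _ _] _] := small_paugs.
have l4 : p6 = 1 - p0 by clear -h5 h8 h1 h3 h7 h4 h9 h10 total; move: total; lia.
(* Modulo 17 the eigenvalues 1 and -1 have multiplicities [1 - p0] and [p0], so [p0] is 0 or 1
   modulo 17, and it is even. The value -16 gives [p6 = 17], against the bound. *)
have : p0 = 0 \/ p0 = -16 by clear -b l4 e0 l1 l2 e1 e2 h5 h8 h1 h3 h7 h4 h9 h10; lia.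
by case=> e; [clear -e l4; lia|move: bound; rewrite l4 e h5 h8 h1 h3 h7 h4 h9 h10].
Qed.

Lemma arith_order8 : p1 = 0 -> p3 = 0 -> p7 = 0 -> p4 = 0 -> y1 = 0 -> y3 = 0 ->
  coef1_cond 2 1 -> coef1_cond 2 2 ->
  let X := p0 * 16%:Z + p6 * 1%:Z + p5 * 7%:Z + p8 * 12%:Z in
  let Y := p0 * 16%:Z + p6 * 1%:Z + p5 * 12%:Z + p8 * 7%:Z in
  let tz2 := [:: 3%:Z; X; 1%:Z; Y; 16%:Z; Y; 1%:Z; X] in
  let X' := p0 * 1%:Z + p6 * 16%:Z + p5 * 7%:Z + p8 * 12%:Z in
  let Y' := p0 * 1%:Z + p6 * 16%:Z + p5 * 12%:Z + p8 * 7%:Z in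
  let tz4 := [:: 5%:Z; X'; 16%:Z; Y'; 1%:Z; Y'; 16%:Z; X'] in
  multiplicity_cond 3 8 (zs [:: 2; 2; 2; 2; 2; 2; 2; 2]%N) tz2 ->
  multiplicity_cond 3 8 (zs [:: 2; 15; 2; 15; 2; 15; 2; 15]%N) tz2 ->
  multiplicity_cond 3 8 (zs [:: 2; 6; 0; 11; 15; 11; 0; 6]%N) tz2 ->
  multiplicity_cond 3 8 (zs [:: 2; 11; 0; 6; 15; 6; 0; 11]%N) tz2 ->
  multiplicity_cond 5 8 (zs [:: 2; 2; 2; 2; 2; 2; 2; 2]%N) tz4 ->
  multiplicity_cond 5 8 (zs [:: 2; 15; 2; 15; 2; 15; 2; 15]%N) tz4 ->
  [/\ p0 = 0, p6 = 0 & p5 = 1 /\ p8 = 0 \/ p5 = 0 /\ p8 = 1].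
Proof.
have [[b0 b6 b5 b8] _] := small_paugs.
move=> h1 h3 h7 h4 h9 h10 [q0 e0] [q0' e0'] /=.
case=> m1 [q1 []] /= l1 e1 [m2 [q2 []]] /= l2 e2 [m3 [q3 []]] /= l3 e3 [m4 [q4 []]] /= l4 e4.
case=> m5 [q5 []] /= l5 e5 [m6 [q6 []]] /= l6 e6.
move: total bound e0 e0'; rewrite /= h1 h3 h7 h4 h9 h10 => t' b e0 e0'.
have t : p8 = 1 - p0 - p6 - p5 by clear -t'; lia.
move: b b8 e0 e0' e1 e2 e3 e4 e5 e6; rewrite t => b b8 e0 e0' e1 e2 e3 e4 e5 e6.
(* As in order 4, the eigenvalues 1 and -1 have multiplicities [1 - p0] and [p0] modulo 17 in
   dimension 3. In dimension 5 they are [1 - p6] and [p6]. The two congruences make [p0] and [p6]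
   even. *)
have c0 : p0 = 0 \/ p0 = -16 by clear -b0 e0 l1 l2 e1 e2; lia.
have c6 : p6 = 0 \/ p6 = -16 by clear -b0 b6 c0 e0' l5 l6 e5 e6; lia.
have sq x : 0 <= (2 * p5 - x) ^+ 2 := sqr_ge0 _.
have c06 : p0 = 0 /\ p6 = 0.
  (* If just one of [p0] and [p6] is -16, then [p5] and [p8] add up to 17, and the sum of their
     squares is at least 17^2 / 2, more than the bound leaves. The square of [2 * p5 - 17] supplies
     this estimate. *)
  by clear -b c0 c6 sq; have := sq 17; case: c0 b => -> ; case: c6 => -> b sq17; split=> //;
    exfalso; nia.
case: c06 b e3 e4 => -> -> b e3 e4.
(* The eigenvalues of order 8 with z + z^-1 equal to 6 and 11 have multiplicities [p5] and [1 - p5]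
   modulo 17. *)
have c5 : p5 = 0 \/ p5 = 1 \/ p5 = 17 \/ p5 = -17 \/ p5 = -16 by clear -b5 l3 l4 e3 e4; lia.
split=> //; clear -c5 b; case: c5 b => [->|[->|[->|[->|->]]]]; lia.
Qed.

Lemma arith_order9 : p0 = 0 -> p6 = 0 -> p5 = 0 -> p8 = 0 -> y1 = 0 -> y3 = 0 ->
  let t1 := p1 * 0%:Z + p3 * 8%:Z + p7 * 14%:Z + p4 * 15%:Z in
  let t2 := p1 * 0%:Z + p3 * 14%:Z + p7 * 15%:Z + p4 * 8%:Z in
  let t4 := p1 * 0%:Z + p3 * 15%:Z + p7 * 8%:Z + p4 * 14%:Z in
  let tz := [:: 3%:Z; t1; t2; 0%:Z; t4; t4; 0%:Z; t2; t1] in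
  multiplicity_cond 3 9 (zs [:: 2; 2; 2; 2; 2; 2; 2; 2; 2]%N) tz ->
  multiplicity_cond 3 9 (zs [:: 2; 16; 16; 2; 16; 16; 2; 16; 16]%N) tz ->
  multiplicity_cond 3 9 (zs [:: 2; 7; 13; 16; 14; 14; 16; 13; 7]%N) tz ->
  multiplicity_cond 3 9 (zs [:: 2; 13; 14; 16; 7; 7; 16; 14; 13]%N) tz ->
  multiplicity_cond 3 9 (zs [:: 2; 14; 7; 16; 13; 13; 16; 7; 14]%N) tz ->
  p1 = 0 /\ [\/ [/\ p3 = 1, p7 = 0 & p4 = 0], [/\ p3 = 0, p7 = 1 & p4 = 0] | [/\ p3 = 0, p7 = 0 &
    p4 = 1]].
Proof.
have [_ [b1 b3 b7 b4]] := small_paugs.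
move=> h0 h6 h5 h8 h9 h10 /=.
case=> m1 [q1 []] /= l1 e1 [m2 [q2 []]] /= l2 e2 [m3 [q3 []]] /= l3 e3 [m4 [q4 []]] /= l4 e4.
case=> m5 [q5 []] /= l5 e5.
move: total bound; rewrite h0 h6 h5 h8 h9 h10 => t' b.
have t : p4 = 1 - p1 - p3 - p7 by clear -t'; lia.
move: b b4 e1 e2 e3 e4 e5; rewrite t => b b4 e1 e2 e3 e4 e5.
(* Modulo 17 the eigenvalue 1 has multiplicity [1 + 5 * p1] and a primitive cube root of unity
   [6 * p1]. Both residues lie between 0 and 3 only if 17 divides [p1]. *)
have c1 : p1 = 0 by clear -b1 l1 l2 e1 e2; lia.
move: b b4 e3 e4 e5; rewrite c1 => b b4 e3 e4 e5.
(* The three pairs of eigenvalues of order 9 have multiplicities [p3], [p7] and [p4] modulo 17.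
   Three residues between 0 and 3 with sum 1 modulo 17 are 1, 0, 0 in some order; size and total
   exclude other lifts. *)
have : p3 = 1 /\ p7 = 0 \/ p3 = 0 /\ p7 = 1 \/ p3 = 0 /\ p7 = 0.
  by clear -b3 b7 b4 l3 l4 l5 e3 e4 e5; lia.
by case=> [[-> ->]|[[-> ->]|[-> ->]]]; split=> //; [constructor 1|constructor 2|constructor 3].
Qed.

Lemma arith_order6 : p6 = 0 -> p5 = 0 -> p8 = 0 -> p3 = 0 -> p7 = 0 -> p4 = 0 -> y1 = 0 -> y3 = 0 ->
  let X := p0 * 16%:Z + p1 * 0%:Z in let Y := p0 * 1%:Z + p1 * 16%:Z in
  let tz2 := [:: 3%:Z; X; 0%:Z; 16%:Z; 0%:Z; X] in
  let tz4 := [:: 5%:Z; Y; 16%:Z; 1%:Z; 16%:Z; Y] in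
  multiplicity_cond 3 6 (zs [:: 2; 2; 2; 2; 2; 2]%N) tz2 ->
  multiplicity_cond 3 6 (zs [:: 2; 16; 16; 2; 16; 16]%N) tz2 ->
  multiplicity_cond 5 6 (zs [:: 2; 2; 2; 2; 2; 2]%N) tz4 -> False.
Proof.
move=> h6 h5 h8 h3 h7 h4 h9 h10 /=.
case=> m1 [q1 []] /= l1 e1 [m2 [q2 []]] /= l2 e2 [m3 [q3 []]] /= l3 e3.
move: total; rewrite h6 h5 h8 h3 h7 h4 h9 h10 => t'.
have t : p1 = 1 - p0 by clear -t'; lia.
(* Modulo 17 the conditions read [3 * m1 = 1 - p0], [6 * m2 = 2 + p0] and [3 * m3 = 1 + 2 * p0].
   With [m1] and [m2] at most 3, the first two leave only [p0 = -2]; then [m3] is -1 modulo 17,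
   impossible up to 5. Dimension 3 alone would not suffice. *)
move: e1 e2 e3; rewrite t => e1 e2 e3; clear -l1 l2 l3 e1 e2 e3; lia.
Qed.

(** All classes that can occur have order dividing 8, so the congruence makes their total, which is
    1, even. *)
Lemma arith_order16 : p1 = 0 -> p3 = 0 -> p7 = 0 -> p4 = 0 -> y1 = 0 -> y3 = 0 -> coef1_cond 2 3
  -> False.
Proof.
move=> h1 h3 h7 h4 h9 h10 [q]; move: total; rewrite /= h1 h3 h7 h4 h9 h10 => t e.
by clear -t e; lia.
Qed.

Lemma arith_order34 : p6 = 0 -> p5 = 0 -> p8 = 0 -> p1 = 0 -> p3 = 0 -> p7 = 0 -> p4 = 0 ->
  coef1_cond 2 1 -> coef1_cond 17 1 -> False.
Proof.
move=> h6 h5 h8 h1 h3 h7 h4 [q e] [q' e']; have [[b0 _ _ _] _] := small_paugs.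
move: total bound e e'; rewrite /= h6 h5 h8 h1 h3 h7 h4 => t b e e'.
have t3 : y3 = 1 - p0 - y1 by clear -t; lia.
move: b e'; rewrite t3 => b e'.
(* [p0] is even, and it is 1 modulo 17 because 17 divides [y1 + y3]. The value -16 makes [y1 + y3]
   equal to 17, against the bound. *)
have c : p0 = -16 by clear -b0 e e'; lia.
by move: b; rewrite c; clear; nia.
Qed.

(** The congruences make [p1] divisible by 3 and equal to 1 modulo 17; in the allowed range the only
    candidates are 1 and -16. *)
Lemma arith_order51 : p0 = 0 -> p6 = 0 -> p5 = 0 -> p8 = 0 -> p3 = 0 -> p7 = 0 -> p4 = 0 ->
  coef1_cond 3 1 -> coef1_cond 17 1 -> False.
Proof.
move=> h0 h6 h5 h8 h3 h7 h4 [q e] [q' e']; have [_ [b1 _ _ _]] := small_paugs.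
move: total e e'; rewrite /= h0 h6 h5 h8 h3 h7 h4 => t e e'.
clear -t b1 e e'; lia.
Qed.

End Arithmetic.

Lemma neq_self (T : eqType) (x : T) (P : Prop) : x != x -> P. Proof. by rewrite eqxx. Qed.

Lemma seq8_ind (T : eqType) (P : T -> Prop) a0 a1 a2 a3 a4 a5 a6 a7 :
  P a0 -> P a1 -> P a2 -> P a3 -> P a4 -> P a5 -> P a6 -> P a7 ->
  forall t, t \in [:: a0; a1; a2; a3; a4; a5; a6; a7] -> P t.
Proof.
move=> ? ? ? ? ? ? ? ? t; rewrite !in_cons in_nil orbF.
by do 7![case/orP=> [/eqP -> //|]] => /eqP ->.
Qed.

Lemma sym2_coefs :
  [/\ char_coefs sym2_char 1 = map Posz [:: 16; 1; 7; 12; 0; 8; 14; 15]%N,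
      char_coefs sym2_char 3 = map Posz [:: 16; 1; 12; 7; 3; 0; 0; 0]%N,
      char_coefs sym2_char 5 = map Posz [:: 16; 1; 12; 7; 0; 15; 8; 14]%N &
      char_coefs sym2_char 7 = map Posz [:: 16; 1; 7; 12; 0; 14; 15; 8]%N] /\
  [/\ char_coefs sym2_char 2 = map Posz [:: 3; 16; 1; 1; 0; 14; 15; 8]%N,
      char_coefs sym2_char 4 = map Posz [:: 3; 3; 16; 16; 0; 15; 8; 14]%N &
      char_coefs sym2_char 8 = map Posz [:: 3; 3; 3; 3; 0; 8; 14; 15]%N].
Proof. by split; split; vm_compute. Qed.

Lemma sym4_coefs :
  [/\ char_coefs sym4_char 1 = map Posz [:: 1; 16; 7; 12; 16; 4; 11; 5]%N,
      char_coefs sym4_char 3 = map Posz [:: 1; 16; 12; 7; 5; 16; 16; 16]%N,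
      char_coefs sym4_char 5 = map Posz [:: 1; 16; 12; 7; 16; 5; 4; 11]%N &
      char_coefs sym4_char 7 = map Posz [:: 1; 16; 7; 12; 16; 11; 5; 4]%N].
Proof. by split; vm_compute. Qed.

Lemma nth_forall (T : Type) (x0 : T) (s : seq T) (P : nat -> T -> Prop) n : size s = n ->
  (fix all k s := if s is x :: s' then P k x /\ all k.+1 s' else True) 0%N s ->
  forall k, (k < n)%N -> P k (nth x0 s k).
Proof.
move=> <- {n} h k; rewrite -[k in P k]add0n; elim: s 0%N k h => // x s IHs j [|k] [Px h] /=;
  first by rewrite addn0.
by rewrite ltnS => ks; rewrite -addSnnS; apply: IHs.
Qed.
(** * A kernel of degree 9 *)

(* The Legendre symbol modulo 17, by Euler's criterion. *)
Definition sg (x : F) : int := if x == 0 then 0 else if x ^+ 8 == 1 then 1 else -1.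

Lemma sgM x y : sg (x * y) = sg x * sg y.
Proof.
pose s := [seq (inZp i : F) | i <- iota 0 17].
have h : all (fun x => all (fun y => sg (x * y) == sg x * sg y) s) s by vm_compute.
exact: (eqP (F17_forall (F17_forall h x) y)).
Qed.

Lemma sgN x : sg (- x) = sg x.
Proof. by apply/eqP; move: x; apply: F17_forall; vm_compute. Qed.

Lemma sg_sqr x : sg x * sg x = (x != 0)%:R.
Proof. by apply/eqP; move: x; apply: F17_forall; vm_compute. Qed.

Lemma sg0 : sg 0 = 0. Proof. by rewrite /sg eqxx. Qed.

Lemma sg1 : sg 1 = 1. Proof. by vm_compute. Qed.
Lemma sg3 : sg 3 = -1. Proof. by vm_compute. Qed.

Lemma sum_sg : \sum_x sg x = 0.
Proof.
have : \sum_x sg x = - \sum_x sg x.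
  rewrite {1}(reindex_inj (mulfI (isT : (3 : F) != 0))) /= -sumrN.
  by apply: eq_bigr => x _; rewrite sgM sg3 mulN1r.
by move: (\sum_x _) => z; lia.
Qed.

Lemma sum_sg_sqr : \sum_(x : F) sg x * sg x = 16.
Proof.
under eq_bigr do rewrite sg_sqr; rewrite -natr_sum.
by rewrite -(big_mkcond (fun x : F => x != 0) (fun=> 1%N)) /= sum1_card cardC1 card_Fp.
Qed.

Definition sdet (v w : F * F) := v.1 * w.2 - v.2 * w.1.
Definition sact (v : F * F) (A : 'M[F]_2) : F * F := (v.1 * A 0 0 + v.2 * A 1 0, v.1 * A 0 1 + v.2
  * A 1 1).
Definition sscale (c : F) (v : F * F) : F * F := (c * v.1, c * v.2).

Lemma sactM v A B : sact v (A *m B) = sact (sact v A) B.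
Proof.
rewrite (mx2_eta A) (mx2_eta B) mul_mx2 /sact !mxE /=; congr pair; ring.
Qed.

Lemma sact1 v : sact v 1%:M = v.
Proof.
case: v => x y; rewrite (_ : 1%:M = mx2 1 0 0 1); last exact: mx2_1.
by rewrite /sact !mxE /= !mulr0 !mulr1 addr0 add0r.
Qed.

Lemma sactN v A : sact v (- A) = sscale (-1) (sact v A).
Proof. rewrite /sact /sscale !mxE /=; congr pair; ring. Qed.

Lemma sdet_act v w A : sdet (sact v A) (sact w A) = \det A * sdet v w.
Proof. rewrite /sdet /sact (mx2_eta A) det_mx2 !mxE /=; ring. Qed.

Lemma sact_scale c v A : sact (sscale c v) A = sscale c (sact v A).
Proof. rewrite /sact /sscale /=; congr pair; ring. Qed.

Lemma sact_inj A : \det A = 1 -> injective (sact^~ A).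
Proof.
move=> dA v w e; have dU : A \in unitmx by rewrite unitmxE dA unitr1.
by rewrite -[v]sact1 -[w]sact1 -(mulmxV dU) !sactM e.
Qed.

Section GaussSum.
Variables (K : fieldType) (z : K).
Hypothesis prz : 17.-primitive_root z.
Hypothesis K0 : 17%:R != 0 :> K.

Definition zchar (x : F) : K := z ^+ x.

Lemma zcharD x y : zchar (x + y) = zchar x * zchar y.
Proof. by rewrite /zchar -exprD /= -(prim_expr_mod prz (x + y)). Qed.

Lemma zchar0 : zchar 0 = 1. Proof. by []. Qed.

Lemma zchar_mod k : z ^+ k = zchar k%:R.
Proof. by rewrite /zchar (val_Fp_nat (isT : prime 17)) prim_expr_mod. Qed.

Lemma sum_zchar a : \sum_x zchar (a * x) = if a == 0 then 17 else 0.
Proof.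
have [-> |a0] := eqVneq a 0.
  under eq_bigr do rewrite mul0r zchar0.
  by rewrite sumr_const card_Fp.
have -> : \sum_x zchar (a * x) = \sum_x zchar x by rewrite [RHS](reindex_inj (mulfI a0)).
have z1 : z - 1 != 0.
  by rewrite subr_eq0 -[z]expr1 -(prim_order_dvd prz).
apply: (mulfI z1); rewrite mulr0.
have -> : \sum_x zchar x = \sum_(i < 17) z ^+ i by [].
by rewrite -subrX1 (prim_expr_order prz) subrr.
Qed.

Definition gauss_sum : K := \sum_x (sg x)%:~R * zchar x.

Lemma gauss_sum_twist a : a != 0 -> \sum_x (sg x)%:~R * zchar (a * x) = (sg a)%:~R * gauss_sum.
Proof.
move=> a0; rewrite /gauss_sum [in RHS](reindex_inj (mulfI a0)) mulr_sumr; apply: eq_bigr => x _.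
by rewrite mulrA -rmorphM sgM mulrA sg_sqr a0 mul1r.
Qed.

(** Only the term [y = -1] survives. Its sign is [sg (-1)], which is 1 since 17 is 1 modulo 4: the
    square is 17 and not -17. *)
Lemma gauss_sum_sqr : gauss_sum ^+ 2 = 17.
Proof.
rewrite expr2 {2}/gauss_sum mulr_sumr.
transitivity (\sum_x \sum_y (sg y)%:~R * zchar ((1 + y) * x)).
  apply: eq_bigr => x _; have [-> |x0] := eqVneq x 0.
    rewrite sg0 mul0r mulr0; under eq_bigr do rewrite mulr0 zchar0 mulr1.
    by rewrite -rmorph_sum sum_sg.
  rewrite mulrCA mulrA -(gauss_sum_twist x0) mulr_suml; apply: eq_bigr => y _.
  by rewrite mulrDl mul1r zcharD [y * x]mulrC; ring.
rewrite exchange_big /= (bigD1 (-1)) //= -mulr_sumr sum_zchar subrr eqxx sgN sg1 mul1r big1 ?addr0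
  // => y y1.
by rewrite -mulr_sumr sum_zchar addrC addr_eq0 (negPf y1) mulr0.
Qed.
End GaussSum.

Section Kernel.
Variable K : numFieldType.
Variable gam : K.
Hypothesis gam2 : gam ^+ 2 = 17.
Implicit Types v w x : F * F.

(* [del / 16] projects the functions on the plane onto those satisfying
   [f (c v) = sg c * f v]; this space has dimension 18, and [kap] acts on it with
   the eigenvalues [16 * gam] and [- 16 * gam].  [ker17] is the projector onto
   the first eigenspace, of dimension 9. *)
Definition kap v w : K := (sg (sdet v w))%:~R.
Definition del v w : K := \sum_c (sg c)%:~R * (w == sscale c v)%:R.
Definition ker17 v w : K := (del v w / 16 + kap v w / (16 * gam)) / 2.

Lemma gam_neq0 : gam != 0.
Proof. by apply: contra_eq_neq gam2 => ->; rewrite expr0n /= eq_sym pnatr_eq0. Qed.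

Lemma del_sum v (f : F * F -> K) : \sum_w del v w * f w = \sum_c (sg c)%:~R * f (sscale c v).
Proof.
rewrite /del; under eq_bigr do rewrite mulr_suml.
rewrite exchange_big; apply: eq_bigr => c _.
rewrite (bigD1 (sscale c v)) //= eqxx mulr1 big1 ?addr0 // => w /negPf ->.
by rewrite mulr0 mul0r.
Qed.

Lemma kap_sym v w : kap v w = kap w v.
Proof. by rewrite /kap -sgN; congr (sg _)%:~R; rewrite /sdet; ring. Qed.

Lemma kap_scale c v w : kap (sscale c v) w = (sg c)%:~R * kap v w.
Proof. by rewrite /kap -rmorphM -sgM; congr (sg _)%:~R; rewrite /sdet /sscale /=; ring. Qed.

Lemma sscaleM c d v : sscale c (sscale d v) = sscale (c * d) v.
Proof. by rewrite /sscale /= !mulrA. Qed.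

Lemma sscale1 v : sscale 1 v = v.
Proof. by case: v => x y; rewrite /sscale !mul1r. Qed.

Lemma sgV c : sg c^-1 = sg c.
Proof.
have [-> |c0] := eqVneq c 0; first by rewrite invr0.
have : sg c * sg c * sg c^-1 = sg c by rewrite -mulrA -sgM divff // sg1 mulr1.
by rewrite sg_sqr c0 mul1r.
Qed.

Lemma del_sym v w : del v w = del w v.
Proof.
rewrite /del (reindex_inj invr_inj) /=; apply: eq_bigr => c _; rewrite sgV.
have [-> |c0] := eqVneq c 0; first by rewrite sg0 !mul0r.
congr (_ * (_ : bool)%:R); apply/eqP/eqP => ->; rewrite sscaleM ?divff ?mulVf ?sscale1 //.
Qed.

Lemma del_scale c v w : c != 0 -> del (sscale c v) w = (sg c)%:~R * del v w.
Proof.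
move=> c0; rewrite /del [in RHS](reindex_inj (mulIf c0)) mulr_sumr /=; apply: eq_bigr => d _.
by rewrite sscaleM mulrA -rmorphM sgM [sg d * _]mulrC mulrA sg_sqr c0 mul1r.
Qed.

Lemma sum_sg_sqrK (t : K) : \sum_c (sg c)%:~R * ((sg c)%:~R * t) = 16 * t.
Proof.
under eq_bigr do rewrite mulrA -rmorphM.
by rewrite -mulr_suml -rmorph_sum sum_sg_sqr.
Qed.

Lemma del_kap v x : \sum_w del v w * kap w x = 16 * kap v x.
Proof. by rewrite del_sum -sum_sg_sqrK; apply: eq_bigr => c _; rewrite kap_scale. Qed.

Lemma kap_del v x : \sum_w kap v w * del w x = 16 * kap v x.
Proof. by rewrite kap_sym -del_kap; apply: eq_bigr => w _; rewrite mulrC kap_sym del_sym. Qed.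

Lemma del_del v x : \sum_w del v w * del w x = 16 * del v x.
Proof.
rewrite del_sum -sum_sg_sqrK; apply: eq_bigr => c _.
by have [-> |c0] := eqVneq c 0; [rewrite sg0 !mul0r | rewrite del_scale].
Qed.

Lemma sum_pairs (f : F -> F -> K) : \sum_(w : F * F) f w.1 w.2 = \sum_x \sum_y f x y.
Proof. by rewrite pair_big. Qed.

Lemma sum_sdet v x (f : F -> F -> K) : sdet v x != 0 ->
  \sum_w f (sdet v w) (sdet w x) = \sum_a \sum_b f a b.
Proof.
move=> d0; rewrite -sum_pairs [RHS](reindex (fun w : F * F => (sdet v w, sdet w x))) //=.
exists (fun p : F * F => ((p.1 * x.1 + p.2 * v.1) / sdet v x, (p.1 * x.2 + p.2 * v.2) / sdet v x)).
  case=> w1 w2 _; case: v x d0 => v1 v2 [x1 x2]; rewrite /sdet /= => d0; congr pair; field => //.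
case=> a b _; case: v x d0 => v1 v2 [x1 x2]; rewrite /sdet /= => d0; congr pair; field => //.
Qed.

Lemma sdet0_scale v x : v != 0 -> sdet v x = 0 -> exists c, x = sscale c v.
Proof.
case: v x => v1 v2 [x1 x2] v0 /eqP; rewrite /sdet subr_eq0 /= => /eqP e.
have [v10|v10] := eqVneq v1 0.
  have v20 : v2 != 0 by apply: contraNneq v0 => ->; rewrite v10.
  exists (x2 / v2); rewrite /sscale /= divfK //; congr pair.
  by move: e; rewrite v10 mul0r mulr0 => /esym/eqP; rewrite mulf_eq0 (negPf v20) => /eqP.
by exists (x1 / v1); rewrite /sscale /= divfK // mulrAC -[x1 * v2]mulrC -e mulrC mulKf.
Qed.

Lemma sscale_inj v : v != 0 -> injective (sscale^~ v).
Proof.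
case: v => v1 v2 v0 c d e; have e1 : c * v1 = d * v1 := congr1 fst e.
have e2 : c * v2 = d * v2 := congr1 snd e; have [v10|v10] := eqVneq v1 0;
  last exact: (mulIf v10 e1).
by apply: (mulIf (_ : v2 != 0)) e2; apply: contraNneq v0 => ->; rewrite v10.
Qed.

Lemma del_scaler v c : v != 0 -> del v (sscale c v) = (sg c)%:~R.
Proof.
move=> v0; rewrite /del (bigD1 c) //= eqxx mulr1 big1 ?addr0 // => d dc.
by rewrite (inj_eq (sscale_inj v0)) eq_sym (negPf dc) mulr0.
Qed.

Lemma sum_kap_sqr v : v != 0 -> \sum_w kap v w * kap v w = 272.
Proof.
move=> v0; have [x dx] : exists x, sdet v x != 0.
  case: v v0 => v1 v2 v0; have [v10|v10] := eqVneq v1 0.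
    exists (1, 0); rewrite /sdet /= mulr0 mulr1 sub0r oppr_eq0.
    by apply: contraNneq v0 => ->; rewrite v10.
  by exists (0, 1); rewrite /sdet /= mulr0 mulr1 subr0.
rewrite (sum_sdet (fun a _ => (sg a)%:~R * (sg a)%:~R) dx).
under eq_bigr do rewrite sumr_const card_Fp // -rmorphM.
by rewrite sumrMnl -rmorph_sum sum_sg_sqr -mulr_natl; ring.
Qed.

(** For independent [v] and [x], the pair ([sdet v w], [sdet w x]) runs over all of [F * F] and the
    sum factors into vanishing character sums. For [x] a multiple of [v] it reduces to
    [sum_kap_sqr], where 272 = 16 * 17. *)
Lemma kap_kap v x : \sum_w kap v w * kap w x = 272 * del v x.
Proof.
have [-> |v0] := eqVneq v 0.
  have -> : del 0 x = 0.
    rewrite /del (eq_bigr (fun c => (sg c)%:~R * (x == 0)%:R)) => [|c _];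
      last by rewrite /sscale !mulr0.
    by rewrite -mulr_suml -rmorph_sum sum_sg mul0r.
  rewrite mulr0 big1 // => w _; rewrite /kap (_ : sdet 0 w = 0) ?sg0 ?mul0r //.
  by rewrite /sdet !mul0r subrr.
have [d0|d0] := eqVneq (sdet v x) 0.
  have [c ->] := sdet0_scale v0 d0.
  rewrite del_scaler // -(sum_kap_sqr v0) mulr_suml; apply: eq_bigr => w _.
  by rewrite [kap w _]kap_sym kap_scale; ring.
rewrite (sum_sdet (fun a b => (sg a)%:~R * (sg b)%:~R) d0) big1 => [|a _].
  rewrite /del big1 ?mulr0 // => c _; case: eqP => [e|]; rewrite ?mulr0 //.
  by case/eqP: d0; rewrite e /sdet /sscale /=; ring.
by rewrite -mulr_sumr -rmorph_sum sum_sg mulr0.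
Qed.

Lemma ker17_idem v x : \sum_w ker17 v w * ker17 w x = ker17 v x.
Proof.
have g0 := gam_neq0.
rewrite (eq_bigr (fun w => (del v w * del w x) / 1024 + (del v w * kap w x) / (1024 * gam)
  + (kap v w * del w x) / (1024 * gam) + (kap v w * kap w x) / (1024 * gam ^+ 2))) => [|w _];
    last first.
  by rewrite /ker17; field.
rewrite !big_split /= -!mulr_suml del_del del_kap kap_del kap_kap gam2 /ker17.
by field.
Qed.

Lemma ker17_act v w A : \det A = 1 -> ker17 (sact v A) (sact w A) = ker17 v w.
Proof.
move=> dA; rewrite /ker17 /kap sdet_act dA mul1r; congr ((_ / _ + _) / _).
by apply: eq_bigr => c _; rewrite -sact_scale (inj_eq (sact_inj dA)).
Qed.

Lemma ker17N v w : ker17 (sscale (-1) v) w = ker17 v w.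
Proof. by rewrite /ker17 kap_scale del_scale ?oppr_eq0 // sgN sg1 !mul1r. Qed.

Lemma trace_ker17_1 : \sum_v ker17 v v = 9.
Proof.
rewrite (bigD1 (0 : F * F)) //= (eq_bigr (fun=> 32^-1)) => [|v v0].
  rewrite /ker17 /kap {1}/sdet subrr sg0 mul0r addr0.
  rewrite (_ : del 0 0 = 0) ?mul0r ?add0r; last first.
    rewrite /del (eq_bigr (fun c => (sg c)%:~R)) => [|c _];
      last by rewrite /sscale !mulr0 eqxx mulr1.
    by rewrite -rmorph_sum sum_sg.
  by rewrite sumr_const cardC1 card_prod card_Fp // -[(17 * 17).-1%N]/288%N -mulr_natl; field.
rewrite /ker17 /kap (_ : sdet v v = 0) ?sg0; last by rewrite /sdet; ring.
by rewrite -{2}[v]sscale1 del_scaler // sg1; field; apply: gam_neq0.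
Qed.

(** The 16 nonzero fixed vectors contribute 1/32 each through [del], hence 1/2. The 272 vectors that
    move contribute only through [kap], all equally, since the form there is [- b] times a square;
    they add up to half of [gam] with the sign of [b]. *)
Lemma trace_ker17_unip b : b != 0 -> \sum_v ker17 (sact v (mx2 1 b 0 1)) v = (1 + (sg b)%:~R *
  gam) / 2.
Proof.
move=> b0; have g0 := gam_neq0.
have E (x y : F) : ker17 (sact (x, y) (mx2 1 b 0 1)) (x, y) =
    (if x == 0 then (y != 0)%:R / 32 else 0) + (x != 0)%:R * (sg b)%:~R / (32 * gam).
  have -> : sact (x, y) (mx2 1 b 0 1) = (x, x * b + y).
    by rewrite /sact !mxE /= !mulr1 mulr0 addr0.
  rewrite /ker17 {1}/kap (_ : sdet _ _ = - (b * (x * x))); last by rewrite /sdet /=; ring.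
  rewrite sgN !sgM sg_sqr; have [-> |x0] := eqVneq x 0.
    rewrite mul0r add0r !mulr0 mul0r !addr0; have [-> |y0] := eqVneq y 0.
      rewrite mul0r /del (eq_bigr (fun c => (sg c)%:~R)) => [|c _];
        last by rewrite /sscale /= !mulr0 eqxx mulr1.
      by rewrite -rmorph_sum sum_sg /= !mul0r addr0.
    rewrite -{2}[(0, y)]sscale1 del_scaler ?sg1; last by rewrite xpair_eqE negb_and y0 orbT.
    by rewrite /= !mul0r; field.
  rewrite rmorphM add0r /del big1 => [|c _]; first by rewrite /= mul0r; field.
  case: eqP => [[e1 e2]|]; rewrite ?mulr0 //.
  have c1 : c = 1 by apply: (mulIf x0); rewrite mul1r.
  move: e2 => /eqP; rewrite c1 mul1r -subr_eq0 opprD addrCA subrr addr0 oppr_eq0 mulf_eq0.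
  by rewrite (negPf x0) (negPf b0).
pose f (s t : F) : K := (if s == 0 then (t != 0)%:R / 32 else 0) + (s != 0)%:R * (sg b)%:~R / (32
  * gam).
transitivity (\sum_s \sum_t f s t).
  by rewrite -sum_pairs; apply: eq_bigr => -[s t] _; apply: E.
rewrite /f.
under eq_bigr do rewrite big_split /= sumr_const card_Fp //.
rewrite big_split /= (bigD1 0) //= [X in _ + X + _]big1 ?addr0; last first.
  by move=> x /negPf ->; rewrite big1.
rewrite -mulr_suml -natr_sum -(big_mkcond (fun y : F => y != 0) (fun=> 1%N)) /= sum1_card cardC1
  card_Fp //.
rewrite (bigD1 0) //= !mul0r mul0rn add0r (eq_bigr (fun=> ((sg b)%:~R / (32 * gam)) *+ 17));
  last first.
  by move=> x ->; rewrite mul1r.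
rewrite sumr_const cardC1 card_Fp // -mulrnA -[(17 * 17.-1)%N]/272%N.
have -> : (sg b)%:~R / (32 * gam) *+ 272 = (sg b)%:~R * gam * (17 / (2 * gam ^+ 2)) :> K.
  by rewrite -mulr_natl; field.
by rewrite gam2; field.
Qed.

End Kernel.

(** * Torsion units for PSL(2, 17) *)

(* [gT] is PSL(2, 17), given by a lifting [l] of its elements to SL(2, 17) that
   is multiplicative up to sign. *)
Section PSL217.
Variables (gT : finGroupType) (l : gT -> 'M[F]_2).
Hypothesis l_det : forall g, \det (l g) = 1.
Hypothesis l_M : forall g h, l (g * h)%g = l g *m l h \/ l (g * h)%g = - (l g *m l h).
Hypothesis l_surj : forall A, \det A = 1 -> exists g, l g = A \/ l g = - A.
Hypothesis l_inj : forall g h, l g = l h \/ l g = - l h -> g = h.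

(* The trace of [l g *m l g]: unlike that of [l g], it does not depend on the
   sign of the lifting. *)
Definition tau g : F := \tr (l g) ^+ 2 - 2.

Lemma even_lM T (f : 'M[F]_2 -> T) : (forall A, f (- A) = f A) ->
  forall g h, f (l (g * h)%g) = f (l g *m l h).
Proof. by move=> fN g h; case: (l_M g h) => ->. Qed.

Lemma l_1 : l 1%g = 1 \/ l 1%g = - 1.
Proof.
have u1 : l 1%g \in unitmx by rewrite unitmxE l_det unitr1.
have := l_M 1 1; rewrite mulg1; case=> e; [left|right].
  by rewrite -[LHS](mulKmx u1) -e mulVmx.
by apply: oppr_inj; rewrite opprK -[LHS](mulKmx u1) mulmxN -e mulVmx.
Qed.

Lemma l_eq1 g : l g = 1 \/ l g = - 1 -> g = 1%g.
Proof. by move=> lg; apply: l_inj; case: lg => ->; case: l_1 => ->; rewrite ?opprK; auto. Qed.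

Lemma l_class g r P e : \det P = 1 -> P *m l g = e *m P -> l r = e \/ l r = - e ->
  g \in (r ^: [set: gT])%g.
Proof.
move=> dP PE lr; have [h lh] := l_surj dP.
suff /(canRL (mulKg _)) -> : (h * g)%g = (r * h)%g.
  by rewrite -conjgE memJ_class ?inE.
apply: l_inj; case: (l_M h g) => ->; case: (l_M r h) => ->; case: lh => ->; case: lr => ->;
  rewrite ?mulNmx ?mulmxN ?PE ?mulNmx ?mulmxN ?opprK; auto.
Qed.

Lemma l_J g h : exists2 P, P \in unitmx & P *m l (g ^ h)%g = l g *m P \/ P *m l (g ^ h)%g = - (l g
  *m P).
Proof.
exists (l h); first by rewrite unitmxE l_det unitr1.
have := l_M h (g ^ h); rewrite conjgE mulKVg.
case: (l_M g h) => -> [] e; [left|right|right|left] => //.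
  by rewrite e opprK.
exact: (esym (oppr_inj e)).
Qed.

Lemma tauJ g h : tau (g ^ h)%g = tau g.
Proof.
have [P uP] := l_J g h.
case=> E; rewrite /tau; have := congr1 (fun M => \tr (invmx P *m M)) E;
 rewrite mulKmx // ?mulmxN ?raddfN /= mxtrace_mulC -mulmxA mulmxV // mulmx1 => ->.
  by [].
by rewrite sqrrN.
Qed.

Lemma mx2_CH (A : 'M[F]_2) : \det A = 1 -> A *m A = \tr A *: A - 1%:M.
Proof.
rewrite (mx2_eta A); move: (A 0 0) (A 0 1) (A 1 0) (A 1 1) => a b c d; rewrite det_mx2 tr_mx2 => dA.
have E k a' b' c' d' x y : k *: mx2 a' b' c' d' + mx2 x 0 0 y = mx2 (k * a' + x) (k * b') (k * c')
  (k * d' + y).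
  by apply/matrixP => i j; rewrite !mxE; case: (i == 0); case: (j == 0); rewrite ?addr0.
rewrite mul_mx2 -[1%:M]/(1 : 'M[F]_2) mx2_1 opp_mx2 !oppr0 E; congr mx2; try ring.
  by transitivity ((a + d) * a - (a * d - b * c)); [ring | rewrite dA].
by transitivity ((a + d) * d - (a * d - b * c)); [ring | rewrite dA].
Qed.

Lemma tau_sqr g : tau (g ^+ 2)%g = tau g ^+ 2 - 2.
Proof.
rewrite /tau expgS expg1 (even_lM (f := fun A => \tr A ^+ 2 - 2)) => [|A];
  last by rewrite raddfN sqrrN.
by rewrite mx2_CH // raddfB /= mxtraceZ mxtrace1; ring.
Qed.

Lemma tau_cube g : tau (g ^+ 3)%g = tau g ^+ 3 - 3 * tau g.
Proof.
have trN (A : 'M[F]_2) : \tr (- A) ^+ 2 - 2 = \tr A ^+ 2 - 2 by rewrite raddfN sqrrN.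
rewrite /tau expgS (even_lM trN).
have -> : \tr (l g *m l (g ^+ 2)%g) ^+ 2 = \tr (l g *m (l g *m l g)) ^+ 2.
  by rewrite expgS expg1; case: (l_M g g) => ->; rewrite ?mulmxN ?raddfN /= ?sqrrN.
rewrite mx2_CH // mulmxBr mulmx1 -scalemxAr mx2_CH // scalerBr scalerA !raddfB /= !mxtraceZ
  mxtrace1.
ring.
Qed.

Lemma tau_1 : tau 1%g = 2.
Proof.
have tr1 : \tr (1 : 'M[F]_2) = 2 by exact: mxtrace1.
by rewrite /tau; case: l_1 => ->; rewrite ?raddfN /= ?sqrrN tr1; ring.
Qed.

Lemma tau_N2 g : tau g = -2 -> #[g]%g = 2%N.
Proof.
move=> tg; apply: nt_prime_order => //; last first.
  by apply: contra_eq_neq tg => ->; rewrite tau_1.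
apply: l_eq1; rewrite expgS expg1.
have t0 : \tr (l g) = 0.
  by move/eqP: tg; rewrite /tau -subr_eq0 opprK subrK sqrf_eq0 => /eqP.
by case: (l_M g g) => ->; rewrite mx2_CH // t0 scale0r add0r ?opprK; auto.
Qed.

Lemma tau_0 g : tau g = 0 -> #[g]%g = 4%N.
Proof.
move=> tg; have o2 : #[(g ^+ 2)%g]%g = 2%N by apply: tau_N2; rewrite tau_sqr tg expr0n add0r.
apply: (order_pfactor (p := 2) (k := 1)) => //.
  by rewrite -order_eq1 o2.
by rewrite -[(2 ^ 2)%N]/(2 * 2)%N expgM -[X in (_ ^+ X)%g]o2 expg_order.
Qed.

Lemma tau_8 g : tau g ^+ 2 = 2 -> #[g]%g = 8%N.
Proof.
move=> tg; have o2 : #[(g ^+ 2)%g]%g = 4%N by apply: tau_0; rewrite tau_sqr tg subrr.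
apply: (order_pfactor (p := 2) (k := 2)) => //.
  by rewrite -[(2 ^ 2)%N]/(2 * 2)%N expgM -order_dvdn o2.
by rewrite -[(2 ^ 3)%N]/(2 * 4)%N expgM -[X in (_ ^+ X)%g]o2 expg_order.
Qed.

Lemma tau_3 g : tau g = -1 -> #[g]%g = 3%N.
Proof.
move=> tg; apply: nt_prime_order => //; last first.
  by apply: contra_eq_neq tg => ->; rewrite tau_1.
have t1 : \tr (l g) ^+ 2 = 1.
  by move/eqP: tg; rewrite /tau subr_eq => /eqP ->; ring.
have gg : l g *m (l g *m l g) = - \tr (l g) *: 1.
  rewrite mx2_CH // mulmxBr mulmx1 -scalemxAr mx2_CH // scalerBr scalerA -expr2 t1 scale1r.
  by rewrite addrAC subrr add0r scaleNr.
apply: l_eq1; move/eqP: t1; rewrite sqrf_eq1 => tr1.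
have {gg} : l g *m (l g *m l g) = 1 \/ l g *m (l g *m l g) = -1.
  by rewrite gg; case/orP: tr1 => /eqP ->; rewrite ?opprK ?scaleN1r ?scale1r; auto.
rewrite !expgS expg0 mulg1.
have ggg : l (g * (g * g))%g = l g *m (l g *m l g) \/ l (g * (g * g))%g = - (l g *m (l g *m l g)).
  by case: (l_M g (g * g)) => ->; case: (l_M g g) => ->; rewrite ?mulmxN ?opprK;
    [left|right|right|left].
by case: ggg => -> [] ->; rewrite ?opprK; [left|right|right|left].
Qed.

Lemma tau_9 g : tau g ^+ 3 - 3 * tau g = -1 -> #[g]%g = 9%N.
Proof.
move=> tg; have o3 : #[(g ^+ 3)%g]%g = 3%N by apply: tau_3; rewrite tau_cube tg.
apply: (order_pfactor (p := 3) (k := 1)) => //.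
  by rewrite -order_eq1 o3.
by rewrite -[(3 ^ 2)%N]/(3 * 3)%N expgM -[X in (_ ^+ X)%g]o3 expg_order.
Qed.

(** * Representatives of the conjugacy classes *)

Definition el (A : 'M[F]_2) : gT := odflt 1%g [pick g | (l g == A) || (l g == - A)].

Lemma elP A : \det A = 1 -> l (el A) = A \/ l (el A) = - A.
Proof.
case/l_surj => g gA; rewrite /el; case: pickP => [h /orP[]/eqP|/(_ g)]; [by left|by right|].
by case: gA => ->; rewrite eqxx ?orbT.
Qed.

Definition comp_el t := el (mx2 0 1 (-1) t).
Definition unip_el b := el (mx2 1 b 0 1).
(* 3 is not a square modulo 17, so these two elements are not conjugate. *)
Definition unip1 := unip_el 1.
Definition unip3 := unip_el 3.

Lemma comp_elP t : l (comp_el t) = mx2 0 1 (-1) t \/ l (comp_el t) = - mx2 0 1 (-1) t.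
Proof. by apply: elP; rewrite det_mx2; ring. Qed.

Lemma unip_elP b : l (unip_el b) = mx2 1 b 0 1 \/ l (unip_el b) = - mx2 1 b 0 1.
Proof. by apply: elP; rewrite det_mx2; ring. Qed.

Lemma tau_comp t : tau (comp_el t) = t ^+ 2 - 2.
Proof. by rewrite /tau; case: (comp_elP t) => ->; rewrite ?raddfN /= ?sqrrN tr_mx2 add0r. Qed.

Lemma tau_unip b : tau (unip_el b) = 2.
Proof. by rewrite /tau; case: (unip_elP b) => ->; rewrite ?raddfN /= ?sqrrN tr_mx2; ring. Qed.

Lemma class_comp g t : tau g = t ^+ 2 - 2 -> tau g != 2 -> g \in (comp_el t ^: [set: gT])%g.
Proof.
move=> /(addIr _) /eqP; rewrite eqf_sqr => tt g2.
have [A AP tA] : exists2 A, l g = A \/ l g = - A & \tr A = t.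
  case/orP: tt => /eqP tt; first by exists (l g); auto.
  by exists (- l g); rewrite ?raddfN /= ?tt ?opprK; auto.
have dA : \det A = 1.
  by rewrite -(l_det g); case: AP => ->; rewrite // -scaleN1r detZ sqrrN expr1n mul1r.
have tA4 : \tr A ^+ 2 != 4.
  apply: contraNneq g2 => e; rewrite /tau (_ : \tr (l g) ^+ 2 = \tr A ^+ 2) ?e;
    first by apply/eqP; ring.
  by case: AP => ->; rewrite ?raddfN /= ?sqrrN.
have [P dP PE] := mx2_companion dA tA4.
rewrite tA in PE; have := comp_elP t.
case: AP => lg lc.
  by apply: (l_class (P := P) dP _ lc); rewrite lg.
apply: (@l_class _ _ P (- mx2 0 1 (-1) t) dP); rewrite ?lg ?mulmxN ?PE ?mulNmx // opprK.
by case: lc; auto.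
Qed.

Lemma class_unip g : tau g = 2 -> g != 1%g ->
  g \in (unip1 ^: [set: gT])%g \/ g \in (unip3 ^: [set: gT])%g.
Proof.
move=> /eqP; rewrite /tau subr_eq => /eqP tg g1.
have /eqP : \tr (l g) ^+ 2 = 2 ^+ 2 by rewrite tg; ring.
rewrite eqf_sqr => tt.
have [A AP tA] : exists2 A, l g = A \/ l g = - A & \tr A = 2.
  case/orP: tt => /eqP tt; first by exists (l g); auto.
  by exists (- l g); rewrite ?raddfN /= ?tt ?opprK; auto.
have dA : \det A = 1.
  by rewrite -(l_det g); case: AP => ->; rewrite // -scaleN1r detZ sqrrN expr1n mul1r.
have A1 : A != 1.
  by apply: contraNneq g1 => A1; apply/eqP/l_eq1; case: AP => ->; rewrite A1; auto.
have [P [be [dP beP PE]]] := mx2_unipotent dA tA A1.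
have cl : g \in (unip_el be ^: [set: gT])%g.
  have := unip_elP be; case: AP => lg lc.
    by apply: (l_class (P := P) dP _ lc); rewrite lg.
  apply: (@l_class _ _ P (- mx2 1 be 0 1) dP); rewrite ?lg ?mulmxN ?PE ?mulNmx // opprK.
  by case: lc; auto.
by case: beP => e; rewrite e in cl; [left|right].
Qed.

Lemma unip_el_neq1 b : b != 0 -> unip_el b != 1%g.
Proof.
move=> b0; apply: contraNneq b0 => u1; have := unip_elP b; rewrite u1.
case: l_1 => -> [] /eqP; rewrite mx2_1 ?opp_mx2 => /eqP/mx2_inj[_ /eqP + _ _];
by rewrite ?oppr0 eq_sym ?oppr_eq0 => /eqP ->.
Qed.

Lemma l_unipX b k : l (unip_el b ^+ k)%g = mx2 1 (k%:R * b) 0 1 \/ l (unip_el b ^+ k)%g = - mx2 1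
  (k%:R * b) 0 1.
Proof.
elim: k => [|k IHk]; first by rewrite mul0r -mx2_1; exact: l_1.
have E : mx2 1 b 0 1 *m mx2 1 (k%:R * b) 0 1 = mx2 1 (k.+1%:R * b) 0 1.
  by rewrite mul_mx2; congr mx2; rewrite ?natr1E -?nat1r; ring.
rewrite expgS; case: (l_M (unip_el b) (unip_el b ^+ k)) => ->;
 case: (unip_elP b) => ->; case: IHk => ->; rewrite ?mulNmx ?mulmxN E ?opprK; auto.
Qed.

Lemma order_unip b : b != 0 -> #[unip_el b]%g = 17%N.
Proof.
move=> b0; apply: nt_prime_order => //; last exact: unip_el_neq1.
apply: l_eq1; have := l_unipX b 17.
have -> : 17%:R = 0 :> F by apply/val_inj.
by rewrite mul0r -mx2_1.
Qed.

Lemma unip13_nconj : unip3 \notin (unip1 ^: [set: gT])%g.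
Proof.
apply/negP => /imsetP[h _ e].
have : (h * unip3)%g = (unip1 * h)%g by rewrite e conjgE mulKVg.
move/(congr1 l) => lE.
have {lE} : l h *m mx2 1 3 0 1 = mx2 1 1 0 1 *m l h \/ l h *m mx2 1 3 0 1 = - (mx2 1 1 0 1 *m l h).
  have e1 := l_M h unip3; have e2 := l_M unip1 h; rewrite {}lE in e1.
  have {}e1 : l (unip1 * h)%g = l h *m mx2 1 3 0 1 \/ l (unip1 * h)%g = - (l h *m mx2 1 3 0 1).
    by case: e1 => ->; case: (unip_elP 3) => ->; rewrite ?mulmxN ?opprK; [left|right|right|left].
  have {}e2 : l (unip1 * h)%g = mx2 1 1 0 1 *m l h \/ l (unip1 * h)%g = - (mx2 1 1 0 1 *m l h).
    by case: e2 => ->; case: (unip_elP 1) => ->; rewrite ?mulNmx ?opprK; [left|right|right|left].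
  case: e1 e2 => -> [] f; [left|right|right|left] => //; first by rewrite -f opprK.
  exact: oppr_inj.
have := l_det h; rewrite (mx2_eta (l h)).
move: (l h 0 0) (l h 0 1) (l h 1 0) (l h 1 1) => a b c d; rewrite det_mx2 !mul_mx2 opp_mx2 => dE.
have two0 (x : F) : x = - x -> x = 0.
  move/eqP; rewrite -subr_eq0 opprK -mulr2n -mulr_natl mulf_eq0 => /orP[|/eqP //].
  by move/eqP/(congr1 val).
(* With the plus sign [l h] is upper triangular with [3 * a ^+ 2 = 1], which is impossible; with the
   minus sign its first column vanishes. *)
case=> /mx2_inj[]; rewrite !mulr1 !mulr0 !mul1r mul0r !addr0 add0r.
  move=> /eqP; rewrite -{1}[a]addr0 (inj_eq (addrI a)) eq_sym => /eqP c0.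
  rewrite addrC => /addrI e1 _ _.
  have := three_nonsquare a; rewrite (_ : 3 * a ^+ 2 = 1) ?eqxx // -[RHS]dE c0 -e1; ring.
move=> e1 _ /two0 c0 _; move: e1 dE; rewrite c0 addr0 => /two0 ->.
by rewrite mul0r mulr0 subr0 => /eqP; rewrite eq_sym oner_eq0.
Qed.

(** [tau g] is the trace of the square of the lift, and by Cayley-Hamilton the traces of the powers
    of this square obey the recursion of [cheb]. *)
Lemma tauX g k : tau (g ^+ k)%g = cheb (tau g) k.
Proof.
have lX j : l (g ^+ j)%g = l g ^+ j \/ l (g ^+ j)%g = - l g ^+ j.
  elim: j => [|j IHj]; first by rewrite expr0; apply: l_1.
  rewrite expgS exprS; case: (l_M g (g ^+ j)%g) => ->; case: IHj => ->;
    rewrite ?mulmxN ?opprK; [left|right|right|left] => //.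
pose S := l g ^+ 2.
have trS j : tau (g ^+ j)%g = \tr (S ^+ j).
  have -> : tau (g ^+ j)%g = \tr (l g ^+ j) ^+ 2 - 2.
    by rewrite /tau; case: (lX j) => ->; rewrite ?raddfN /= ?sqrrN.
  have dj : \det (l g ^+ j) = 1.
    by elim: j => [|j IHj]; rewrite ?expr0 ?det1 // exprS det_mulmx IHj l_det mulr1.
  have E : (l g ^+ j) ^+ 2 = \tr (l g ^+ j) *: l g ^+ j - 1%:M by rewrite expr2; apply: mx2_CH.
  by rewrite /S -exprM mulnC exprM E raddfB /= mxtraceZ mxtrace1.
have dS : \det S = 1 by rewrite /S expr2 det_mulmx l_det mulr1.
rewrite trS; have -> : tau g = \tr S by rewrite -[g]expg1 trS expr1.
suff [] : \tr (S ^+ k) = cheb (\tr S) k /\ \tr (S ^+ k.+1) = cheb (\tr S) k.+1 by [].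
elim: k => [|k [IH1 IH2]]; first by rewrite expr0 expr1 mxtrace1.
split=> //; rewrite -[RHS]/(\tr S * cheb (\tr S) k.+1 - cheb (\tr S) k) -IH1 -IH2.
have E : S * S = \tr S *: S - 1%:M by apply: mx2_CH.
by rewrite !exprS mulrA E mulrBl -scalerAl mul1r raddfB /= mxtraceZ.
Qed.

Section Reps.

Definition reps : seq gT := 1%g :: map comp_el traces ++ [:: unip1; unip3].

(** A class invariant with distinct values on [reps], which proves by computation that no class is
    represented twice. The last component separates the two classes of order 17. *)
Let key g := (tau g, g == 1%g, g \in (unip1 ^: [set: gT])%g).

Let keyJ g h : key (g ^ h)%g = key g.
Proof.
rewrite /key (tauJ) conjg_eq1 memJ_norm //.
by rewrite (subsetP (class_norm _ [set: gT])) ?inE.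
Qed.

Let traces_neq : all (fun t => t ^+ 2 - 2 != 2) traces.
Proof. by vm_compute. Qed.

Let map_key : map key reps = (2, true, false) :: map (fun t => (t ^+ 2 - 2, false, false)) traces
  ++ [:: (2, false, true); (2, false, false)].
Proof.
have keyc t : t \in traces -> key (comp_el t) = (t ^+ 2 - 2, false, false).
  move/(allP traces_neq) => t2; rewrite /key (tau_comp); congr (_, _, _); apply: contraNF t2.
    by move/eqP=> e; rewrite -(tau_comp t) e (tau_1).
  by case/imsetP => h _ e; rewrite -(tau_comp t) e (tauJ) (tau_unip).
have u1 : (unip1 == 1%g) = false by apply: negbTE; apply: unip_el_neq1.
have u3 : (unip3 == 1%g) = false by apply: negbTE; apply: unip_el_neq1.
have k1 : key 1%g = (2, true, false).
  rewrite /key (tau_1) eqxx; congr (_, _, _); apply: contraFF u1 => /imsetP[h _ e].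
  by rewrite -(conjg_eq1 _ h) -e.
have ku1 : key unip1 = (2, false, true).
  by rewrite /key (tau_unip) u1 class_refl.
have ku3 : key unip3 = (2, false, false).
  by rewrite /key (tau_unip) u3 (negbTE (unip13_nconj)).
rewrite /reps map_cons map_cat -map_comp k1; congr (_ :: (_ ++ _));
  last by rewrite 2!map_cons ku1 ku3.
by apply/eq_in_map.
Qed.

Let reps_exist g : has (fun r => g \in (r ^: [set: gT])%g) reps.
Proof.
apply/hasP; have [tg|tg] := eqVneq (tau g) 2.
  have [->|g1] := eqVneq g 1%g; first by exists 1%g; [exact: mem_head | exact: class_refl].
  case: (class_unip tg g1) => cg.
    by exists unip1; last exact: cg; rewrite /reps in_cons mem_cat; apply/orP; right; apply/orP;
      right; exact: mem_head.
  by exists unip3; last exact: cg; rewrite /reps in_cons mem_cat; apply/orP; right; apply/orP;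
    right; rewrite in_cons; apply/orP; right; exact: mem_head.
have h : all (fun x : F => (x ^+ 2 - 2 != 2) ==> has (fun t => x ^+ 2 - 2 == t ^+ 2 - 2) traces)
    [seq inZp i | i <- iota 0 17] by vm_compute.
have /hasP[t tl /eqP te] : has (fun t => tau g == t ^+ 2 - 2) traces.
  by have := F17_forall h (\tr (l g)); rewrite -/(tau g) tg implyTb.
exists (comp_el t); last exact: (class_comp te tg).
by rewrite /reps in_cons mem_cat; apply/orP; right; apply/orP; left; exact: map_f.
Qed.

Lemma reps_count g : count (fun r => g \in (r ^: [set: gT])%g) reps = 1%N.
Proof.
apply/eqP; rewrite eqn_leq -has_count reps_exist andbT.
have uk : uniq (map key reps) by rewrite map_key; vm_compute.
apply: leq_trans (_ : (count (fun r => key r == key g) reps <= 1)%N).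
  by apply: sub_count => r /imsetP[h _ ->]; rewrite /= keyJ.
by rewrite -(count_map key (pred1 (key g))) -/(count_mem _ _) (count_uniq_mem _ uk) leq_b1.
Qed.

End Reps.

Lemma order_comp0 : #[comp_el 0]%g = 2%N.
Proof. by apply: (tau_N2); rewrite tau_comp; apply/eqP; vm_compute. Qed.
Lemma order_comp6 : #[comp_el 6]%g = 4%N.
Proof. by apply: (tau_0); rewrite tau_comp; apply/eqP; vm_compute. Qed.
Lemma order_comp5 : #[comp_el 5]%g = 8%N.
Proof. by apply: (tau_8); rewrite tau_comp; apply/eqP; vm_compute. Qed.
Lemma order_comp8 : #[comp_el 8]%g = 8%N.
Proof. by apply: (tau_8); rewrite tau_comp; apply/eqP; vm_compute. Qed.
Lemma order_comp1 : #[comp_el 1%R]%g = 3%N.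
Proof. by apply: (tau_3); rewrite tau_comp; apply/eqP; vm_compute. Qed.
Lemma order_comp3 : #[comp_el 3]%g = 9%N.
Proof. by apply: (tau_9); rewrite tau_comp; apply/eqP; vm_compute. Qed.
Lemma order_comp7 : #[comp_el 7]%g = 9%N.
Proof. by apply: (tau_9); rewrite tau_comp; apply/eqP; vm_compute. Qed.
Lemma order_comp4 : #[comp_el 4]%g = 9%N.
Proof. by apply: (tau_9); rewrite tau_comp; apply/eqP; vm_compute. Qed.
Lemma order_unip1 : #[unip1]%g = 17%N.
Proof. by apply: (order_unip). Qed.
Lemma order_unip3 : #[unip3]%g = 17%N.
Proof. by apply: (order_unip). Qed.

Definition torsion_orders := (order_comp0, order_comp6, order_comp5, order_comp8,
  order_comp1, order_comp3, order_comp7, order_comp4, order_unip1, order_unip3).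

Lemma card_cent_order (x y : gT) k : y = (x ^+ k)%g -> (#[x]%g <= #|'C[y]%g|)%N.
Proof. by move=> ->; apply/subset_leq_card; rewrite cycle_subG cent1C groupX ?cent1id. Qed.

Lemma card_centJ (x y : gT) : y \in (x ^: [set: gT])%g -> #|'C[y]%g| = #|'C[x]%g|.
Proof. by case/imsetP => h _ ->; rewrite -2!cent_set1 -conjg_set1 centJ cardJg. Qed.

Lemma card_cent_comp t x k : tau (x ^+ k)%g = t ^+ 2 - 2 -> t ^+ 2 - 2 != 2 ->
  (#[x]%g <= #|'C[comp_el t]%g|)%N.
Proof.
move=> e t2; rewrite -(@card_centJ _ (x ^+ k)%g); first exact: card_cent_order erefl.
by apply: (class_comp); rewrite e.
Qed.

(** * Constraints on a torsion unit *)

Section Unit.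
Variables (u : group_ring int gT) (n : nat).
Hypotheses (n_gt0 : (0 < n)%N) (un : u ^+ n = 1) (aug1 : augmentation u = 1).

Hypothesis u_neq1 : u != 1.

Lemma paug_1 : paug u 1%g = 0.
Proof. by rewrite /paug class1G big_set1 (gr_coef1_torsion n_gt0 un). Qed.

Lemma unit_sum (R : pzRingType) k (f : gT -> R) : coprime k n -> (forall g h, f (g ^ h)%g = f g) ->
  \sum_g (gr_coef (u ^+ k) g)%:~R * f g =
  \sum_(t <- traces) (paug u (comp_el t))%:~R * f (comp_el t ^+ k)%g
  + (paug u unip1)%:~R * f (unip1 ^+ k)%g + (paug u unip3)%:~R * f (unip3 ^+ k)%g.
Proof.
move=> kn fJ; rewrite (sum_gr_coef_coprime reps_count n_gt0 un kn fJ) /reps big_cons big_cat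
  big_map.
by rewrite paug_1 mul0r add0r -addrA; congr (_ + _); rewrite big_cons big_seq1.
Qed.

Lemma unit_sum1 (R : pzRingType) (f : gT -> R) : (forall g h, f (g ^ h)%g = f g) ->
  \sum_g (gr_coef u g)%:~R * f g =
  \sum_(t <- traces) (paug u (comp_el t))%:~R * f (comp_el t)%g
  + (paug u unip1)%:~R * f unip1 + (paug u unip3)%:~R * f unip3.
Proof.
move=> fJ; have := unit_sum (coprime1n n) fJ; rewrite expr1 => ->.
by rewrite !expg1; congr (_ + _ + _); apply: eq_bigr => t _; rewrite expg1.
Qed.

Lemma unit_total : \sum_(t <- traces) paug u (comp_el t) + paug u unip1 + paug u unip3 = 1.
Proof.
have := unit_sum1 (fun (_ _ : gT) => erefl (1 : int)); rewrite !intz !mulr1.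
rewrite (eq_bigr (fun g => gr_coef u g)) => [|g _]; last by rewrite intz mulr1.
rewrite -/(augmentation u) aug1 => ->; congr (_ + _ + _).
by apply: eq_bigr => t _; rewrite intz mulr1.
Qed.

End Unit.

Lemma reps_ind (P : gT -> Prop) : P 1%g ->
  P (comp_el 0) -> P (comp_el 6) -> P (comp_el 5) -> P (comp_el 8) ->
  P (comp_el 1) -> P (comp_el 3) -> P (comp_el 7) -> P (comp_el 4) ->
  P unip1 -> P unip3 -> forall r, r \in reps -> P r.
Proof.
move=> P0 P1 P2 P3 P4 P5 P6 P7 P8 P9 P10 r; rewrite /reps in_cons mem_cat.
case/orP => [/eqP -> //|/orP[/mapP[t + ->]|]].
  rewrite /traces !in_cons.
  by do ![case/orP=> [/eqP -> //|]].
by rewrite in_cons mem_seq1 => /orP[] /eqP ->.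
Qed.

Lemma like_single (u : group_ring int gT) r0 g : r0 \in reps -> g \in (r0 ^: [set: gT])%g ->
  paug u r0 = 1 -> (forall r, r \in reps -> r != r0 -> paug u r = 0) ->
  forall x, paug u x = paug (gr_elt g) x.
Proof.
move=> r0s gr0 u0 uz x.
have /hasP[r rs xr] : has (fun r => x \in (r ^: [set: gT])%g) reps by rewrite has_count reps_count.
rewrite (paug_class u xr) (paug_class (gr_elt g) xr) paug_elt.
have [-> |rr0] := eqVneq r r0; first by rewrite gr0 u0.
rewrite uz // (_ : g \in _ = false) //; apply: contraNF rr0 => gr.
have := reps_count g; set a := (fun r => _) => a1.
have ar : a r by []. have ar0 : a r0 by [].
(* Distinct [r] and [r0] in the class of [g] would both be counted. *)
elim: (reps) rs r0s a1 => // y s IHs; rewrite !in_cons /=.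
have cs z : z \in s -> a z -> (0 < count a s)%N by move=> zs az; rewrite -has_count; apply/hasP;
  exists z.
case/orP=> [/eqP <-|rs'] /orP[/eqP e|r0s'].
- by rewrite e eqxx.
- by rewrite ar add1n => -[c0]; have := cs _ r0s' ar0; rewrite c0.
- by rewrite -e ar0 add1n => -[c0]; have := cs _ rs' ar; rewrite c0.
case: (a y) => [|c1]; last exact: IHs rs' r0s' c1.
by rewrite add1n => -[c0]; have := cs _ rs' ar; rewrite c0.
Qed.

Lemma like_sum (R : pzRingType) (v : group_ring int gT) g (f : gT -> R) :
  (forall x, paug v x = paug (gr_elt g) x) -> (forall g h, f (g ^ h)%g = f g) ->
  \sum_x (gr_coef v x)%:~R * f x = f g.
Proof.
move=> vg fJ; rewrite (sum_gr_coef_class _ reps_count fJ).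
under eq_bigr do rewrite vg.
rewrite -(sum_gr_coef_class _ reps_count fJ) (bigD1 g) //= ffunE eqxx mul1r big1 ?addr0 // => x
  /negPf xg.
by rewrite ffunE xg mul0r.
Qed.

Section CharValues.
Variables (u : group_ring int gT) (n : nat).
Hypotheses (n_gt0 : (0 < n)%N) (un : u ^+ n = 1) (aug1 : augmentation u = 1) (u_neq1 : u != 1).
Hypothesis n17 : ~~ (17 %| n)%N.

Definition comp_paugs : seq int := [seq paug u (comp_el t) | t <- traces].

Lemma unip_paug : (paug u unip1 = 0) * (paug u unip3 = 0).
Proof. by split; apply: (paug_eq0 n_gt0 un); rewrite torsion_orders. Qed.

Lemma tau_sum (R : pzRingType) (h : F -> R) k : coprime k n ->
  \sum_g (gr_coef (u ^+ k) g)%:~R * h (tau g) =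
  \sum_(t <- traces) (paug u (comp_el t))%:~R * h (cheb (t ^+ 2 - 2) k).
Proof.
move=> kn; rewrite (unit_sum n_gt0 un aug1 u_neq1 kn) => [|g x]; last by rewrite tauJ.
rewrite !unip_paug !mul0r !addr0; apply: eq_bigr => t _.
by rewrite tauX tau_comp.
Qed.

Lemma tau_sum_int (h : F -> F) k : coprime k n ->
  \sum_g (gr_coef (u ^+ k) g)%:~R * h (tau g) = (dotz comp_paugs (char_coefs h k))%:~R.
Proof.
move=> kn; rewrite tau_sum // dotz_map rmorph_sum; apply: eq_bigr => t _.
by rewrite rmorphM /= -pmulrn natr_Zp.
Qed.

(** The palindrome condition on [behead tz] is the symmetry of the traces under k -> n - k; the
    trace at exponent 0 has no partner. *)
Lemma eig_int d (phi : gT -> 'M[F]_d) (h : F -> F) (tz cz : seq int) (s : F) :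
  {morph phi : x y / (x * y)%g >-> x *m y} -> phi 1%g = 1 -> (forall g, \tr (phi g) = h (tau g)) ->
  size tz = n -> size cz = n -> behead tz = rev (behead tz) ->
  (forall k, (k < n)%N -> \sum_g (gr_coef (u ^+ k) g)%:~R * h (tau g) = (nth 0 tz k)%:~R) ->
  (cheb s n == 2) && all (fun k => cheb s k == (nth 0 cz k)%:~R) (iota 0 n) ->
  exists m q, (m <= d)%N /\ (2 * n * m)%:Z = dotz cz tz + 17%:Z * q.
Proof.
clear aug1 u_neq1; move=> phiM phi1 phitr stz scz tzr tzE /andP[/eqP sn /allP csE].
have nF : n%:R != 0 :> F by rewrite -(dvdn_pcharf pchar_F17).
have rn : gr_mx phi u ^+ n = 1 by rewrite -gr_mxX // un gr_mx1.
have trE k : (k < n)%N -> \tr (gr_mx phi u ^+ k) = (nth 0 tz k)%:~R.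
  by move=> kn; rewrite -gr_mxX // mxtrace_gr_mx -tzE //; apply: eq_bigr => g _; rewrite phitr.
have tzs k : (0 < k < n)%N -> (nth 0 tz (n - k))%:~R = (nth 0 tz k)%:~R :> F.
  case: k => // k /andP[_ kn]; congr (_%:~R).
  have sb : size (behead tz) = n.-1 by rewrite size_behead stz.
  have kn' : (k < size (behead tz))%N by rewrite sb; lia.
  have := congr1 (fun w => nth 0 w k) tzr; rewrite (nth_rev _ kn') sb !nth_behead => ->.
  by congr (nth _ _ _); lia.
have [m md] := eigenvalue_multiplicity nF rn sn trE tzs.
rewrite (eq_bigr (fun k : 'I_n => (nth 0 cz k * nth 0 tz k)%:~R)); last first.
  by move=> k _; rewrite rmorphM /= (eqP (csE _ _)) // mem_iota /= ltn_ord.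
rewrite -rmorph_sum /= -(dotzE scz stz) -[(2 * n * m)%:R]/(((2 * n * m)%:Z)%:~R) => /eqP.
rewrite -subr_eq0 -rmorphB => /eqP /(@Fp_int_eq0 17 _ isT) [q qE].
by exists m, q; split=> //; rewrite -qE; ring.
Qed.

End CharValues.

Lemma sym2M : {morph (fun g => sym2_mx (l g)) : x y / (x * y)%g >-> x *m y}.
Proof. by move=> x y; rewrite (even_lM sym2_mxN) sym2_mxM. Qed.
Lemma sym4M : {morph (fun g => sym4_mx (l g)) : x y / (x * y)%g >-> x *m y}.
Proof. by move=> x y; rewrite (even_lM sym4_mxN) sym4_mxM. Qed.
Lemma sym2_1 : sym2_mx (l 1%g) = 1.
Proof. by case: (l_1) => ->; rewrite ?sym2_mxN sym2_mx1. Qed.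
Lemma sym4_1 : sym4_mx (l 1%g) = 1.
Proof. by case: (l_1) => ->; rewrite ?sym4_mxN sym4_mx1. Qed.
Lemma sym2_tr g : \tr (sym2_mx (l g)) = sym2_char (tau g).
Proof. exact: tr_sym2. Qed.
Lemma sym4_tr g : \tr (sym4_mx (l g)) = sym4_char (tau g).
Proof. exact: tr_sym4. Qed.

Lemma comp_reps t : t \in traces -> comp_el t \in reps.
Proof. by move=> tt; rewrite in_cons mem_cat map_f ?orbT. Qed.

Lemma tau_class g t : t ^+ 2 - 2 != 2 -> tau g = t ^+ 2 - 2 -> g \in (comp_el t ^: [set: gT])%g.
Proof. by move=> t2 tg; apply: (class_comp tg); rewrite tg. Qed.

Section Cases.
Variables (u : group_ring int gT) (n : nat).
Hypotheses (n_gt0 : (0 < n)%N) (un : u ^+ n = 1) (aug1 : augmentation u = 1) (u_neq1 : u != 1).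

Lemma total_paug : paug u (comp_el 0) + paug u (comp_el 6) + paug u (comp_el 5) + paug u (comp_el 8)
  + paug u (comp_el 1) + paug u (comp_el 3) + paug u (comp_el 7) + paug u (comp_el 4)
  + paug u unip1 + paug u unip3 = 1.
Proof.
rewrite -(unit_total n_gt0 un aug1 u_neq1).
by congr (_ + _ + _); rewrite /traces; symmetry; apply: sum_seq8.
Qed.

Lemma paug_order (x : gT) : ~~ (#[x]%g %| n)%N -> paug u x = 0.
Proof. exact: paug_eq0. Qed.

(** The Frobenius congruence is applied to the indicator function of the identity: one side is the
    coefficient of [u ^+ (p ^ a)] at the identity, which is 0 by Berman-Higman. *)
Lemma coef1_congruence p a : prime p -> u ^+ (p ^ a) != 1 ->
  exists q, dotz (comp_paugs u) [seq ((o %| p ^ a)%N : nat)%:Z | o <- [:: 2; 4; 8; 8; 3; 9; 9; 9]%N]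
    + (paug u unip1 + paug u unip3) * ((17 %| p ^ a)%N : nat)%:Z = p%:Z * q.
Proof.
move=> p_pr upa; pose f (g : gT) : 'F_p := (g == 1%g)%:R.
have fJ g h : f (g ^ h)%g = f g by rewrite /f conjg_eq1.
have := @frobenius_iter gT _ p a u f (pchar_Fp p_pr) fJ.
have augX k : augmentation (u ^+ k) = 1 by apply: augmentationX.
have un' : (u ^+ (p ^ a)) ^+ n = 1 by rewrite exprAC un expr1n.
rewrite (bigD1 1%g) //= (gr_coef1_torsion n_gt0 un' (augX _) upa) mul0r add0r big1 => [|g /negPf
  g1]; last first.
  by rewrite /f g1 mulr0.
have fXJ g h : f ((g ^ h) ^+ (p ^ a))%g = f (g ^+ (p ^ a))%g by rewrite -conjXg fJ.
rewrite (unit_sum1 n_gt0 un aug1 u_neq1 fXJ).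
have fE (x : gT) o : #[x]%g = o -> f (x ^+ (p ^ a))%g = (((o %| p ^ a)%N : nat)%:Z)%:~R.
  by move=> <-; rewrite /f -order_dvdn.
rewrite (fE _ _ (order_unip1)) (fE _ _ (order_unip3)).
rewrite (@sum_dotz _ _ _ _ _ [seq ((o %| p ^ a)%N : nat)%:Z | o <- [:: 2; 4; 8; 8; 3; 9; 9;
  9]%N]); last first.
  rewrite /traces !map_cons; cbv beta; rewrite (fE _ _ (order_comp0)) (fE _ _ (order_comp6)).
  rewrite (fE _ _ (order_comp5)) (fE _ _ (order_comp8)).
  rewrite (fE _ _ (order_comp1)) (fE _ _ (order_comp3)).
  by rewrite (fE _ _ (order_comp7)) (fE _ _ (order_comp4)).
rewrite -addrA -mulrDl -rmorphD -rmorphM -rmorphD => /esym/Fp_int_eq0 [//|q e].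
by exists q; exact: e.
Qed.

End Cases.

Lemma paugs_vanish (u : group_ring int gT) n : (0 < n)%N -> u ^+ n = 1 ->
  (~~ (2 %| n)%N -> paug u (comp_el 0) = 0) /\
  (~~ (4 %| n)%N -> paug u (comp_el 6) = 0) /\
  (~~ (8 %| n)%N -> paug u (comp_el 5) = 0 /\ paug u (comp_el 8) = 0) /\
  (~~ (3 %| n)%N -> paug u (comp_el 1) = 0) /\
  (~~ (9 %| n)%N -> [/\ paug u (comp_el 3) = 0, paug u (comp_el 7) = 0 & paug u (comp_el 4) = 0]) /\
  (~~ (17 %| n)%N -> paug u unip1 = 0 /\ paug u unip3 = 0).
Proof.
move=> n0 un; have z (x : gT) o : #[x]%g = o -> ~~ (o %| n)%N -> paug u x = 0.
  by move=> <-; apply: paug_order n0 un x.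
split; first exact: z (order_comp0).
split; first exact: z (order_comp6).
split.
  by move=> d; split; [exact: z (order_comp5) d | exact: z (order_comp8) d].
split; first exact: z (order_comp1).
split.
  by move=> d; split; [exact: z (order_comp3) d | exact: z (order_comp7) d | exact: z
    (order_comp4) d].
by move=> d; split; [exact: z (order_unip1) d | exact: z (order_unip3) d].
Qed.

Definition like (v : group_ring int gT) (t : F) : Prop :=
  forall g, tau g = t -> forall x, paug v x = paug (gr_elt g) x.

Lemma like_comp_reps (u : group_ring int gT) t0 : t0 \in traces -> t0 ^+ 2 - 2 != 2 -> paug u
  (comp_el t0) = 1 ->
  paug u 1%g = 0 -> (forall t, t \in traces -> t != t0 -> paug u (comp_el t) = 0) ->
  paug u unip1 = 0 -> paug u unip3 = 0 -> like u (t0 ^+ 2 - 2).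
Proof.
move=> tt t2 u1 c1 ct y1 y3 g tg x.
apply: (like_single (comp_reps tt) (tau_class t2 tg) u1).
move=> r; rewrite in_cons mem_cat; case/orP=> [/eqP -> //|/orP[/mapP[t ts ->]|]].
  by move=> tn; apply: ct => //; apply: contraNneq tn => ->.
by rewrite in_cons mem_seq1 => /orP[] /eqP ->.
Qed.

Lemma sum_like (v : group_ring int gT) (s : F) (h : F -> F) (z : int) :
  (exists t, t ^+ 2 - 2 = s) -> like v s -> h s == z%:~R ->
  \sum_g (gr_coef v g)%:~R * h (tau g) = z%:~R.
Proof.
case=> t ts lv /eqP hz; rewrite -ts in lv hz.
rewrite (like_sum (f := fun g => h (tau g)) (lv _ (tau_comp t))) => [|g k].
  by rewrite tau_comp.
by rewrite tauJ.
Qed.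

Lemma sum_one (h : F -> F) (z : int) : h 2 == z%:~R ->
  \sum_g (gr_coef (1 : group_ring int gT) g)%:~R * h (tau g) = z%:~R.
Proof.
move/eqP=> hz; rewrite (like_sum (g := 1%g) (f := fun g => h (tau g))) //.
  by rewrite (tau_1).
by move=> g k; rewrite tauJ.
Qed.

Lemma sum_coprime (u : group_ring int gT) n k (h : F -> F) L X : (0 < n)%N -> u ^+ n = 1 ->
  augmentation u = 1 -> u != 1 ->
  ~~ (17 %| n)%N -> coprime k n -> char_coefs h k = L -> dotz (comp_paugs u) L = X ->
  \sum_g (gr_coef (u ^+ k) g)%:~R * h (tau g) = X%:~R.
Proof. by move=> n0 un aug1 u1 n17 kn <- <-; apply: (tau_sum_int n0 un aug1 u1 n17). Qed.

Lemma like_order2 u : u ^+ 2 = 1 -> augmentation u = 1 -> u != 1 -> like u (-2).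
Proof.
move=> un aug1 u1; have n0 : (0 < 2)%N by [].
have [v2 [v4 [v8 [v3 [v9 v17]]]]] := paugs_vanish n0 un.
have p6 := v4 isT.
have [p5 p8] := v8 isT.
have p1 := v3 isT.
have [p3 p7 p4] := v9 isT.
have [y1 y3] := v17 isT.
have p0 := arith_order2 (total_paug n0 un aug1 u1) p6 p5 p8 p1 p3 p7 p4 y1 y3.
have -> : (-2 : F) = 0 ^+ 2 - 2 by apply/eqP; vm_compute.
apply: (@like_comp_reps u 0) (isT) (isT) p0 (paug_1 n0 un aug1 u1) _ y1 y3.
exact: (@seq8_ind _ (fun t => t != 0 -> paug u (comp_el t) = 0) _ _ _ _ _ _ _ _
  (@neq_self _ _ _) (fun _ => p6) (fun _ => p5) (fun _ => p8) (fun _ => p1) (fun _ => p3) (fun _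
    => p7) (fun _ => p4)).
Qed.

Lemma like_order3 u : u ^+ 3 = 1 -> augmentation u = 1 -> u != 1 -> like u (-1).
Proof.
move=> un aug1 u1; have n0 : (0 < 3)%N by [].
have [v2 [v4 [v8 [v3 [v9 v17]]]]] := paugs_vanish n0 un.
have p0 := v2 isT.
have p6 := v4 isT.
have [p5 p8] := v8 isT.
have [p3 p7 p4] := v9 isT.
have [y1 y3] := v17 isT.
have p1 := arith_order3 (total_paug n0 un aug1 u1) p0 p6 p5 p8 p3 p7 p4 y1 y3.
have -> : (-1 : F) = 1%R ^+ 2 - 2 by apply/eqP; vm_compute.
apply: (@like_comp_reps u 1%R) (isT) (isT) p1 (paug_1 n0 un aug1 u1) _ y1 y3.
exact: (@seq8_ind _ (fun t => t != 1%R -> paug u (comp_el t) = 0) _ _ _ _ _ _ _ _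
  (fun _ => p0) (fun _ => p6) (fun _ => p5) (fun _ => p8) (@neq_self _ _ _) (fun _ => p3) (fun _
    => p7) (fun _ => p4)).
Qed.

Lemma sum_2 v (h : F -> F) z : v ^+ 2 = 1 -> augmentation v = 1 -> v != 1 -> h (-2) == z%:~R ->
  \sum_g (gr_coef v g)%:~R * h (tau g) = z%:~R.
Proof.
move=> v2 aug1 v1; apply: sum_like (like_order2 v2 aug1 v1).
by exists 0; apply/eqP; vm_compute.
Qed.

Lemma sum_3 v (h : F -> F) z : v ^+ 3 = 1 -> augmentation v = 1 -> v != 1 -> h (-1) == z%:~R ->
  \sum_g (gr_coef v g)%:~R * h (tau g) = z%:~R.
Proof.
move=> v2 aug1 v1; apply: sum_like (like_order3 v2 aug1 v1).
by exists 1; apply/eqP; vm_compute.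
Qed.

Lemma sym2_eig (u : group_ring int gT) n tz : (0 < n)%N -> u ^+ n = 1 -> ~~ (17 %| n)%N ->
  (forall k, (k < n)%N -> \sum_g (gr_coef (u ^+ k) g)%:~R * sym2_char (tau g) = (nth 0 tz k)%:~R) ->
  size tz = n -> behead tz = rev (behead tz) -> forall cz (s : F), size cz = n ->
  (cheb s n == 2) && all (fun k => cheb s k == (nth 0 cz k)%:~R) (iota 0 n) ->
  multiplicity_cond 3 n cz tz.
Proof.
move=> n0 un n17 tzE stz rtz cz s scz cs.
exact: (eig_int n0 un n17 (sym2M) (sym2_1) (sym2_tr) stz scz rtz tzE cs).
Qed.

Lemma sym4_eig (u : group_ring int gT) n tz : (0 < n)%N -> u ^+ n = 1 -> ~~ (17 %| n)%N ->
  (forall k, (k < n)%N -> \sum_g (gr_coef (u ^+ k) g)%:~R * sym4_char (tau g) = (nth 0 tz k)%:~R) ->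
  size tz = n -> behead tz = rev (behead tz) -> forall cz (s : F), size cz = n ->
  (cheb s n == 2) && all (fun k => cheb s k == (nth 0 cz k)%:~R) (iota 0 n) ->
  multiplicity_cond 5 n cz tz.
Proof.
move=> n0 un n17 tzE stz rtz cz s scz cs.
exact: (eig_int n0 un n17 (sym4M) (sym4_1) (sym4_tr) stz scz rtz tzE cs).
Qed.

(** * The representation of degree 9 and units of order 17 *)

Section Rho.
Variables (K : numFieldType) (gam : K).
Hypothesis gam2 : gam ^+ 2 = 17.
Local Notation T := (F * F)%type.

(** Matrices of size 289 and rank 9: [rho17 1%g] is the projector [ker17] and not the identity. This
    explains the weak hypotheses of [RootProjector]. *)
Definition rho17 g : 'M[K]_#|{: T}| :=
  \matrix_(i, j) ker17 gam (sact (enum_val i) (l g)) (enum_val j).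

Lemma sum_enum_val (f : T -> K) : \sum_(i < #|{: T}|) f (enum_val i) = \sum_v f v.
Proof. by rewrite [RHS](reindex (@enum_val _ {: T})) //; exists enum_rank => x _;
  rewrite ?enum_valK ?enum_rankK. Qed.

Lemma ker17_opp v A w : ker17 gam (sact v (- A)) w = ker17 gam (sact v A) w.
Proof. by rewrite sactN ker17N. Qed.

Lemma rho17M : {morph rho17 : g h / (g * h)%g >-> g *m h}.
Proof.
move=> g h; apply/matrixP => i j; rewrite !mxE.
have -> : ker17 gam (sact (enum_val i) (l (g * h)%g)) (enum_val j) = ker17 gam (sact (enum_val i)
  (l g *m l h)) (enum_val j).
  by case: (l_M g h) => ->; rewrite ?ker17_opp.
rewrite sactM -(ker17_idem gam2) (reindex_inj (sact_inj (l_det h))) /= -sum_enum_val.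
by apply: eq_bigr => k _; rewrite !mxE ker17_act.
Qed.

Lemma mxtrace_rho17 g : \tr (rho17 g) = \sum_v ker17 gam (sact v (l g)) v.
Proof. by rewrite -sum_enum_val; apply: eq_bigr => i _; rewrite mxE. Qed.

Lemma mxtrace_rho17J g h : \tr (rho17 (g ^ h)%g) = \tr (rho17 g).
Proof. by rewrite conjgE rho17M mxtrace_mulC -rho17M mulgK. Qed.

Lemma mxtrace_rho17_1 : \tr (rho17 1%g) = 9.
Proof.
rewrite mxtrace_rho17 -(trace_ker17_1 gam2); apply: eq_bigr => v _.
by case: (l_1) => ->; rewrite ?ker17_opp sact1.
Qed.

Lemma mxtrace_rho17_unip b k : k%:R * b != 0 -> \tr (rho17 (unip_el b ^+ k)%g) = (1 + (sg (k%:R *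
  b))%:~R * gam) / 2.
Proof.
move=> kb; rewrite mxtrace_rho17 -(trace_ker17_unip gam2 kb); apply: eq_bigr => v _.
by case: (l_unipX b k) => ->; rewrite ?ker17_opp.
Qed.

End Rho.

Lemma half_trace (K : numFieldType) (y y' : int) (s gam : K) : y + y' = 1 ->
  y%:~R * ((1 + s * 1%:~R * gam) / 2) + y'%:~R * ((1 + s * (-1)%:~R * gam) / 2) = (1 + (y -
    y')%:~R * s * gam) / 2.
Proof.
move=> yy; have -> : y' = 1 - y by rewrite -yy; ring.
by rewrite !rmorphB !rmorphN /=; field.
Qed.

Lemma multiplicity_int (K : numFieldType) (m : nat) (s D : int) (gam : K) : gam ^+ 2 = 17 ->
  17 * m%:R = s%:~R * gam * (D%:~R * gam / 2) + 17 / 2 -> (2 * m)%:Z = 1 + s * D.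
Proof.
move=> gam2 e; apply/eqP; rewrite -(eqr_int K) -pmulrn natrM intrD intrM -subr_eq0.
have -> : 2%:R * m%:R - (1%:~R + s%:~R * D%:~R) =
  2 / 17 * (17 * m%:R - (s%:~R * gam * (D%:~R * gam / 2) + 17 / 2)) + (gam ^+ 2 - 17) * s%:~R *
    D%:~R / 17 by field.
by rewrite e gam2 !subrr mulr0 !mul0r addr0.
Qed.

(** Let D be the difference of the two partial augmentations. The eigenvalues z^-1 and z^-3 have
    multiplicities (1 + D)/2 and (1 - D)/2, natural numbers with sum 1, so D is 1 or -1; the sum of
    the partial augmentations is 1. *)
Lemma paugs_order17 (u : group_ring int gT) : u ^+ 17 = 1 -> augmentation u = 1 -> u != 1 ->
  (paug u unip1 = 1 /\ paug u unip3 = 0) \/ (paug u unip1 = 0 /\ paug u unip3 = 1).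
Proof.
move=> un aug1 u1; have n0 : (0 < 17)%N by [].
have [v2 [v4 [v8 [v3 [v9 _]]]]] := paugs_vanish n0 un.
have p0 := v2 isT; have p6 := v4 isT; have [p5 p8] := v8 isT; have p1 := v3 isT;
  have [p3 p7 p4] := v9 isT.
have tot : paug u unip1 + paug u unip3 = 1.
  exact: (arith_order17 (total_paug n0 un aug1 u1) p0 p6 p5 p8 p1 p3 p7 p4).
have [z prz] := C_prim_root_exists n0.
pose gam := gauss_sum z; have gam2 : gam ^+ 2 = 17 := gauss_sum_sqr prz.
pose B k := gr_mx (rho17 gam) (u ^+ k).
have BM i j : B i *m B j = B (i + j)%N by rewrite /B exprD (gr_mxM (rho17M gam2)).
have Bn : B 17%N = B 0%N by rewrite /B un.
have n17 : 17%:R != 0 :> algC by rewrite pnatr_eq0.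
have tr0 : \tr (B 0%N) = 9 by rewrite /B expr0 gr_mx1 mxtrace_rho17_1.
have trk (k : F) : k != 0 -> \tr (B k) = (1 + (paug u unip1 - paug u unip3)%:~R * (sg k)%:~R *
  gam) / 2.
  move=> k0; have k17 : coprime k 17.
    rewrite coprime_sym prime_coprime // gtnNdvd // ?ltn_ord //.
    by rewrite lt0n; apply: contra k0 => /eqP k0; apply/eqP/val_inj.
  rewrite /B mxtrace_gr_mx (unit_sum n0 un aug1 u1 k17 (mxtrace_rho17J gam2)).
  rewrite big1_seq => [|t /andP[_ tt]]; last first.
    suff -> : paug u (comp_el t) = 0 by rewrite mul0r.
    exact: (@seq8_ind _ (fun t => paug u (comp_el t) = 0) _ _ _ _ _ _ _ _ p0 p6 p5 p8 p1 p3 p7 p4).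
  have T b : b != 0 -> \tr (rho17 gam (unip_el b ^+ k)%g) = (1 + (sg k)%:~R * (sg b)%:~R * gam) / 2.
    move=> b0; have kb : (k : nat)%:R * b != 0 by rewrite natr_Zp mulf_neq0.
    by rewrite (mxtrace_rho17_unip gam2 kb) natr_Zp sgM rmorphM.
  have T1 := T 1 isT; have T3 := T 3 isT.
  rewrite add0r [in X in _ * X + _]T1 [in X in _ + _ * X]T3 sg1 sg3.
  exact: half_trace.
pose D := paug u unip1 - paug u unip3.
have mult j : (j = 1%N \/ j = 3%N) -> exists m : nat, (2 * m)%:Z = 1 + sg j%:R * D.
  move=> jj; have zj : (z ^- j) ^+ 17 = 1 by rewrite exprVn exprAC (prim_expr_order prz) expr1n
    invr1.
  exists (\rank (root_proj 17 B (z ^- j))).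
  have := root_mult BM Bn n17 zj.
  have jF : (j%:R : F) != 0 by case: jj => ->.
  (* The trace at [k = 0] is 9 = 1/2 + 17/2, so the formula for nonzero [k] extends to 0 with a
     correction of 17/2. This leaves a vanishing sum, a Gauss sum and the correction. *)
  rewrite (eq_bigr (fun k : F => zchar z (j%:R * k) / 2 + (sg k)%:~R * zchar z (j%:R * k) * (D%:~R
    * gam / 2)
    + zchar z (j%:R * k) * ((k == 0)%:R * (17 / 2)))) => [|k _]; last first.
    have -> : (z ^- j) ^- k = zchar z (j%:R * k).
      by rewrite exprVn invrK -exprM (zchar_mod prz) natrM natr_Zp.
    have [-> |k0] := eqVneq k 0; first by rewrite tr0 sg0 mulr0 zchar0 /=; field.
    by rewrite trk // -/D /=; field.
  rewrite !big_split /= -!mulr_suml (sum_zchar prz) (negPf jF) mul0r add0r (gauss_sum_twist _ jF)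
    (bigD1 0) //=.
  rewrite big1 ?addr0 => [|k /negPf ->]; last by rewrite mul0r mulr0.
  rewrite mulr0 zchar0 !mul1r -/gam => e.
  exact: multiplicity_int gam2 e.
have [m mE] := mult 1%N (or_introl erefl); have [m' mE'] := mult 3%N (or_intror erefl).
move: mE mE' tot; rewrite sg1 sg3 /D; clear; move: (paug u unip1) (paug u unip3) => y y'; lia.
Qed.

Hypothesis cardG : #|gT| = 2448%N.

Lemma unit_bound (u : group_ring int gT) n : (0 < n)%N -> u ^+ n = 1 ->
  8 * (paug u (comp_el 0) ^+ 2 + paug u (comp_el 6) ^+ 2 + paug u (comp_el 5) ^+ 2 + paug u
    (comp_el 8) ^+ 2)
  + 9 * (paug u (comp_el 1) ^+ 2 + paug u (comp_el 3) ^+ 2 + paug u (comp_el 7) ^+ 2 + paug u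
    (comp_el 4) ^+ 2)
  + 17 * (paug u unip1 ^+ 2 + paug u unip3 ^+ 2) <= 2448.
Proof.
move=> n_gt0 un.
have tX x k : tau (x ^+ k)%g = cheb (tau x) k := tauX x k.
(* The classes of orders 2 and 4 contain powers of an element of order 8, and that of order 3 the
   cube of an element of order 9; hence the weights 8 and 9. *)
have c0 : (8 <= #|'C[comp_el 0%R]%g|)%N.
  apply: leq_trans (eq_leq (esym order_comp5)) _; apply: (@card_cent_comp _ _ 4);
    last by vm_compute.
  by rewrite tX tau_comp; apply/eqP; vm_compute.
have c6 : (8 <= #|'C[comp_el 6%R]%g|)%N.
  apply: leq_trans (eq_leq (esym order_comp5)) _; apply: (@card_cent_comp _ _ 2);
    last by vm_compute.
  by rewrite tX tau_comp; apply/eqP; vm_compute.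
have c1 : (9 <= #|'C[comp_el 1%R]%g|)%N.
  apply: leq_trans (eq_leq (esym order_comp3)) _; apply: (@card_cent_comp _ _ 3);
    last by vm_compute.
  by rewrite tX tau_comp; apply/eqP; vm_compute.
have cs (x : gT) : (#[x]%g <= #|'C[x]%g|)%N by apply: (@card_cent_order _ _ 1); rewrite expg1.
have csE (x : gT) c : #[x]%g = c -> (c <= #|'C[x]%g|)%N by move=> <-; apply: cs.
apply: (@weighted_sum_bound _ _ _ 1%g).
- by have := torsion_paug_bound reps_count n_gt0 un; rewrite cardG.
- apply/and5P; split; [exact: c0 | exact: c6 | exact: csE order_comp5 | exact: csE order_comp8 |
  by []].
- apply/and5P; split; [exact: c1 | exact: csE order_comp3 | exact: csE order_comp7 | exact: csE
  order_comp4 | by []].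
by apply/and3P; split; [exact: csE order_unip1 | exact: csE order_unip3 | by []].
Qed.

(** * Orders 4, 8 and 9, and the excluded orders *)

Lemma like_order4 u : u ^+ 4 = 1 -> augmentation u = 1 -> u ^+ 2 != 1 -> like u 0.
Proof.
move=> un aug1 u2; have n0 : (0 < 4)%N by [].
have u1 : u != 1 by apply: contraNneq u2 => ->; rewrite expr1n.
have augX k : augmentation (u ^+ k) = 1 by apply: augmentationX.
have [v2 [v4 [v8 [v3 [v9 v17]]]]] := paugs_vanish n0 un.
have [p5 p8] := v8 isT.
have p1 := v3 isT.
have [p3 p7 p4] := v9 isT.
have [y1 y3] := v17 isT.
have [[c1 _ _ c7] _] := sym2_coefs.
have [_ c3 _ _] := sym2_coefs.1.
pose X := paug u (comp_el 0) * 16%:Z + paug u (comp_el 6) * 1%:Z + paug u (comp_el 5) * 7%:Z +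
  paug u (comp_el 8) * 12%:Z.
pose Y := paug u (comp_el 0) * 16%:Z + paug u (comp_el 6) * 1%:Z + paug u (comp_el 5) * 12%:Z +
  paug u (comp_el 8) * 7%:Z.
have T20 : \sum_g (gr_coef (u ^+ 0) g)%:~R * sym2_char (tau g) = 3%:Z%:~R.
  by rewrite expr0; apply: sum_one; vm_compute.
have T21 : \sum_g (gr_coef (u ^+ 1) g)%:~R * sym2_char (tau g) = X%:~R.
  exact: (sum_coprime n0 un aug1 u1 isT (k := 1) isT c1 (dot_pow2 _ _ _ _ _ _ _ _ _ _ _ _ p1 p3 p7
    p4)).
have u22 : (u ^+ 2) ^+ 2 = 1 by rewrite -exprM.
have T22 : \sum_g (gr_coef (u ^+ 2) g)%:~R * sym2_char (tau g) = 16%:Z%:~R.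
  by apply: sum_2 u22 (augX 2) u2 _; vm_compute.
have T23 : \sum_g (gr_coef (u ^+ 3) g)%:~R * sym2_char (tau g) = Y%:~R.
  exact: (sum_coprime n0 un aug1 u1 isT (k := 3) isT c3 (dot_pow2 _ _ _ _ _ _ _ _ _ _ _ _ p1 p3 p7
    p4)).
have XY : Y = X by rewrite /X /Y p5 p8.
rewrite XY in T23.
have tz2 : forall k, (k < 4)%N -> \sum_g (gr_coef (u ^+ k) g)%:~R * sym2_char (tau g) = (nth 0 [::
  3%:Z; X; 16%:Z; X] k)%:~R.
  apply: (@nth_forall _ 0 [:: 3%:Z; X; 16%:Z;
    X] (fun k z => \sum_g (gr_coef (u ^+ k) g)%:~R * sym2_char (tau g) = z%:~R) 4 erefl).
  exact: (conj T20 (conj T21 (conj T22 (conj T23 (I))))).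
have e1 := coef1_congruence n0 un aug1 u1 (p := 2) (a := 1) isT u2.
have [p0 p6] := arith_order4 (total_paug n0 un aug1 u1) (unit_bound n0 un) p5 p8 p1 p3 p7 p4 y1 y3
  e1
  (sym2_eig n0 un isT tz2 erefl erefl (cz := (map Posz [:: 2; 2; 2; 2]%N)) (s := 2) erefl isT)
  (sym2_eig n0 un isT tz2 erefl erefl (cz := (map Posz [:: 2; 15; 2; 15]%N)) (s := 15) erefl isT).
have -> : (0 : F) = 6 ^+ 2 - 2 by apply/eqP; vm_compute.
apply: (@like_comp_reps u 6) (isT) (isT) p6 (paug_1 n0 un aug1 u1) _ y1 y3.
exact: (@seq8_ind _ (fun t => t != 6 -> paug u (comp_el t) = 0) _ _ _ _ _ _ _ _
  (fun _ => p0) (@neq_self _ _ _) (fun _ => p5) (fun _ => p8) (fun _ => p1) (fun _ => p3) (fun _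
    => p7) (fun _ => p4)).
Qed.

Lemma sum_4 v (h : F -> F) z : v ^+ 4 = 1 -> augmentation v = 1 -> v ^+ 2 != 1 -> h 0 == z%:~R ->
  \sum_g (gr_coef v g)%:~R * h (tau g) = z%:~R.
Proof.
move=> v4 aug1 v2; apply: sum_like (like_order4 v4 aug1 v2).
by exists 6; apply/eqP; vm_compute.
Qed.

(** The traces of even powers are known from orders 2 and 4; those of odd powers are linear in the
    partial augmentations of [u], because these exponents are prime to 8. *)
Lemma like_order8 u : u ^+ 8 = 1 -> augmentation u = 1 -> u ^+ 4 != 1 -> like u 6 \/ like u 11.
Proof.
move=> un aug1 u4; have n0 : (0 < 8)%N by [].
have u1 : u != 1 by apply: contraNneq u4 => ->; rewrite expr1n.
have augX k : augmentation (u ^+ k) = 1 by apply: augmentationX.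
have [v2 [v4 [v8 [v3 [v9 v17]]]]] := paugs_vanish n0 un.
have p1 := v3 isT.
have [p3 p7 p4] := v9 isT.
have [y1 y3] := v17 isT.
have [[c1 c3 c5 c7] _] := sym2_coefs; have [d1 d3 d5 d7] := sym4_coefs.
pose X := paug u (comp_el 0) * 16%:Z + paug u (comp_el 6) * 1%:Z + paug u (comp_el 5) * 7%:Z +
  paug u (comp_el 8) * 12%:Z.
pose Y := paug u (comp_el 0) * 16%:Z + paug u (comp_el 6) * 1%:Z + paug u (comp_el 5) * 12%:Z +
  paug u (comp_el 8) * 7%:Z.
pose X' := paug u (comp_el 0) * 1%:Z + paug u (comp_el 6) * 16%:Z + paug u (comp_el 5) * 7%:Z +
  paug u (comp_el 8) * 12%:Z.
pose Y' := paug u (comp_el 0) * 1%:Z + paug u (comp_el 6) * 16%:Z + paug u (comp_el 5) * 12%:Z +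
  paug u (comp_el 8) * 7%:Z.
have u2_4 : (u ^+ 2) ^+ 4 = 1 by rewrite -exprM.
have u2_2 : (u ^+ 2) ^+ 2 != 1 by rewrite -exprM.
have u4_2 : (u ^+ 4) ^+ 2 = 1 by rewrite -exprM.
have u6_4 : (u ^+ 6) ^+ 4 = 1 by rewrite -exprM -[(6 * 4)%N]/(8 * 3)%N exprM un expr1n.
have u6_2 : (u ^+ 6) ^+ 2 != 1 by rewrite -exprM -[(6 * 2)%N]/(8 + 4)%N exprD un mul1r.
have u2 : u ^+ (2 ^ 1) != 1 by apply: contraNneq u4 => u2;
  rewrite -[4%N]/(2 ^ 1 * 2)%N exprM u2 expr1n.
have T20 : \sum_g (gr_coef (u ^+ 0) g)%:~R * sym2_char (tau g) = 3%:Z%:~R.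
  by rewrite expr0; apply: sum_one; vm_compute.
have T21 : \sum_g (gr_coef (u ^+ 1) g)%:~R * sym2_char (tau g) = X%:~R.
  exact: (sum_coprime n0 un aug1 u1 isT (k := 1) isT c1 (dot_pow2 _ _ _ _ _ _ _ _ _ _ _ _ p1 p3 p7
    p4)).
have T23 : \sum_g (gr_coef (u ^+ 3) g)%:~R * sym2_char (tau g) = Y%:~R.
  exact: (sum_coprime n0 un aug1 u1 isT (k := 3) isT c3 (dot_pow2 _ _ _ _ _ _ _ _ _ _ _ _ p1 p3 p7
    p4)).
have T25 : \sum_g (gr_coef (u ^+ 5) g)%:~R * sym2_char (tau g) = Y%:~R.
  exact: (sum_coprime n0 un aug1 u1 isT (k := 5) isT c5 (dot_pow2 _ _ _ _ _ _ _ _ _ _ _ _ p1 p3 p7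
    p4)).
have T27 : \sum_g (gr_coef (u ^+ 7) g)%:~R * sym2_char (tau g) = X%:~R.
  exact: (sum_coprime n0 un aug1 u1 isT (k := 7) isT c7 (dot_pow2 _ _ _ _ _ _ _ _ _ _ _ _ p1 p3 p7
    p4)).
have T22 : \sum_g (gr_coef (u ^+ 2) g)%:~R * sym2_char (tau g) = 1%:Z%:~R.
  by apply: sum_4 u2_4 (augX 2) u2_2 _; vm_compute.
have T26 : \sum_g (gr_coef (u ^+ 6) g)%:~R * sym2_char (tau g) = 1%:Z%:~R.
  by apply: sum_4 u6_4 (augX 6) u6_2 _; vm_compute.
have T24 : \sum_g (gr_coef (u ^+ 4) g)%:~R * sym2_char (tau g) = 16%:Z%:~R.
  by apply: sum_2 u4_2 (augX 4) u4 _; vm_compute.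
have tz2 : forall k, (k < 8)%N -> \sum_g (gr_coef (u ^+ k) g)%:~R * sym2_char (tau g) = (nth 0 [::
  3%:Z; X; 1%:Z; Y; 16%:Z; Y; 1%:Z; X] k)%:~R.
  apply: (@nth_forall _ 0 [:: 3%:Z; X; 1%:Z; Y; 16%:Z; Y; 1%:Z;
    X] (fun k z => \sum_g (gr_coef (u ^+ k) g)%:~R * sym2_char (tau g) = z%:~R) 8 erefl).
  exact: (conj T20 (conj T21 (conj T22 (conj T23 (conj T24 (conj T25 (conj T26 (conj T27
    (I))))))))).
have T40 : \sum_g (gr_coef (u ^+ 0) g)%:~R * sym4_char (tau g) = 5%:Z%:~R.
  by rewrite expr0; apply: sum_one; vm_compute.
have T41 : \sum_g (gr_coef (u ^+ 1) g)%:~R * sym4_char (tau g) = X'%:~R.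
  exact: (sum_coprime n0 un aug1 u1 isT (k := 1) isT d1 (dot_pow2 _ _ _ _ _ _ _ _ _ _ _ _ p1 p3 p7
    p4)).
have T43 : \sum_g (gr_coef (u ^+ 3) g)%:~R * sym4_char (tau g) = Y'%:~R.
  exact: (sum_coprime n0 un aug1 u1 isT (k := 3) isT d3 (dot_pow2 _ _ _ _ _ _ _ _ _ _ _ _ p1 p3 p7
    p4)).
have T45 : \sum_g (gr_coef (u ^+ 5) g)%:~R * sym4_char (tau g) = Y'%:~R.
  exact: (sum_coprime n0 un aug1 u1 isT (k := 5) isT d5 (dot_pow2 _ _ _ _ _ _ _ _ _ _ _ _ p1 p3 p7
    p4)).
have T47 : \sum_g (gr_coef (u ^+ 7) g)%:~R * sym4_char (tau g) = X'%:~R.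
  exact: (sum_coprime n0 un aug1 u1 isT (k := 7) isT d7 (dot_pow2 _ _ _ _ _ _ _ _ _ _ _ _ p1 p3 p7
    p4)).
have T42 : \sum_g (gr_coef (u ^+ 2) g)%:~R * sym4_char (tau g) = 16%:Z%:~R.
  by apply: sum_4 u2_4 (augX 2) u2_2 _; vm_compute.
have T46 : \sum_g (gr_coef (u ^+ 6) g)%:~R * sym4_char (tau g) = 16%:Z%:~R.
  by apply: sum_4 u6_4 (augX 6) u6_2 _; vm_compute.
have T44 : \sum_g (gr_coef (u ^+ 4) g)%:~R * sym4_char (tau g) = 1%:Z%:~R.
  by apply: sum_2 u4_2 (augX 4) u4 _; vm_compute.
have tz4 : forall k, (k < 8)%N -> \sum_g (gr_coef (u ^+ k) g)%:~R * sym4_char (tau g) = (nth 0 [::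
  5%:Z; X'; 16%:Z; Y'; 1%:Z; Y'; 16%:Z; X'] k)%:~R.
  apply: (@nth_forall _ 0 [:: 5%:Z; X'; 16%:Z; Y'; 1%:Z; Y'; 16%:Z;
    X'] (fun k z => \sum_g (gr_coef (u ^+ k) g)%:~R * sym4_char (tau g) = z%:~R) 8 erefl).
  exact: (conj T40 (conj T41 (conj T42 (conj T43 (conj T44 (conj T45 (conj T46 (conj T47
    (I))))))))).
have e1 := coef1_congruence n0 un aug1 u1 (p := 2) (a := 1) isT u2.
have e2 := coef1_congruence n0 un aug1 u1 (p := 2) (a := 2) isT u4.
have [p0 p6 [[p5 p8]|[p5 p8]]] := arith_order8 (total_paug n0 un aug1 u1) (unit_bound n0 un) p1 p3
  p7 p4 y1 y3 e1 e2
  (sym2_eig n0 un isT tz2 erefl erefl (cz := (map Posz [:: 2; 2; 2; 2; 2; 2; 2;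
    2]%N)) (s := 2) erefl isT)
  (sym2_eig n0 un isT tz2 erefl erefl (cz := (map Posz [:: 2; 15; 2; 15; 2; 15; 2;
    15]%N)) (s := 15) erefl isT)
  (sym2_eig n0 un isT tz2 erefl erefl (cz := (map Posz [:: 2; 6; 0; 11; 15; 11; 0;
    6]%N)) (s := 6) erefl isT)
  (sym2_eig n0 un isT tz2 erefl erefl (cz := (map Posz [:: 2; 11; 0; 6; 15; 6; 0;
    11]%N)) (s := 11) erefl isT)
  (sym4_eig n0 un isT tz4 erefl erefl (cz := (map Posz [:: 2; 2; 2; 2; 2; 2; 2;
    2]%N)) (s := 2) erefl isT)
  (sym4_eig n0 un isT tz4 erefl erefl (cz := (map Posz [:: 2; 15; 2; 15; 2; 15; 2;
    15]%N)) (s := 15) erefl isT).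
  left; have -> : (6 : F) = 5 ^+ 2 - 2 by apply/eqP; vm_compute.
  apply: (@like_comp_reps u 5) (isT) (isT) p5 (paug_1 n0 un aug1 u1) _ y1 y3.
exact: (@seq8_ind _ (fun t => t != 5 -> paug u (comp_el t) = 0) _ _ _ _ _ _ _ _
  (fun _ => p0) (fun _ => p6) (@neq_self _ _ _) (fun _ => p8) (fun _ => p1) (fun _ => p3) (fun _
    => p7) (fun _ => p4)).
right; have -> : (11 : F) = 8 ^+ 2 - 2 by apply/eqP; vm_compute.
apply: (@like_comp_reps u 8) (isT) (isT) p8 (paug_1 n0 un aug1 u1) _ y1 y3.
exact: (@seq8_ind _ (fun t => t != 8 -> paug u (comp_el t) = 0) _ _ _ _ _ _ _ _
  (fun _ => p0) (fun _ => p6) (fun _ => p5) (@neq_self _ _ _) (fun _ => p1) (fun _ => p3) (fun _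
    => p7) (fun _ => p4)).
Qed.

Lemma like_order9 u : u ^+ 9 = 1 -> augmentation u = 1 -> u ^+ 3 != 1 -> [\/ like u 7, like u 13 |
  like u 14].
Proof.
move=> un aug1 u3; have n0 : (0 < 9)%N by [].
have u1 : u != 1 by apply: contraNneq u3 => ->; rewrite expr1n.
have augX k : augmentation (u ^+ k) = 1 by apply: augmentationX.
have [v2 [v4 [v8 [v3 [v9 v17]]]]] := paugs_vanish n0 un.
have p0 := v2 isT.
have p6 := v4 isT.
have [p5 p8] := v8 isT.
have [y1 y3] := v17 isT.
have [[c1 _ c5 c7] [c2 c4 c8]] := sym2_coefs.
pose t1 := paug u (comp_el 1%R) * 0%:Z + paug u (comp_el 3) * 8%:Z + paug u (comp_el 7) * 14%:Z +
  paug u (comp_el 4) * 15%:Z.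
pose t2 := paug u (comp_el 1%R) * 0%:Z + paug u (comp_el 3) * 14%:Z + paug u (comp_el 7) * 15%:Z +
  paug u (comp_el 4) * 8%:Z.
pose t4 := paug u (comp_el 1%R) * 0%:Z + paug u (comp_el 3) * 15%:Z + paug u (comp_el 7) * 8%:Z +
  paug u (comp_el 4) * 14%:Z.
have u3_3 : (u ^+ 3) ^+ 3 = 1 by rewrite -exprM.
have u6_3 : (u ^+ 6) ^+ 3 = 1 by rewrite -exprM -[(6 * 3)%N]/(9 * 2)%N exprM un expr1n.
have u6 : u ^+ 6 != 1 by apply: contraNneq u3 => u6; move: un;
  rewrite -[9%N]/(6 + 3)%N exprD u6 mul1r => ->.
have T20 : \sum_g (gr_coef (u ^+ 0) g)%:~R * sym2_char (tau g) = 3%:Z%:~R.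
  by rewrite expr0; apply: sum_one; vm_compute.
have T21 : \sum_g (gr_coef (u ^+ 1) g)%:~R * sym2_char (tau g) = t1%:~R.
  exact: (sum_coprime n0 un aug1 u1 isT (k := 1) isT c1 (dot_pow3 _ _ _ _ _ _ _ _ _ _ _ _ p0 p6 p5
    p8)).
have T22 : \sum_g (gr_coef (u ^+ 2) g)%:~R * sym2_char (tau g) = t2%:~R.
  exact: (sum_coprime n0 un aug1 u1 isT (k := 2) isT c2 (dot_pow3 _ _ _ _ _ _ _ _ _ _ _ _ p0 p6 p5
    p8)).
have T23 : \sum_g (gr_coef (u ^+ 3) g)%:~R * sym2_char (tau g) = 0%:Z%:~R.
  by apply: sum_3 u3_3 (augX 3) u3 _; vm_compute.
have T24 : \sum_g (gr_coef (u ^+ 4) g)%:~R * sym2_char (tau g) = t4%:~R.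
  exact: (sum_coprime n0 un aug1 u1 isT (k := 4) isT c4 (dot_pow3 _ _ _ _ _ _ _ _ _ _ _ _ p0 p6 p5
    p8)).
have T25 : \sum_g (gr_coef (u ^+ 5) g)%:~R * sym2_char (tau g) = t4%:~R.
  exact: (sum_coprime n0 un aug1 u1 isT (k := 5) isT c5 (dot_pow3 _ _ _ _ _ _ _ _ _ _ _ _ p0 p6 p5
    p8)).
have T26 : \sum_g (gr_coef (u ^+ 6) g)%:~R * sym2_char (tau g) = 0%:Z%:~R.
  by apply: sum_3 u6_3 (augX 6) u6 _; vm_compute.
have T27 : \sum_g (gr_coef (u ^+ 7) g)%:~R * sym2_char (tau g) = t2%:~R.
  exact: (sum_coprime n0 un aug1 u1 isT (k := 7) isT c7 (dot_pow3 _ _ _ _ _ _ _ _ _ _ _ _ p0 p6 p5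
    p8)).
have T28 : \sum_g (gr_coef (u ^+ 8) g)%:~R * sym2_char (tau g) = t1%:~R.
  exact: (sum_coprime n0 un aug1 u1 isT (k := 8) isT c8 (dot_pow3 _ _ _ _ _ _ _ _ _ _ _ _ p0 p6 p5
    p8)).
have tz2 : forall k, (k < 9)%N -> \sum_g (gr_coef (u ^+ k) g)%:~R * sym2_char (tau g) = (nth 0 [::
  3%:Z; t1; t2; 0%:Z; t4; t4; 0%:Z; t2; t1] k)%:~R.
  apply: (@nth_forall _ 0 [:: 3%:Z; t1; t2; 0%:Z; t4; t4; 0%:Z; t2;
    t1] (fun k z => \sum_g (gr_coef (u ^+ k) g)%:~R * sym2_char (tau g) = z%:~R) 9 erefl).
  exact: (conj T20 (conj T21 (conj T22 (conj T23 (conj T24 (conj T25 (conj T26 (conj T27 (conj T28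
    (I)))))))))).
have [p1 [[p3 p7 p4]|[p3 p7 p4]|[p3 p7 p4]]] := arith_order9 (total_paug n0 un aug1 u1)
  (unit_bound n0 un) p0 p6 p5 p8 y1 y3
  (sym2_eig n0 un isT tz2 erefl erefl (cz := (map Posz [:: 2; 2; 2; 2; 2; 2; 2; 2;
    2]%N)) (s := 2) erefl isT)
  (sym2_eig n0 un isT tz2 erefl erefl (cz := (map Posz [:: 2; 16; 16; 2; 16; 16; 2; 16;
    16]%N)) (s := 16) erefl isT)
  (sym2_eig n0 un isT tz2 erefl erefl (cz := (map Posz [:: 2; 7; 13; 16; 14; 14; 16; 13;
    7]%N)) (s := 7) erefl isT)
  (sym2_eig n0 un isT tz2 erefl erefl (cz := (map Posz [:: 2; 13; 14; 16; 7; 7; 16; 14;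
    13]%N)) (s := 13) erefl isT)
  (sym2_eig n0 un isT tz2 erefl erefl (cz := (map Posz [:: 2; 14; 7; 16; 13; 13; 16; 7;
    14]%N)) (s := 14) erefl isT).
- constructor 1; have -> : (7 : F) = 3 ^+ 2 - 2 by apply/eqP; vm_compute.
  apply: (@like_comp_reps u 3) (isT) (isT) p3 (paug_1 n0 un aug1 u1) _ y1 y3.
exact: (@seq8_ind _ (fun t => t != 3 -> paug u (comp_el t) = 0) _ _ _ _ _ _ _ _
  (fun _ => p0) (fun _ => p6) (fun _ => p5) (fun _ => p8) (fun _ => p1) (@neq_self _ _ _) (fun _
    => p7) (fun _ => p4)).
- constructor 2; have -> : (13 : F) = 7 ^+ 2 - 2 by apply/eqP; vm_compute.
apply: (@like_comp_reps u 7) (isT) (isT) p7 (paug_1 n0 un aug1 u1) _ y1 y3.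
exact: (@seq8_ind _ (fun t => t != 7 -> paug u (comp_el t) = 0) _ _ _ _ _ _ _ _
  (fun _ => p0) (fun _ => p6) (fun _ => p5) (fun _ => p8) (fun _ => p1) (fun _ => p3) (@neq_self _
    _ _) (fun _ => p4)).
- constructor 3; have -> : (14 : F) = 4 ^+ 2 - 2 by apply/eqP; vm_compute.
apply: (@like_comp_reps u 4) (isT) (isT) p4 (paug_1 n0 un aug1 u1) _ y1 y3.
exact: (@seq8_ind _ (fun t => t != 4 -> paug u (comp_el t) = 0) _ _ _ _ _ _ _ _
  (fun _ => p0) (fun _ => p6) (fun _ => p5) (fun _ => p8) (fun _ => p1) (fun _ => p3) (fun _ =>
    p7) (@neq_self _ _ _)).
Qed.

Lemma not_order6 (u : group_ring int gT) : u ^+ 6 = 1 -> augmentation u = 1 -> u ^+ 2 != 1 -> u ^+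
  3 != 1 -> False.
Proof.
move=> un aug1 u2 u3; have n0 : (0 < 6)%N by [].
have u1 : u != 1 by apply: contraNneq u2 => ->; rewrite expr1n.
have augX k : augmentation (u ^+ k) = 1 by apply: augmentationX.
have [v2 [v4 [v8 [v3 [v9 v17]]]]] := paugs_vanish n0 un.
have p6 := v4 isT.
have [p5 p8] := v8 isT.
have [p3 p7 p4] := v9 isT.
have [y1 y3] := v17 isT.
have [[c1 _ c5 _] _] := sym2_coefs; have [d1 _ d5 _] := sym4_coefs.
pose X := paug u (comp_el 0) * 16%:Z + paug u (comp_el 1%R) * 0%:Z.
pose Y := paug u (comp_el 0) * 1%:Z + paug u (comp_el 1%R) * 16%:Z.
have u2_3 : (u ^+ 2) ^+ 3 = 1 by rewrite -exprM.
have u3_2 : (u ^+ 3) ^+ 2 = 1 by rewrite -exprM.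
have u4_3 : (u ^+ 4) ^+ 3 = 1 by rewrite -exprM -[(4 * 3)%N]/(6 * 2)%N exprM un expr1n.
have u4 : u ^+ 4 != 1 by apply: contraNneq u2 => u4; move: un;
  rewrite -[6%N]/(4 + 2)%N exprD u4 mul1r => ->.
have T20 : \sum_g (gr_coef (u ^+ 0) g)%:~R * sym2_char (tau g) = 3%:Z%:~R.
  by rewrite expr0; apply: sum_one; vm_compute.
have T21 : \sum_g (gr_coef (u ^+ 1) g)%:~R * sym2_char (tau g) = X%:~R.
  exact: (sum_coprime n0 un aug1 u1 isT (k := 1) isT c1 (dot_6 _ _ _ _ _ _ _ _ _ _ p6 p5 p8 p3 p7
    p4)).
have T25 : \sum_g (gr_coef (u ^+ 5) g)%:~R * sym2_char (tau g) = X%:~R.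
  exact: (sum_coprime n0 un aug1 u1 isT (k := 5) isT c5 (dot_6 _ _ _ _ _ _ _ _ _ _ p6 p5 p8 p3 p7
    p4)).
have T22 : \sum_g (gr_coef (u ^+ 2) g)%:~R * sym2_char (tau g) = 0%:Z%:~R.
  by apply: sum_3 u2_3 (augX 2) u2 _; vm_compute.
have T24 : \sum_g (gr_coef (u ^+ 4) g)%:~R * sym2_char (tau g) = 0%:Z%:~R.
  by apply: sum_3 u4_3 (augX 4) u4 _; vm_compute.
have T23 : \sum_g (gr_coef (u ^+ 3) g)%:~R * sym2_char (tau g) = 16%:Z%:~R.
  by apply: sum_2 u3_2 (augX 3) u3 _; vm_compute.
have tz2 : forall k, (k < 6)%N -> \sum_g (gr_coef (u ^+ k) g)%:~R * sym2_char (tau g) = (nth 0 [::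
  3%:Z; X; 0%:Z; 16%:Z; 0%:Z; X] k)%:~R.
  apply: (@nth_forall _ 0 [:: 3%:Z; X; 0%:Z; 16%:Z; 0%:Z;
    X] (fun k z => \sum_g (gr_coef (u ^+ k) g)%:~R * sym2_char (tau g) = z%:~R) 6 erefl).
  exact: (conj T20 (conj T21 (conj T22 (conj T23 (conj T24 (conj T25 (I))))))).
have T40 : \sum_g (gr_coef (u ^+ 0) g)%:~R * sym4_char (tau g) = 5%:Z%:~R.
  by rewrite expr0; apply: sum_one; vm_compute.
have T41 : \sum_g (gr_coef (u ^+ 1) g)%:~R * sym4_char (tau g) = Y%:~R.
  exact: (sum_coprime n0 un aug1 u1 isT (k := 1) isT d1 (dot_6 _ _ _ _ _ _ _ _ _ _ p6 p5 p8 p3 p7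
    p4)).
have T45 : \sum_g (gr_coef (u ^+ 5) g)%:~R * sym4_char (tau g) = Y%:~R.
  exact: (sum_coprime n0 un aug1 u1 isT (k := 5) isT d5 (dot_6 _ _ _ _ _ _ _ _ _ _ p6 p5 p8 p3 p7
    p4)).
have T42 : \sum_g (gr_coef (u ^+ 2) g)%:~R * sym4_char (tau g) = 16%:Z%:~R.
  by apply: sum_3 u2_3 (augX 2) u2 _; vm_compute.
have T44 : \sum_g (gr_coef (u ^+ 4) g)%:~R * sym4_char (tau g) = 16%:Z%:~R.
  by apply: sum_3 u4_3 (augX 4) u4 _; vm_compute.
have T43 : \sum_g (gr_coef (u ^+ 3) g)%:~R * sym4_char (tau g) = 1%:Z%:~R.
  by apply: sum_2 u3_2 (augX 3) u3 _; vm_compute.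
have tz4 : forall k, (k < 6)%N -> \sum_g (gr_coef (u ^+ k) g)%:~R * sym4_char (tau g) = (nth 0 [::
  5%:Z; Y; 16%:Z; 1%:Z; 16%:Z; Y] k)%:~R.
  apply: (@nth_forall _ 0 [:: 5%:Z; Y; 16%:Z; 1%:Z; 16%:Z;
    Y] (fun k z => \sum_g (gr_coef (u ^+ k) g)%:~R * sym4_char (tau g) = z%:~R) 6 erefl).
  exact: (conj T40 (conj T41 (conj T42 (conj T43 (conj T44 (conj T45 (I))))))).
exact: (arith_order6 (total_paug n0 un aug1 u1) p6 p5 p8 p3 p7 p4 y1 y3
  (sym2_eig n0 un isT tz2 erefl erefl (cz := (map Posz [:: 2; 2; 2; 2; 2; 2]%N)) (s := 2) erefl isT)
  (sym2_eig n0 un isT tz2 erefl erefl (cz := (map Posz [:: 2; 16; 16; 2; 16;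
    16]%N)) (s := 16) erefl isT)
  (sym4_eig n0 un isT tz4 erefl erefl (cz := (map Posz [:: 2; 2; 2; 2; 2;
    2]%N)) (s := 2) erefl isT)).
Qed.

Lemma not_order16 (u : group_ring int gT) : u ^+ 16 = 1 -> augmentation u = 1 -> u ^+ 8 != 1 ->
  False.
Proof.
move=> un aug1 u8; have n0 : (0 < 16)%N by [].
have u1 : u != 1 by apply: contraNneq u8 => ->; rewrite expr1n.
have [v2 [v4 [v8 [v3 [v9 v17]]]]] := paugs_vanish n0 un.
have p1 := v3 isT.
have [p3 p7 p4] := v9 isT.
have [y1 y3] := v17 isT.
exact: (arith_order16 (total_paug n0 un aug1 u1) p1 p3 p7 p4 y1 y3
  (coef1_congruence n0 un aug1 u1 (p := 2) (a := 3) isT u8)).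
Qed.

Lemma not_order34 (u : group_ring int gT) : u ^+ 34 = 1 -> augmentation u = 1 -> u ^+ 2 != 1 -> u
  ^+ 17 != 1 -> False.
Proof.
move=> un aug1 u2 u17; have n0 : (0 < 34)%N by [].
have u1 : u != 1 by apply: contraNneq u2 => ->; rewrite expr1n.
have [v2 [v4 [v8 [v3 [v9 v17]]]]] := paugs_vanish n0 un.
have p6 := v4 isT.
have [p5 p8] := v8 isT.
have p1 := v3 isT.
have [p3 p7 p4] := v9 isT.
exact: (arith_order34 (total_paug n0 un aug1 u1) (unit_bound n0 un) p6 p5 p8 p1 p3 p7 p4
  (coef1_congruence n0 un aug1 u1 (p := 2) (a := 1) isT u2)
  (coef1_congruence n0 un aug1 u1 (p := 17) (a := 1) isT u17)).
Qed.

Lemma not_order51 (u : group_ring int gT) : u ^+ 51 = 1 -> augmentation u = 1 -> u ^+ 3 != 1 -> u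
  ^+ 17 != 1 -> False.
Proof.
move=> un aug1 u3 u17; have n0 : (0 < 51)%N by [].
have u1 : u != 1 by apply: contraNneq u3 => ->; rewrite expr1n.
have [v2 [v4 [v8 [v3 [v9 v17]]]]] := paugs_vanish n0 un.
have p0 := v2 isT.
have p6 := v4 isT.
have [p5 p8] := v8 isT.
have [p3 p7 p4] := v9 isT.
exact: (arith_order51 (total_paug n0 un aug1 u1) (unit_bound n0 un) p0 p6 p5 p8 p3 p7 p4
  (coef1_congruence n0 un aug1 u1 (p := 3) (a := 1) isT u3)
  (coef1_congruence n0 un aug1 u1 (p := 17) (a := 1) isT u17)).
Qed.

(** * A group element matching all powers of the unit *)

Definition same_powers (u v : group_ring int gT) := forall k x, paug (u ^+ k) x = paug (v ^+ k) x.

Lemma same_powers_prime (u v : group_ring int gT) p : prime p -> u ^+ p = 1 -> v ^+ p = 1 ->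
  (forall x, paug u x = paug v x) -> same_powers u v.
Proof.
move=> p_pr up vp uv k x; apply: (@paugX_pfactor _ u v p 0) => //.
by move=> j y; rewrite up vp.
Qed.

Lemma gr_elt_order (g : gT) n : #[g]%g = n -> (gr_elt g : group_ring int gT) ^+ n = 1.
Proof. by move=> <-; rewrite -gr_eltX expg_order. Qed.

Lemma same_powers_2 (u : group_ring int gT) g : u ^+ 2 = 1 -> augmentation u = 1 -> u != 1 ->
  tau g = -2 -> same_powers u (gr_elt g).
Proof.
move=> un aug1 u1 tg; apply: (@same_powers_prime _ _ 2) => //;
  last exact: (like_order2 un aug1 u1 tg).
exact/gr_elt_order/(tau_N2).
Qed.

Lemma same_powers_3 (u : group_ring int gT) g : u ^+ 3 = 1 -> augmentation u = 1 -> u != 1 ->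
  tau g = -1 -> same_powers u (gr_elt g).
Proof.
move=> un aug1 u1 tg; apply: (@same_powers_prime _ _ 3) => //;
  last exact: (like_order3 un aug1 u1 tg).
exact/gr_elt_order/(tau_3).
Qed.

Lemma same_powers_4 (u : group_ring int gT) g : u ^+ 4 = 1 -> augmentation u = 1 -> u ^+ 2 != 1 ->
  tau g = 0 -> same_powers u (gr_elt g).
Proof.
move=> un aug1 u2 tg; apply: (@paugX_pfactor _ _ _ 2 1) => //.
- exact/gr_elt_order/(tau_0).
- exact: (like_order4 un aug1 u2 tg).
rewrite -gr_eltX; apply: same_powers_2 => //; [by rewrite -exprM | exact: augmentationX | ].
by rewrite (tau_sqr) tg; apply/eqP; vm_compute.
Qed.

(** The elements of order 4 form a single class, so the square of any element of order 8 matches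
    [u ^+ 2] and only [u] itself decides between the two classes of order 8. *)
Lemma same_powers_8 (u : group_ring int gT) : u ^+ 8 = 1 -> augmentation u = 1 -> u ^+ 4 != 1 ->
  exists2 g, #[g]%g = 8%N & same_powers u (gr_elt g).
Proof.
move=> un aug1 u4.
have H t s : #[comp_el t]%g = 8%N -> t ^+ 2 - 2 == s -> s ^+ 2 - 2 == 0 -> like u s ->
    exists2 g, #[g]%g = 8%N & same_powers u (gr_elt g).
  move=> og /eqP <- /eqP t2 lu; exists (comp_el t) => //.
  apply: (@paugX_pfactor _ _ _ 2 2) => //; first exact/gr_elt_order.
    exact: lu (tau_comp t).
  rewrite -gr_eltX; apply: same_powers_4; [by rewrite -exprM | exact: augmentationX | by rewrite
    -exprM | ].
  by rewrite (tau_sqr) tau_comp.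
case: (like_order8 un aug1 u4) => lu.
  by apply: (H 5) lu; [exact: (order_comp5) | vm_compute | vm_compute].
by apply: (H 8) lu; [exact: (order_comp8) | vm_compute | vm_compute].
Qed.

Lemma same_powers_9 (u : group_ring int gT) : u ^+ 9 = 1 -> augmentation u = 1 -> u ^+ 3 != 1 ->
  exists2 g, #[g]%g = 9%N & same_powers u (gr_elt g).
Proof.
move=> un aug1 u3.
have H t s : #[comp_el t]%g = 9%N -> t ^+ 2 - 2 == s -> s ^+ 3 - 3 * s == -1 -> like u s ->
    exists2 g, #[g]%g = 9%N & same_powers u (gr_elt g).
  move=> og /eqP <- /eqP t3 lu; exists (comp_el t) => //.
  apply: (@paugX_pfactor _ _ _ 3 1) => //; first exact/gr_elt_order.
    exact: lu (tau_comp t).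
  rewrite -gr_eltX; apply: same_powers_3 => //; [by rewrite -exprM | exact: augmentationX | ].
  by rewrite (tau_cube) tau_comp.
case: (like_order9 un aug1 u3) => lu.
- by apply: (H 3) lu; [exact: (order_comp3) | vm_compute | vm_compute].
- by apply: (H 7) lu; [exact: (order_comp7) | vm_compute | vm_compute].
- by apply: (H 4) lu; [exact: (order_comp4) | vm_compute | vm_compute].
Qed.

Lemma same_powers_17 (u : group_ring int gT) : u ^+ 17 = 1 -> augmentation u = 1 -> u != 1 ->
  exists2 g, #[g]%g = 17%N & same_powers u (gr_elt g).
Proof.
move=> un aug1 u1; have n0 : (0 < 17)%N by [].
have [v2 [v4 [v8 [v3 [v9 _]]]]] := paugs_vanish n0 un.
have p0 := v2 isT; have p6 := v4 isT; have [p5 p8] := v8 isT; have p1 := v3 isT;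
  have [p3 p7 p4] := v9 isT.
have c1 := paug_1 n0 un aug1 u1.
have H r : r \in reps -> #[r]%g = 17%N -> paug u r = 1 -> (forall r', r' \in reps -> r' != r ->
  paug u r' = 0) ->
    exists2 g, #[g]%g = 17%N & same_powers u (gr_elt g).
  move=> rr orr ur uz; exists r; first exact: orr.
  apply: (@same_powers_prime u (gr_elt r) 17 isT un (gr_elt_order orr)).
  exact: (like_single rr (class_refl _ _) ur uz).
case: (paugs_order17 un aug1 u1) => -[e1 e3].
  apply: (H unip1) e1 _; [|exact: (order_unip1)|].
    by rewrite in_cons mem_cat mem_head !orbT.
  exact: (@reps_ind (fun r => r != unip1 -> paug u r = 0) (fun _ => c1) (fun _ => p0) (fun _ =>
    p6) (fun _ => p5) (fun _ => p8)
    (fun _ => p1) (fun _ => p3) (fun _ => p7) (fun _ => p4) (@neq_self _ _ _) (fun _ => e3)).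
apply: (H unip3) e3 _; [|exact: (order_unip3)|].
  by rewrite in_cons mem_cat; apply/orP; right; apply/orP; right; rewrite in_cons; apply/orP;
    right; exact: mem_head.
exact: (@reps_ind (fun r => r != unip3 -> paug u r = 0) (fun _ => c1) (fun _ => p0) (fun _ => p6)
  (fun _ => p5) (fun _ => p8)
    (fun _ => p1) (fun _ => p3) (fun _ => p7) (fun _ => p4) (fun _ => e1) (@neq_self _ _ _)).
Qed.

Lemma torsion_same_powers (u : group_ring int gT) N : (0 < N)%N -> u ^+ N = 1 -> augmentation u =
  1 -> u != 1 ->
  exists n g, [/\ (1 < n)%N, u ^+ n = 1, (gr_elt g : group_ring int gT) ^+ n = 1 & same_powers u
    (gr_elt g)].
Proof.
move=> N0 uN aug1 u1.
have exN : exists n, (0 < n)%N && (u ^+ n == 1) by exists N; rewrite N0 uN eqxx.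
case: (ex_minnP exN) => n /andP[n0 /eqP un] nmin.
have umin k : (0 < k < n)%N -> u ^+ k != 1.
  by case/andP=> k0 kn; apply: contraTneq kn => uk; rewrite -leqNgt nmin // k0 uk eqxx.
have augX k : augmentation (u ^+ k) = 1 by apply: augmentationX.
have dvd := torsion_order_dvd n0 un aug1 umin; rewrite cardG in dvd.
have D d : (0 < d)%N -> (d %| n)%N -> (u ^+ (n %/ d)) ^+ d = 1 /\ (forall k, (0 < k < d)%N -> (u
  ^+ (n %/ d)) ^+ k != 1).
  move=> d0 dn; rewrite -exprM divnK //; split=> // k /andP[k0 kd]; rewrite -exprM; apply: umin.
  have q0 : (0 < n %/ d)%N by rewrite divn_gt0 // dvdn_leq.
  by rewrite muln_gt0 q0 k0 /= -{2}(divnK dn) ltn_pmul2l.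
have n6 : ~~ (6 %| n)%N.
  apply/negP => /(D 6 isT)[w6 wk]; exact: (not_order6 w6 (augX _) (wk 2 isT) (wk 3 isT)).
have n16 : ~~ (16 %| n)%N.
  apply/negP => /(D 16 isT)[w6 wk]; exact: (not_order16 w6 (augX _) (wk 8 isT)).
have n34 : ~~ (34 %| n)%N.
  apply/negP => /(D 34 isT)[w6 wk]; exact: (not_order34 w6 (augX _) (wk 2 isT) (wk 17 isT)).
have n51 : ~~ (51 %| n)%N.
  apply/negP => /(D 51 isT)[w6 wk]; exact: (not_order51 w6 (augX _) (wk 3 isT) (wk 17 isT)).
have : n \in [:: 1; 2; 3; 4; 8; 9; 17]%N.
  (* As 2448 is 2^4 * 3^2 * 17, the divisors that remain are exactly the orders of elements of the
     group. *)
  have h : all (fun n => [&& ~~ (6 %| n), ~~ (16 %| n), ~~ (34 %| n) & ~~ (51 %| n)] ==> (n \in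
    [:: 1; 2; 3; 4; 8; 9; 17]))%N (divisors 2448) by vm_compute.
  have nd : n \in divisors 2448 by rewrite -dvdn_divisors.
  by have := allP h n nd; rewrite n6 n16 n34 n51 implyTb.
have n1 : n != 1%N by apply: contraNneq u1 => n1; rewrite -un n1.
rewrite in_cons (negPf n1) orFb !in_cons in_nil orbF.
have W (g : gT) : #[g]%g = n -> same_powers u (gr_elt g) ->
  exists n g, [/\ (1 < n)%N, u ^+ n = 1, (gr_elt g : group_ring int gT) ^+ n = 1 & same_powers u
    (gr_elt g)].
  by move=> og sp; exists n, g; split=> //; [rewrite ltn_neqAle eq_sym n1 | exact: gr_elt_order].
case/or4P=> [/eqP e|/eqP e|/eqP e|/or3P[/eqP e|/eqP e|/eqP e]]; rewrite e in un umin W.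
- apply: (W _ (order_comp0)); apply: same_powers_2 => //.
  by rewrite tau_comp; apply/eqP; vm_compute.
- apply: (W _ (order_comp1)); apply: same_powers_3 => //.
  by rewrite tau_comp; apply/eqP; vm_compute.
- apply: (W _ (order_comp6)); apply: same_powers_4 => //; first exact: umin.
  by rewrite tau_comp; apply/eqP; vm_compute.
- by case: (same_powers_8 un aug1 (umin 4 isT)) => g; apply: W.
- by case: (same_powers_9 un aug1 (umin 3 isT)) => g; apply: W.
- by case: (same_powers_17 un aug1 u1) => g; apply: W.
Qed.

End PSL217.

(** * Conclusion for PSL(2, 17) *)

Lemma ZG_to_QG_elt (gT : finGroupType) (g : gT) : ZG_to_QG (gr_elt g) = gr_elt g.
Proof. by apply: group_ringP => x; rewrite !ffunE; case: (x == g). Qed.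

Lemma card_PSL217 : #|[subg PSL 2 'F_17]| = 2448%N.
Proof. by have := card_PSL (isT : prime 17) isT; lia. Qed.

Theorem theorem2 :
  (forall u : group_ring int [subg PSL 2 'F_17],
     torsion_unit u ->
     exists (g : [subg PSL 2 'F_17])
            (x : group_ring rat [subg PSL 2 'F_17]),
       x \is a GRing.unit /\ x^-1 * ZG_to_QG u * x = gr_elt g)
  /\ Zassenhaus_conjecture [subg PSL 2 'F_17].
Proof.
have main (u : group_ring int [subg PSL 2 'F_17]) : torsion_unit u -> exists g,
  rationally_conjugate u g.
  case=> /andP[_ /eqP aug1] u1 [N N0 uN].
  have [n [g [n1 un gn sp]]] := torsion_same_powers (@det_PSL_lift 17) (@PSL_liftM 17)
    (@PSL_lift_surj 17) (@PSL_lift_inj 17) card_PSL217 N0 uN aug1 u1.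
  have [x [xU e]] := rational_intertwiner n1 un gn sp.
  exists g, x => //; by rewrite -mulrA e ZG_to_QG_elt mulKr.
split=> [u /main[g [x xU e]]|]; last exact: main.
by exists g, x.
Qed.
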